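(* Let $\varepsilon>0$, $\nu\in[0,1/2]$ and $T\ge 1$. There exists a constant $C=C(\varepsilon)$ such that \[ \left|\left\{t\in[-T,T] : \left|\sum_{M<m\le M'}\frac{1}{m^{1+it}}\right|\ge M^{-\nu}\ \text{for some } M\in[T^\varepsilon,T^{1/2}/2] \text{ and } M'\in(M,2M]\right\}\right| \] is \[ \ll_\varepsilon T^{\varepsilon}\max_{1-\nu-\varepsilon\le\alpha\le 1} T^{\frac{\alpha-(1-\nu)}{2}}N(\alpha,C\cdot T)+T^{\frac{\nu}{2}+\varepsilon}. \]
   Context: $|\cdot|$ applied to a subset of $\mathbb{R}$ denotes its Lebesgue measure. For real $\sigma$ and $T\ge 0$, $N(\sigma,T):=\#\{\rho=\beta+i\gamma:\zeta(\rho)=0,\ \beta\ge\sigma,\ |\gamma|\le T\}$, where $\zeta$ is the Riemann zeta function and zeros are counted with multiplicity. $A\ll_\varepsilon B$ means $|A|\le C'B$ with $C'$ depending only on $\varepsilon$. *)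

(* Defs.v *)
From mathcomp Require Import all_boot all_order all_algebra.
From mathcomp Require Import all_classical all_reals all_analysis.
From mathcomp Require Export complex.

Set Implicit Arguments.
Unset Strict Implicit.
Unset Printing Implicit Defensive.

Import Order.TTheory GRing.Theory Num.Theory.
Import numFieldNormedType.Exports.

Local Open Scope classical_set_scope.
Local Open Scope ring_scope.
Local Open Scope complex_scope.

Definition cexp (R : realType) (z : R[i]) : R[i] :=
  (expR (complex.Re z))%:C * (cos (complex.Im z) +i* sin (complex.Im z)).

(* m ^ s = exp (s log m), meaningful for m > 0 only. *)
Definition natcpow (R : realType) (m : nat) (s : R[i]) : R[i] :=
  cexp (s * (ln (m%:R : R))%:C).

(* The topology of R[i], and its structure of normed module over itself, are
   attached to the alias R[i]^o. *)
Definition holomorphic_at (R : realType) (f : R[i] -> R[i]) (z : R[i]) : Prop :=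
  \forall w \near (z : R[i]^o), derivable (f : R[i]^o -> R[i]^o) w 1.

(* The Riemann zeta function: the analytic continuation to C \ {1} of
   \sum_(n >= 1) n ^ (- s), Re s > 1.  By the identity theorem this determines
   zeta everywhere except at the pole 1, where its value is arbitrary. *)
Definition is_riemann_zeta (R : realType) (zeta : R[i] -> R[i]) : Prop :=
  (forall s : R[i], s != 1 -> holomorphic_at zeta s) /\
  (forall s : R[i], 1 < complex.Re s ->
     series (fun n : nat => (natcpow n.+1 s)^-1 : R[i]^o) @ \oo
       --> (zeta s : R[i]^o)).

(* The largest k such that (w - z) ^ k divides f in the ring of germs of
   holomorphic functions at z (+oo if f vanishes near z). *)
Definition zero_order (R : realType) (f : R[i] -> R[i]) (z : R[i]) : \bar R :=
  ereal_sup [set (k%:R : R)%:E | k in [set k : nat |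
    exists g : R[i] -> R[i], holomorphic_at g z /\
      \forall w \near (z : R[i]^o), f w = (w - z) ^+ k * g w]].

(* The pole 1 is excluded explicitly, zeta being unspecified there. *)
Definition zeta_zeros (R : realType) (zeta : R[i] -> R[i]) (sigma T : R) :
    set R[i] :=
  [set rho | [/\ rho != 1, zeta rho = 0, sigma <= complex.Re rho &
                 `|complex.Im rho| <= T]].

(* N(sigma, T), an extended real. *)
Definition zeta_N (R : realType) (zeta : R[i] -> R[i]) (sigma T : R) : \bar R :=
  \esum_(rho in zeta_zeros zeta sigma T) zero_order zeta rho.

(* \sum_(M < m <= M') 1 / m ^ (1 + i t), with real M and M'. *)
Definition dirichlet_sum (R : realType) (M M' t : R) : R[i] :=
  \sum_(m \in [set m : nat | M < m%:R <= M']) (natcpow m (1 +i* t))^-1.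

Definition large_value_set (R : realType) (eps nu T : R) : set R :=
  [set t | t \in `[- T, T] /\
    exists M M' : R,
      [/\ M \in `[T `^ eps, T `^ (1 / 2) / 2],
          M' \in `]M, 2 * M] &
          (M `^ (- nu))%:C <= `|dirichlet_sum M M' t|]].

(* Main.v *)
(** Cut the strip [|Im s| <= 2T] into unit strips, and let [sigma_j] be the first
    of O(1 / eps) equidistributed levels in [[1 - nu - eps / 2, 1]] with no zero
    of zeta to its right near the [j]-th strip.  There [log zeta] is defined, and
    Borel-Caratheodory followed by a two-constants inequality gives
    [zeta = O(T^o(1))] on [Re s >= sigma_j + o(1)].  Write the sum over
    [M < m <= M'] as a Perron integral on [Re s = 1 + o(1)] and move the contour
    to the staircase [Re s = sigma_j + o(1)]: the sum at height [t] is
    [<< T^o(1) \sum_j M^(sigma_j - 1) / (1 + |j - t|)].  The strips at the lowest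
    level contribute less than [M^(- nu)], so if the sum is large then the other
    strips dominate; summing over integer heights, the measure is bounded by a
    weighted number of such strips, and each of them, apart from the O(1) strips
    next to the pole, has a zero with real part at least the previous level. *)

(* All that is given about [zeta] is holomorphy off 1 and its Dirichlet series. Polynomial growth to
   the left of 1 is recovered by comparing with an Euler-Maclaurin approximation on [Re s >= 2] and
   propagating the comparison by the two-constants inequality. No residue is picked up on the way to
   the staircase. Strips within 12 of the real axis count as bad at every level, so there the
   contour stays at [Re s = 1 + dl], to the right of the pole; and the Perron kernel [dker] of a
   difference of two partial sums is entire. The cutoff is smoothed between consecutive integers to
   make the Perron integral converge absolutely. This costs a factor [M], but the truncation error,
   about [M ^ (1 + dl) / T], stays below [M ^ (- nu) >= T ^ (- 1 / 4)] because [M <= T ^ (1 / 2)].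
   The same upper bound on [M] produces the 2 in the denominator of [(alpha - (1 - nu)) / 2]. The
   lower bound [M >= T ^ eps] lets the gain [M ^ (- 3 eps / 8)] at the lowest level absorb the
   losses [T ^ dl'], with [dl' = eps ^ 2 / 16]. *)
Require Import Defs.
From HB Require Import structures.
From mathcomp Require Import all_boot all_order all_algebra.
From mathcomp Require Import all_classical all_reals all_analysis.
From mathcomp Require Import ring lra zify.

Set Implicit Arguments.
Unset Strict Implicit.
Unset Printing Implicit Defensive.

Import Order.TTheory GRing.Theory Num.Theory.
Import numFieldNormedType.Exports.

Local Open Scope classical_set_scope.
Local Open Scope ring_scope.
Local Open Scope complex_scope.

(** * Complex derivatives *)

(* Locked, like the contour integrals below, lest unification unfold it. *)
HB.lock Definition cmod (R : realType) (z : R[i]) : R := Normc.normc z.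

Section Modulus.
Variable R : realType.
Local Notation C := R[i].
Implicit Types (x y z : C) (r s : R).

Lemma cmodE z : cmod z = Num.sqrt (complex.Re z ^+ 2 + complex.Im z ^+ 2).
Proof. by rewrite unlock; case: z. Qed.

Lemma normr_cmod z : `|z| = (cmod z)%:C.
Proof. by rewrite normc_def cmodE. Qed.

Lemma cmodM x y : cmod (x * y) = cmod x * cmod y.
Proof. by rewrite unlock; exact: Normc.normcM. Qed.

Lemma cmodD x y : cmod (x + y) <= cmod x + cmod y.
Proof. by rewrite unlock; exact: le_normcD. Qed.

Lemma cmodN x : cmod (- x) = cmod x.
Proof. by rewrite unlock; exact: normcN. Qed.

Lemma cmodV x : cmod x^-1 = (cmod x)^-1.
Proof. by rewrite unlock; exact: Normc.normcV. Qed.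

Lemma cmod0 : cmod (0 : C) = 0.
Proof. by rewrite unlock; exact: Normc.normc0. Qed.
Lemma cmod1 : cmod (1 : C) = 1.
Proof. by rewrite unlock; exact: Normc.normc1. Qed.

Lemma cmod_ge0 x : 0 <= cmod x.
Proof. by rewrite cmodE sqrtr_ge0. Qed.

Lemma cmod_eq0 x : (cmod x == 0) = (x == 0).
Proof.
apply/eqP/eqP => [|->]; last exact: cmod0.
by rewrite unlock => /Normc.eq0_normc.
Qed.

Lemma cmod_gt0 x : (0 < cmod x) = (x != 0).
Proof. by rewrite lt_neqAle eq_sym cmod_eq0 cmod_ge0 andbT. Qed.

Lemma cmodB x y : cmod (x - y) <= cmod x + cmod y.
Proof. by rewrite (le_trans (cmodD _ _))// cmodN. Qed.

Lemma cmod_distC x y : cmod (x - y) = cmod (y - x).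
Proof. by rewrite -cmodN opprB. Qed.

Lemma cmodX x n : cmod (x ^+ n) = cmod x ^+ n.
Proof. by elim: n => [|n IH]; rewrite ?expr0 ?cmod1// !exprS cmodM IH. Qed.

Lemma cmodR r : cmod r%:C = `|r|.
Proof. by rewrite cmodE /= expr0n/= addr0 sqrtr_sqr. Qed.

Lemma cmodi : cmod ('i : C) = 1.
Proof. by rewrite cmodE /= expr0n/= add0r expr1n sqrtr1. Qed.

Lemma natCR n : (n%:R : C) = (n%:R : R)%:C.
Proof. by rewrite (rmorph_nat (real_complex R)). Qed.

Lemma cmod_nat n : cmod (n%:R : C) = n%:R.
Proof. by rewrite natCR cmodR ger0_norm. Qed.

Lemma cmod_Re z : `|complex.Re z| <= cmod z.
Proof.
rewrite cmodE -sqrtr_sqr ler_sqrt ?lerDl ?sqr_ge0//.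
by rewrite addr_ge0 ?sqr_ge0.
Qed.

Lemma cmod_Im z : `|complex.Im z| <= cmod z.
Proof.
rewrite cmodE -sqrtr_sqr ler_sqrt ?lerDr ?sqr_ge0//.
by rewrite addr_ge0 ?sqr_ge0.
Qed.

Lemma cmod_leD z : cmod z <= `|complex.Re z| + `|complex.Im z|.
Proof.
have {1}-> : z = (complex.Re z)%:C + 'i * (complex.Im z)%:C.
  by case: z => a b; apply/eqP; rewrite eq_complex /= !(mul0r, mul1r, mulr0, addr0, add0r, subr0) !eqxx.
by rewrite (le_trans (cmodD _ _))// cmodM cmodi mul1r !cmodR.
Qed.

Lemma cmod_sum I (r : seq I) (P : pred I) (F : I -> C) :
  cmod (\sum_(i <- r | P i) F i) <= \sum_(i <- r | P i) cmod (F i).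
Proof.
elim/big_rec2: _ => [|i a b _ h]; first by rewrite cmod0.
by rewrite (le_trans (cmodD _ _))// lerD2l.
Qed.

Lemma cmod_lb x y : cmod x - cmod y <= cmod (x + y).
Proof.
by rewrite lerBlDr -{1}(addrK y x) (le_trans (cmodB _ _)).
Qed.

Lemma ReD x y : complex.Re (x + y) = complex.Re x + complex.Re y.
Proof. by case: x y => [? ?] []. Qed.
Lemma ImD x y : complex.Im (x + y) = complex.Im x + complex.Im y.
Proof. by case: x y => [? ?] []. Qed.
Lemma ReN x : complex.Re (- x) = - complex.Re x. Proof. by case: x. Qed.
Lemma ImN x : complex.Im (- x) = - complex.Im x. Proof. by case: x. Qed.
Lemma ReB x y : complex.Re (x - y) = complex.Re x - complex.Re y.
Proof. by rewrite ReD ReN. Qed.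
Lemma ImB x y : complex.Im (x - y) = complex.Im x - complex.Im y.
Proof. by rewrite ImD ImN. Qed.
Lemma ReM x y : complex.Re (x * y) =
  complex.Re x * complex.Re y - complex.Im x * complex.Im y.
Proof. by case: x y => [? ?] []. Qed.
Lemma ImM x y : complex.Im (x * y) =
  complex.Re x * complex.Im y + complex.Im x * complex.Re y.
Proof. by case: x y => [? ?] []. Qed.

Lemma complex_eq x y :
  complex.Re x = complex.Re y -> complex.Im x = complex.Im y -> x = y.
Proof. by case: x y => [? ?] [? ?] /= -> ->. Qed.

Lemma complexDi r s : r +i* s = r%:C + 'i * s%:C.
Proof. by apply: complex_eq; rewrite /= ?ReD ?ImD ?ReM ?ImM/=; ring. Qed.

End Modulus.

Section Derivative.
Variable R : realType.
Local Notation C := R[i].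
Implicit Types (f g : C -> C) (z l m : C).

(** Differentiability as first-order approximation, measured by the real modulus: there is no
    quotient by [h], so the calculus rules reduce to real inequalities. *)
Definition cder f z l := forall e : R, 0 < e -> exists2 d : R, 0 < d &
  forall h : C, cmod h < d -> cmod (f (z + h) - f z - l * h) <= e * cmod h.

Definition cdiff f z := exists l, cder f z l.

Lemma cder_const c z : cder (fun=> c) z 0.
Proof.
move=> e e0; exists 1 => // h _.
by rewrite subrr mul0r subrr cmod0 mulr_ge0 ?cmod_ge0 ?ltW.
Qed.

Lemma cder_id z : cder id z 1.
Proof.
move=> e e0; exists 1 => // h _.
rewrite (_ : _ - _ = 0) ?cmod0 ?mulr_ge0 ?cmod_ge0 ?ltW//.
by rewrite /=; ring.
Qed.

Lemma cder_lip f z l : cder f z l -> exists2 d : R, 0 < d &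
  forall h, cmod h < d -> cmod (f (z + h) - f z) <= (cmod l + 1) * cmod h.
Proof.
move=> /(_ 1 ltr01)[d d0 fd]; exists d => // h /fd.
rewrite mul1r => fh.
rewrite (_ : f (z + h) - f z = (f (z + h) - f z - l * h) + l * h); last by ring.
by rewrite (le_trans (cmodD _ _))// cmodM; lra.
Qed.

Lemma cder_cont f z l : cder f z l -> forall e : R, 0 < e ->
  exists2 d : R, 0 < d & forall h, cmod h < d -> cmod (f (z + h) - f z) < e.
Proof.
move=> /cder_lip[d d0 fd] e e0.
have l0 : 0 < cmod l + 1 by rewrite ltr_wpDl// cmod_ge0.
exists (Num.min d (e / (cmod l + 1))) => [|h].
  by rewrite lt_min d0/= divr_gt0.
rewrite lt_min => /andP[hd he].
by rewrite (le_lt_trans (fd _ hd))// mulrC -ltr_pdivlMr.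
Qed.

Lemma cderD f g z l m : cder f z l -> cder g z m ->
  cder (fun w => f w + g w) z (l + m).
Proof.
move=> df dg e e0; have e2 : 0 < e / 2 by rewrite divr_gt0.
have [d d0 fd] := df _ e2; have [d' d'0 gd] := dg _ e2.
exists (Num.min d d') => [|h]; first by rewrite lt_min d0 d'0.
rewrite lt_min => /andP[/fd h1 /gd h2].
rewrite (_ : _ - _ - _ = (f (z + h) - f z - l * h) + (g (z + h) - g z - m * h)).
  by rewrite (le_trans (cmodD _ _))//; lra.
by ring.
Qed.

Lemma cderM f g z l m : cder f z l -> cder g z m ->
  cder (fun w => f w * g w) z (l * g z + f z * m).
Proof.
move=> df dg e e0.
have p x : 0 < cmod x + 1 :> R by rewrite ltr_wpDl// cmod_ge0.
have q x : 0 < e / 3 / (cmod x + 1) by rewrite !divr_gt0.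
have [d1 d10 fd] := df _ (q (g z)).
have [d2 d20 gd] := dg _ (q (f z)).
have [d3 d30 gc] := cder_cont dg (q l).
have [d4 d40 gc'] := cder_cont dg ltr01.
exists (Num.min (Num.min d1 d2) (Num.min d3 d4)) => [|h].
  by rewrite !lt_min d10 d20 d30 d40.
rewrite !lt_min => /andP[/andP[/fd h1 /gd h2] /andP[/gc h3 /gc' h4]].
rewrite (_ : _ - _ - _ = (f (z + h) - f z - l * h) * g (z + h) +
  f z * (g (z + h) - g z - m * h) + l * h * (g (z + h) - g z)); last by ring.
rewrite (_ : e * cmod h = e / 3 * cmod h + e / 3 * cmod h + e / 3 * cmod h);
  last by field.
apply: (le_trans (cmodD _ _)); rewrite !cmodM.
apply: lerD; first apply: (le_trans (cmodD _ _)); rewrite ?cmodM; first apply: lerD.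
- have gz : cmod (g (z + h)) <= cmod (g z) + 1.
    rewrite -{1}(subrK (g z) (g (z + h))) (le_trans (cmodD _ _))//.
    by rewrite addrC lerD2l ltW.
  rewrite (_ : _ * cmod h = e / 3 / (cmod (g z) + 1) * cmod h * (cmod (g z) + 1)).
    by apply: ler_pM => //; exact: cmod_ge0.
  by field; rewrite gt_eqF.
- apply: (@le_trans _ _ ((cmod (f z) + 1) * (e / 3 / (cmod (f z) + 1) * cmod h))).
    by apply: ler_pM; rewrite ?cmod_ge0// lerDl.
  by rewrite le_eqVlt; apply/orP; left; apply/eqP; field; rewrite gt_eqF.
- rewrite (_ : e / 3 * cmod h = (cmod l + 1) * cmod h * (e / 3 / (cmod l + 1))).
    apply: ler_pM; rewrite ?mulr_ge0 ?cmod_ge0// ?ler_wpM2r ?cmod_ge0 ?lerDl//.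
    exact: ltW.
  by field; rewrite gt_eqF.
Qed.

Lemma cder_eq f z l m : cder f z l -> l = m -> cder f z m.
Proof. by move=> ? <-. Qed.

Lemma cderZ c f z l : cder f z l -> cder (fun w => c * f w) z (c * l).
Proof.
move=> df; apply: cder_eq (cderM (cder_const c z) df) _; ring.
Qed.

Lemma cderN f z l : cder f z l -> cder (fun w => - f w) z (- l).
Proof.
move=> df e e0; have [d d0 fd] := df e e0; exists d => // h /fd.
by rewrite -cmodN; congr (cmod _ <= _); ring.
Qed.

Lemma cderB f g z l m : cder f z l -> cder g z m ->
  cder (fun w => f w - g w) z (l - m).
Proof. by move=> df /cderN; exact: cderD. Qed.

Lemma cder_comp f g z l m : cder g z m -> cder f (g z) l ->
  cder (fun w => f (g w)) z (l * m).
Proof.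
move=> dg df e e0.
have p x : 0 < cmod x + 1 :> R by rewrite ltr_wpDl// cmod_ge0.
have q x : 0 < e / 2 / (cmod x + 1) by rewrite !divr_gt0.
have [d1 d10 fd] := df _ (q m).
have [d2 d20 gd] := dg _ (q l).
have [d3 d30 gc] := cder_cont dg d10.
have [d4 d40 gl] := cder_lip dg.
exists (Num.min (Num.min d2 d3) d4) => [|h].
  by rewrite !lt_min d40 d20 d30.
rewrite !lt_min => /andP[/andP[/gd h2 /gc /fd h3] /gl h4].
move: h3; rewrite [g z + _]addrC subrK => h3.
rewrite (_ : _ - _ - _ = (f (g (z + h)) - f (g z) - l * (g (z + h) - g z)) +
  l * (g (z + h) - g z - m * h)); last by ring.
rewrite (_ : e * cmod h = e / 2 * cmod h + e / 2 * cmod h); last by field.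
apply: (le_trans (cmodD _ _)); rewrite !cmodM; apply: lerD.
- apply: (le_trans h3).
  rewrite (_ : e / 2 * cmod h = e / 2 / (cmod m + 1) * ((cmod m + 1) * cmod h)).
    by rewrite ler_wpM2l// ltW.
  by field; rewrite gt_eqF.
- apply: (@le_trans _ _ ((cmod l + 1) * (e / 2 / (cmod l + 1) * cmod h))).
    by apply: ler_pM; rewrite ?cmod_ge0// lerDl.
  by rewrite le_eqVlt; apply/orP; left; apply/eqP; field; rewrite gt_eqF.
Qed.

Lemma cder_inv z : z != 0 -> cder (fun w => w^-1) z (- z ^- 2).
Proof.
move=> z0 e e0; have zp : 0 < cmod z by rewrite cmod_gt0.
(* The remainder is [h ^+ 2 / (z ^+ 2 * (z + h))]; the first radius keeps [|z + h| >= |z| / 2], the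
   second makes the rest at most [e * |h|]. *)
exists (Num.min (cmod z / 2) (e * cmod z ^+ 3 / 2)) => [|h].
  by rewrite lt_min !divr_gt0// mulr_gt0// exprn_gt0.
rewrite lt_min => /andP[h1 h2].
have zh : cmod z / 2 <= cmod (z + h) by apply: le_trans (cmod_lb z h); lra.
have zh0 : z + h != 0 by rewrite -cmod_gt0 (lt_le_trans _ zh)// divr_gt0.
rewrite (_ : _ - _ - _ = h ^+ 2 / (z ^+ 2 * (z + h))); last first.
  by field; rewrite zh0 z0.
rewrite cmodM cmodV cmodM !cmodX expr2 mulrAC ler_wpM2r ?cmod_ge0//.
rewrite ler_pdivrMr; last by rewrite mulr_gt0 ?exprn_gt0// cmod_gt0.
apply: (@le_trans _ _ (e * (cmod z ^+ 2 * (cmod z / 2)))).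
  by move: h2; rewrite !exprS expr0 mulr1; lra.
by rewrite ler_pM2l// ler_pM2l// exprn_gt0.
Qed.

Lemma cderV f z l : f z != 0 -> cder f z l ->
  cder (fun w => (f w)^-1) z (- l / f z ^+ 2).
Proof.
move=> fz df; apply: cder_eq (cder_comp df (cder_inv fz)) _.
by rewrite mulNr mulrC mulNr.
Qed.

Lemma cder_near f g z l (d : R) : 0 < d ->
  (forall h, cmod h < d -> f (z + h) = g (z + h)) -> cder f z l -> cder g z l.
Proof.
move=> d0 fg df e e0; have [d' d'0 fd] := df e e0.
exists (Num.min d d') => [|h]; first by rewrite lt_min d0.
rewrite lt_min => /andP[hd /fd].
rewrite fg//; have := fg 0; rewrite cmod0 addr0 => -> //.
Qed.

Lemma cder_ext f g z l : f =1 g -> cder f z l -> cder g z l.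
Proof. by move=> fg; apply: (@cder_near _ _ _ _ 1) => // h _. Qed.

Lemma cderX f z l n : cder f z l ->
  cder (fun w => f w ^+ n) z (n%:R * f z ^+ n.-1 * l).
Proof.
move=> df; elim: n => [|n IH].
  by apply: cder_eq (cder_const 1 z) _; rewrite !mul0r.
apply: (@cder_ext (fun w => f w * f w ^+ n)) => [w|]; first by rewrite exprS.
apply: cder_eq (cderM df IH) _ => /=.
case: n {IH} => [|n] /=; first by rewrite expr0; ring.
by rewrite -!natr1 exprS; ring.
Qed.

Lemma cdiff_const c z : cdiff (fun=> c) z.
Proof. by exists 0; exact: cder_const. Qed.
Lemma cdiff_id z : cdiff id z.
Proof. by exists 1; exact: cder_id. Qed.
Lemma cdiffD f g z : cdiff f z -> cdiff g z -> cdiff (fun w => f w + g w) z.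
Proof. by move=> [l dl] [m dm]; exists (l + m); exact: cderD. Qed.
Lemma cdiffB f g z : cdiff f z -> cdiff g z -> cdiff (fun w => f w - g w) z.
Proof. by move=> [l dl] [m dm]; exists (l - m); exact: cderB. Qed.
Lemma cdiffM f g z : cdiff f z -> cdiff g z -> cdiff (fun w => f w * g w) z.
Proof. by move=> [l dl] [m dm]; exists (l * g z + f z * m); exact: cderM. Qed.
Lemma cdiffV f z : f z != 0 -> cdiff f z -> cdiff (fun w => (f w)^-1) z.
Proof. by move=> fz [l dl]; exists (- l / f z ^+ 2); exact: cderV. Qed.
Lemma cdiffX f z n : cdiff f z -> cdiff (fun w => f w ^+ n) z.
Proof. by move=> [l dl]; exists (n%:R * f z ^+ n.-1 * l); exact: cderX. Qed.
Lemma cdiff_comp f g z : cdiff g z -> cdiff f (g z) -> cdiff (fun w => f (g w)) z.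
Proof. by move=> [m dm] [l dl]; exists (l * m); exact: cder_comp. Qed.
Lemma cdiff_ext f g z : f =1 g -> cdiff f z -> cdiff g z.
Proof. by move=> fg [l df]; exists l; exact: cder_ext df. Qed.

Lemma cder_unique f z l m : cder f z l -> cder f z m -> l = m.
Proof.
move=> dl dm; apply/eqP; rewrite -subr_eq0 -cmod_eq0; apply/negPn/negP => lm.
have c0 : 0 < cmod (l - m) by rewrite cmod_gt0 -cmod_eq0.
have e0 : 0 < cmod (l - m) / 4 by rewrite divr_gt0.
have [d d0 fd] := dl _ e0; have [d' d'0 fd'] := dm _ e0.
pose r := Num.min d d' / 2.
have r0 : 0 < r by rewrite divr_gt0// lt_min d0.
have rr : cmod r%:C = r by rewrite cmodR gtr0_norm.
have [rd rd'] : r < d /\ r < d'.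
  by apply/andP; rewrite -lt_min /r; move: r0; rewrite /r; lra.
have := fd r%:C; have := fd' r%:C; rewrite rr => /(_ rd') h1 /(_ rd) h2.
have : cmod ((l - m) * r%:C) <= cmod (l - m) / 4 * r + cmod (l - m) / 4 * r.
  rewrite (_ : _ * _ = (f (z + r%:C) - f z - m * r%:C) - (f (z + r%:C) - f z - l * r%:C)).
    by rewrite (le_trans (cmodB _ _))// lerD.
  by ring.
rewrite cmodM rr => h3.
have := mulr_gt0 c0 r0; lra.
Qed.

End Derivative.

(** * Integrals along horizontal and vertical segments *)

Section RealIntegral.
Variable R : realType.
Implicit Types (f g F : R -> R) (a b c x : R).

Lemma is_derive_eps F x (l : R) :
  (forall e : R, 0 < e -> exists2 d : R, 0 < d & forall h : R, `|h| < d ->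
     `|F (x + h) - F x - l * h| <= e * `|h|) ->
  is_derive x 1 F l.
Proof.
move=> H.
have K : h^-1 *: ((F \o shift x) (h *: (1 : R)) - F x) @[h --> 0^'] --> l.
  apply/cvgrPdist_le => /= e /H[d d0 Hd].
  exists d => //= h /=; rewrite sub0r normrN => /Hd hd h0.
  rewrite /GRing.scale/= mulr1 [h + x]addrC.
  rewrite (_ : _ - _ = - (h^-1 * (F (x + h) - F x - l * h))); last by field.
  rewrite normrN normrM normfV ler_pdivrMl ?normr_gt0//.
  by rewrite [leRHS]mulrC.
apply: DeriveDef; first by apply/cvg_ex; exists l.
by apply/cvg_lim => //; exact: Rhausdorff.
Qed.

Lemma eps_is_derive F x (l : R) : is_derive x 1 F l ->
  forall e : R, 0 < e -> exists2 d : R, 0 < d & forall h : R, `|h| < d ->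
     `|F (x + h) - F x - l * h| <= e * `|h|.
Proof.
move=> [dF Fl] e e0.
have K : h^-1 *: ((F \o shift x) (h *: (1 : R)) - F x) @[h --> 0^'] --> l.
  by rewrite -Fl; exact: dF.
move/cvgrPdist_le : K => /(_ e e0)[d /= d0 Hd]; exists d => // h hd.
have [->|h0] := eqVneq h 0.
  by rewrite addr0 subrr mulr0 subrr normr0 mulr0.
have := Hd h; rewrite /= sub0r normrN => /(_ hd h0).
rewrite /GRing.scale/= mulr1 [h + x]addrC.
rewrite (_ : l - _ = - (h^-1 * (F (x + h) - F x - l * h))); last by field.
rewrite normrN normrM normfV ler_pdivrMl ?normr_gt0//.
by rewrite [leRHS]mulrC.
Qed.

Definition rint f a b : R := (\int[lebesgue_measure]_(x in `[a, b]) f x)%R.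

Definition rcts f a b := forall x, a <= x <= b -> {for x, continuous f}.

Lemma rcts_integrable f a b : rcts f a b ->
  lebesgue_measure.-integrable `[a, b] (EFin \o f).
Proof.
move=> cf; apply: continuous_compact_integrable; first exact: segment_compact.
apply: continuous_in_subspaceT => x; rewrite inE /= in_itv /= => xab.
exact: cf.
Qed.

Lemma rint_id f a : rint f a a = 0.
Proof. by rewrite /rint set_itv1 Rintegral_set1. Qed.

Lemma rcts_sub f a b a' b' : a <= a' -> b' <= b -> rcts f a b -> rcts f a' b'.
Proof.
move=> aa bb cf x /andP[x1 x2]; apply: cf.
by rewrite (le_trans aa)//= (le_trans x2).
Qed.

Lemma rint_cat f a b c : a <= b -> b <= c -> rcts f a c ->
  rint f a c = rint f a b + rint f b c.
Proof.
move=> ab bc cf; have bc' := rcts_sub ab (lexx c) cf.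
have := @Rintegral_itvB _ f (BLeft a) (BRight c) b.
rewrite -/(rint f a c) -/(rint f a b) => /(_ (rcts_integrable cf)).
have ab' : (BLeft a <= BRight b)%O by rewrite bnd_simp.
have bc2 : (BRight b <= BRight c)%O by rewrite bnd_simp.
move=> /(_ ab' bc2); rewrite Rintegral_itv_obnd_cbnd => [bcE|].
  by rewrite [rint f b c]/rint -bcE addrC subrK.
apply: integrableS (rcts_integrable bc') => //.
by apply: subset_itv; rewrite bnd_simp.
Qed.

Lemma rint_bound f a b B : a <= b -> rcts f a b ->
  (forall x, a <= x <= b -> `|f x| <= B :> R) -> `|rint f a b| <= B * (b - a).
Proof.
move=> ab cf fB; have If := rcts_integrable cf.
apply: (@le_trans _ _ (\int[lebesgue_measure]_(x in `[a, b]) `|f x|)%R).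
  exact: le_normr_Rintegral.
have -> : B * (b - a) = (\int[lebesgue_measure]_(x in `[a, b]) (cst B x))%R.
  rewrite [RHS]Rintegral_cst//; congr (_ * _).
  have /= := lebesgue_measure_itv (`[a, b] : interval R); rewrite lte_fin => ->.
  have [//|ba] := ltP.
  by rewrite /= (@le_anti _ _ a b) ?ab// subrr.
apply: le_Rintegral => //=.
- by have := integrable_norm If; exact.
- by apply: rcts_integrable => x _; exact: cvg_cst.
Qed.

Lemma rint_FTC f F a b : a <= b -> rcts f a b ->
  (forall x, a <= x <= b -> is_derive x 1 F (f x)) -> rint f a b = F b - F a.
Proof.
rewrite le_eqVlt => /predU1P[->|ab] cf dF.
  by rewrite rint_id subrr.
have cF x : a <= x <= b -> {for x, continuous F}.
  move=> /dF [dFx _].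
  by apply: differentiable_continuous; apply/derivable1_diffP.
rewrite /rint /Rintegral (@continuous_FTC2 _ f F)//.
- by apply: continuous_in_subspaceT => x; rewrite inE /= in_itv /=; exact: cf.
- split.
  + move=> x; rewrite in_itv/= => /andP[/ltW ax /ltW xb].
    by apply: ex_derive; apply: dF; rewrite ax.
  + by apply: cvg_at_right_filter; apply: cF; rewrite lexx ltW.
  + by apply: cvg_at_left_filter; apply: cF; rewrite lexx ltW.
- move=> x; rewrite in_itv/= => /andP[/ltW ax /ltW xb].
  by rewrite derive1E; apply: derive_val; apply: dF; rewrite ax.
Qed.

Lemma rintD f g a b : rcts f a b -> rcts g a b ->
  rint (fun x => f x + g x) a b = rint f a b + rint g a b.
Proof.
by move=> cf cg; apply: RintegralD => //; exact: rcts_integrable.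
Qed.

Lemma rintZ r f a b : rcts f a b -> rint (fun x => r * f x) a b = r * rint f a b.
Proof.
by move=> cf; apply: RintegralZl => //; exact: rcts_integrable.
Qed.

Lemma rint_eq f g a b : (forall x, a <= x <= b -> f x = g x) ->
  rint f a b = rint g a b.
Proof.
by move=> fg; apply: eq_Rintegral => x; rewrite inE /= in_itv /=; exact: fg.
Qed.

Lemma rctsD f g a b : rcts f a b -> rcts g a b -> rcts (fun x => f x + g x) a b.
Proof. by move=> cf cg x xab; apply: cvgD; [exact: cf|exact: cg]. Qed.

Lemma rctsZ r f a b : rcts f a b -> rcts (fun x => r * f x) a b.
Proof. by move=> cf x xab; apply: cvgM; [exact: cvg_cst|exact: cf]. Qed.

End RealIntegral.

Section ComplexIntegral.
Variable R : realType.
Local Notation C := R[i].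
Local Notation Re := complex.Re.
Local Notation Im := complex.Im.
Implicit Types (f g F : C -> C) (u v : R -> C) (a b c x y : R) (p w z : C).

Definition cint u a b : C :=
  rint (fun x => Re (u x)) a b +i* rint (fun x => Im (u x)) a b.

Definition ccts u a b :=
  rcts (fun x => Re (u x)) a b /\ rcts (fun x => Im (u x)) a b.

Lemma ccts_sub u a b a' b' : a <= a' -> b' <= b -> ccts u a b -> ccts u a' b'.
Proof. by move=> h k [h1 h2]; split; apply: rcts_sub _ _ _; eassumption. Qed.

Lemma cint_cat u a b c : a <= b -> b <= c -> ccts u a c ->
  cint u a c = cint u a b + cint u b c.
Proof.
by move=> ab bc [h1 h2]; rewrite /cint (rint_cat ab bc h1) (rint_cat ab bc h2).
Qed.

Lemma cint_eq u v a b : (forall x, a <= x <= b -> u x = v x) ->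
  cint u a b = cint v a b.
Proof.
by move=> uv; rewrite /cint; congr (_ +i* _); apply: rint_eq => x /uv ->.
Qed.

Lemma ccts_eq u v a b : (forall x, u x = v x) -> ccts u a b -> ccts v a b.
Proof. by move=> /funext ->. Qed.

(** The factor 2 is the price of bounding the real and the imaginary part separately; it affects
    absolute constants only. *)
Lemma cint_bound u a b B : a <= b -> ccts u a b ->
  (forall x, a <= x <= b -> cmod (u x) <= B) ->
  cmod (cint u a b) <= 2 * B * (b - a).
Proof.
move=> ab [h1 h2] uB; apply: (le_trans (cmod_leD _)) => /=.
rewrite -mulrA mulr2n mulrDl !mul1r.
by apply: lerD; apply: rint_bound => // x /uB; apply: le_trans;
  [exact: cmod_Re|exact: cmod_Im].
Qed.

Lemma cintD u v a b : ccts u a b -> ccts v a b ->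
  cint (fun x => u x + v x) a b = cint u a b + cint v a b.
Proof.
move=> [h1 h2] [h3 h4]; apply: complex_eq => /=.
  by rewrite -rintD//; apply: rint_eq => x _; rewrite ReD.
by rewrite -rintD//; apply: rint_eq => x _; rewrite ImD.
Qed.

Lemma cintZ w u a b : ccts u a b -> cint (fun x => w * u x) a b = w * cint u a b.
Proof.
move=> [h1 h2]; apply: complex_eq; rewrite /= ?ReM ?ImM/=.
  rewrite -rintZ// -mulNr -rintZ// -rintD; try exact: rctsZ.
  by apply: rint_eq => x _; rewrite ReM mulNr.
rewrite -rintZ// -rintZ// -rintD; try exact: rctsZ.
by apply: rint_eq => x _; rewrite ImM.
Qed.

Lemma cintB u v a b : ccts u a b -> ccts v a b ->
  ccts (fun x => (-1) * v x) a b ->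
  cint u a b - cint v a b = cint (fun x => u x - v x) a b.
Proof.
move=> cu cv cv'; rewrite -[in LHS](mulN1r (cint v a b)) -cintZ// -cintD//.
by apply: cint_eq => x _; rewrite mulN1r.
Qed.

Lemma cctsD u v a b : ccts u a b -> ccts v a b -> ccts (fun x => u x + v x) a b.
Proof.
move=> [h1 h2] [h3 h4]; split.
- rewrite (_ : (fun x => _) = fun x => Re (u x) + Re (v x)); first exact: rctsD.
  by apply/funext => x; rewrite ReD.
- rewrite (_ : (fun x => _) = fun x => Im (u x) + Im (v x)); first exact: rctsD.
  by apply/funext => x; rewrite ImD.
Qed.

Lemma cctsZ w u a b : ccts u a b -> ccts (fun x => w * u x) a b.
Proof.
move=> [h1 h2]; split.
- rewrite (_ : (fun x => _) = fun x => Re w * Re (u x) + - Im w * Im (u x)).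
    by apply: rctsD; exact: rctsZ.
  by apply/funext => x; rewrite ReM mulNr.
- rewrite (_ : (fun x => _) = fun x => Re w * Im (u x) + Im w * Re (u x)).
    by apply: rctsD; exact: rctsZ.
  by apply/funext => x; rewrite ImM.
Qed.

Lemma cint_sum I (r : seq I) (P : pred I) (F : I -> R -> C) a b :
  (forall i, P i -> ccts (F i) a b) ->
  cint (fun x => \sum_(i <- r | P i) F i x) a b = \sum_(i <- r | P i) cint (F i) a b
  /\ ccts (fun x => \sum_(i <- r | P i) F i x) a b.
Proof.
move=> cF; elim: r => [|i r [IH1 IH2]].
  split.
    rewrite big_nil -[RHS](mul0r (cint (fun=> 0) a b)) -cintZ.
      by apply: cint_eq => x _; rewrite big_nil mul0r.
    by split => x _; exact: cvg_cst.
  rewrite (_ : (fun x => _) = fun=> 0); first by split => x _; exact: cvg_cst.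
  by apply/funext => x; rewrite big_nil.
rewrite big_cons; case: ifPn => Pi; last first.
  rewrite (_ : (fun x => _) = fun x => \sum_(i <- r | P i) F i x) //.
  by apply/funext => x; rewrite big_cons (negbTE Pi).
rewrite (_ : (fun x => _) = fun x => F i x + \sum_(i <- r | P i) F i x).
  split; last by apply: cctsD => //; exact: cF.
  by rewrite cintD ?IH1//; exact: cF.
by apply/funext => x; rewrite big_cons Pi.
Qed.

(** Horizontal and vertical segments are both of the form [p + w * x], with [w = 1] and [w = 'i];
    continuity and the fundamental theorem are proved once for this family. *)
Lemma cdiff_line f p w x : cdiff f (p + w * x%:C) ->
  {for x, continuous (fun x => Re (f (p + w * x%:C)))} /\
  {for x, continuous (fun x => Im (f (p + w * x%:C)))}.
Proof.
move=> [l /cder_cont df].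
have K (e : R) : 0 < e -> exists2 d : R, 0 < d & forall y, `|x - y| < d ->
    cmod (f (p + w * x%:C) - f (p + w * y%:C)) < e.
  move=> /df[d d0 fd].
  have w0 : 0 < cmod w + 1 by rewrite ltr_wpDl// cmod_ge0.
  exists (d / (cmod w + 1)); first by rewrite divr_gt0.
  move=> y; rewrite ltr_pdivlMr// => xy.
  rewrite cmod_distC (_ : p + w * y%:C = p + w * x%:C + w * (y - x)%:C); last first.
    by rewrite rmorphB/=; ring.
  apply: fd; rewrite cmodM cmodR distrC; apply: le_lt_trans xy.
  by rewrite mulrC ler_wpM2l// lerDl.
split; apply/cvgrPdist_lt => /= e /K[d d0 fd]; exists d => //= y /= /fd;
  apply: le_lt_trans.
  by rewrite -ReB cmod_Re.
by rewrite -ImB cmod_Im.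
Qed.

Lemma cder_line F p w x l : cder F (p + w * x%:C) l ->
  is_derive x 1 (fun x => Re (F (p + w * x%:C))) (Re (l * w)) /\
  is_derive x 1 (fun x => Im (F (p + w * x%:C))) (Im (l * w)).
Proof.
move=> dF.
have K (e : R) : 0 < e -> exists2 d : R, 0 < d & forall h : R, `|h| < d ->
    cmod (F (p + w * (x + h)%:C) - F (p + w * x%:C) - l * w * h%:C) <= e * `|h|.
  move=> e0; have w0 : 0 < cmod w + 1 by rewrite ltr_wpDl// cmod_ge0.
  have [d d0 Fd] := dF (e / (cmod w + 1)) (divr_gt0 e0 w0).
  exists (d / (cmod w + 1)); first by rewrite divr_gt0.
  move=> h; rewrite ltr_pdivlMr// => hd.
  have wh : cmod (w * h%:C) <= `|h| * (cmod w + 1).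
    by rewrite cmodM cmodR mulrC ler_wpM2l// lerDl.
  have := Fd _ (le_lt_trans wh hd).
  have -> : p + w * (x + h)%:C = p + w * x%:C + w * h%:C.
    by rewrite rmorphD/= mulrDr addrA.
  rewrite -[l * w * _]mulrA => /le_trans; apply.
  rewrite -mulrA ler_pM2l// mulrC ler_pdivrMr//.
split; apply: is_derive_eps => e /K[d d0 Fd]; exists d => // h /Fd; apply: le_trans.
  have -> : Re (l * w) * h = Re (l * w * h%:C) by rewrite [RHS]ReM/= mulr0 subr0.
  by rewrite -!ReB cmod_Re.
have -> : Im (l * w) * h = Im (l * w * h%:C) by rewrite [RHS]ImM/= mulr0 add0r.
by rewrite -!ImB cmod_Im.
Qed.

Lemma cint_FTC f F p w a b : a <= b ->
  (forall x, a <= x <= b -> cder F (p + w * x%:C) (f (p + w * x%:C))) ->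
  ccts (fun x => f (p + w * x%:C)) a b ->
  w * cint (fun x => f (p + w * x%:C)) a b = F (p + w * b%:C) - F (p + w * a%:C).
Proof.
move=> ab dF cf; rewrite -cintZ//.
rewrite (@cint_eq _ (fun x => f (p + w * x%:C) * w)); last by move=> x _; rewrite mulrC.
have [h1 h2] := cctsZ w cf.
apply: complex_eq; rewrite /= ?ReB ?ImB.
- apply: (rint_FTC (F := fun x => Re (F (p + w * x%:C)))) => // [|x xab].
    by rewrite (_ : (fun x => _) = fun x => Re (w * f (p + w * x%:C)))//; apply/funext => x; rewrite mulrC.
  by have [] := cder_line (dF _ xab).
- apply: (rint_FTC (F := fun x => Im (F (p + w * x%:C)))) => // [|x xab].
    by rewrite (_ : (fun x => _) = fun x => Im (w * f (p + w * x%:C)))//; apply/funext => x; rewrite mulrC.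
  by have [] := cder_line (dF _ xab).
Qed.

End ComplexIntegral.

(** * Boundary integrals over rectangles *)

HB.lock Definition Hint (R : realType) (f : R[i] -> R[i]) (y a b : R) : R[i] :=
  cint (fun x => f (x +i* y)) a b.
HB.lock Definition Vint (R : realType) (f : R[i] -> R[i]) (x a b : R) : R[i] :=
  cint (fun y => f (x +i* y)) a b.
(** The boundary is run counterclockwise; the factor ['i] is [dz = i dy] on the vertical sides. *)
HB.lock Definition rect (R : realType) (f : R[i] -> R[i]) (a b c d : R) : R[i] :=
  Hint f c a b + 'i * Vint f b c d - Hint f d a b - 'i * Vint f a c d.

Section Rectangle.
Variable R : realType.
Local Notation C := R[i].
Local Notation Re := complex.Re.
Local Notation Im := complex.Im.
Implicit Types (f g F : C -> C) (a b c d x y : R) (p w z : C).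

Lemma HintE f y a b : Hint f y a b = cint (fun x => f (x +i* y)) a b.
Proof. by rewrite unlock. Qed.

Lemma VintE f x a b : Vint f x a b = cint (fun y => f (x +i* y)) a b.
Proof. by rewrite unlock. Qed.

Lemma lineH y : (fun x => x +i* y) = fun x : R => 0 +i* y + 1 * x%:C.
Proof. by apply/funext => x; apply: complex_eq; rewrite /= ?mul1r ?mul0r; ring. Qed.

Lemma cdiff_Hccts f y a b : (forall x, a <= x <= b -> cdiff f (x +i* y)) ->
  ccts (fun x => f (x +i* y)) a b.
Proof.
move=> df; have e x : x +i* y = 0 +i* y + 1 * x%:C by have := lineH y => /(congr1 (@^~ x)).
rewrite (_ : (fun x => _) = fun x => f (0 +i* y + 1 * x%:C)); last by apply/funext => x; rewrite e.
by split=> x /df; rewrite e => /cdiff_line[].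
Qed.

Lemma cdiff_Vccts f x a b : (forall y, a <= y <= b -> cdiff f (x +i* y)) ->
  ccts (fun y => f (x +i* y)) a b.
Proof.
move=> df; have e y : x +i* y = x%:C + 'i * y%:C by exact: complexDi.
rewrite (_ : (fun y => _) = fun y => f (x%:C + 'i * y%:C)); last by apply/funext => y; rewrite e.
by split=> y /df; rewrite e => /cdiff_line[].
Qed.

Lemma Hint_FTC f F y a b : a <= b ->
  (forall x, a <= x <= b -> cder F (x +i* y) (f (x +i* y))) ->
  ccts (fun x => f (x +i* y)) a b ->
  Hint f y a b = F (b +i* y) - F (a +i* y).
Proof.
have e x : x +i* y = 0 +i* y + 1 * x%:C by have := lineH y => /(congr1 (@^~ x)).
move=> ab dF cf.
have -> : Hint f y a b = 1 * cint (fun x => f (0 +i* y + 1 * x%:C)) a b.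
  by rewrite mul1r HintE; apply: cint_eq => x _; rewrite -e.
rewrite (@cint_FTC _ f F (0 +i* y) 1 a b ab) -?e//.
- by move=> x xab; rewrite -e; exact: dF.
- by apply: ccts_eq cf => x; rewrite -e.
Qed.

Lemma Vint_FTC f F x a b : a <= b ->
  (forall y, a <= y <= b -> cder F (x +i* y) (f (x +i* y))) ->
  ccts (fun y => f (x +i* y)) a b ->
  'i * Vint f x a b = F (x +i* b) - F (x +i* a).
Proof.
move=> ab dF cf; rewrite !complexDi -(@cint_FTC _ f)//.
- by rewrite VintE; congr (_ * _); apply: cint_eq => y _; rewrite complexDi.
- by move=> y yab; rewrite -complexDi; exact: dF.
- by apply: ccts_eq cf => y; rewrite complexDi.
Qed.

Definition inrect a b c d z := (a <= Re z <= b) && (c <= Im z <= d).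

Definition holr f a b c d := forall z, inrect a b c d z -> cdiff f z.

Lemma rectE f a b c d : rect f a b c d =
  Hint f c a b + 'i * Vint f b c d - Hint f d a b - 'i * Vint f a c d.
Proof. by rewrite [rect]unlock. Qed.

(** Continuity is asked on the four sides alone, so that a function with a singularity inside the
    rectangle can be integrated. *)
Definition bccts f a b c d := [/\ ccts (fun x => f (x +i* c)) a b,
  ccts (fun x => f (x +i* d)) a b, ccts (fun y => f (a +i* y)) c d &
  ccts (fun y => f (b +i* y)) c d].

Lemma holr_bccts f a b c d : a <= b -> c <= d -> holr f a b c d -> bccts f a b c d.
Proof.
move=> ab cd hf; split; (try by apply: cdiff_Hccts => x xab; apply: hf;
  rewrite /inrect /= xab ?lexx ?cd); by apply: cdiff_Vccts => x xab; apply: hf;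
  rewrite /inrect /= xab ?lexx ?ab.
Qed.

Lemma holr_sub f a b c d a' b' c' d' : a <= a' -> b' <= b -> c <= c' -> d' <= d ->
  holr f a b c d -> holr f a' b' c' d'.
Proof.
move=> h1 h2 h3 h4 hf z /andP[/andP[z1 z2] /andP[z3 z4]]; apply: hf.
apply/andP; split; apply/andP; split.
- exact: le_trans z1. - exact: le_trans h2. - exact: le_trans z3. - exact: le_trans h4.
Qed.

Lemma rect_splitx f a m b c d : a <= m -> m <= b ->
  bccts f a b c d -> rect f a b c d = rect f a m c d + rect f m b c d.
Proof.
move=> am mb [h1 h2 _ _]; rewrite !rectE !HintE (cint_cat am mb h1) (cint_cat am mb h2).
by ring.
Qed.

Lemma rect_splity f a b c m d : c <= m -> m <= d ->
  bccts f a b c d -> rect f a b c d = rect f a b c m + rect f a b m d.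
Proof.
move=> am mb [_ _ h1 h2]; rewrite !rectE !VintE (cint_cat am mb h1) (cint_cat am mb h2).
by ring.
Qed.

Lemma rect_primitive f F a b c d : a <= b -> c <= d -> bccts f a b c d ->
  (forall x, a <= x <= b -> cder F (x +i* c) (f (x +i* c)) /\
                            cder F (x +i* d) (f (x +i* d))) ->
  (forall y, c <= y <= d -> cder F (a +i* y) (f (a +i* y)) /\
                            cder F (b +i* y) (f (b +i* y))) ->
  rect f a b c d = 0.
Proof.
move=> ab cd [h1 h2 h3 h4] H V.
rewrite rectE (Hint_FTC ab (F := F) _ h1); last by move=> x /H[].
rewrite (Hint_FTC ab (F := F) _ h2); last by move=> x /H[].
rewrite (Vint_FTC cd (F := F) _ h3); last by move=> x /V[].
rewrite (Vint_FTC cd (F := F) _ h4); last by move=> x /V[].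
by ring.
Qed.

Lemma Hint_bound f y a b B : a <= b -> ccts (fun x => f (x +i* y)) a b ->
  (forall x, a <= x <= b -> cmod (f (x +i* y)) <= B) ->
  cmod (Hint f y a b) <= 2 * B * (b - a).
Proof. by move=> ab cf fB; rewrite HintE; exact: cint_bound. Qed.

Lemma Vint_bound f x a b B : a <= b -> ccts (fun y => f (x +i* y)) a b ->
  (forall y, a <= y <= b -> cmod (f (x +i* y)) <= B) ->
  cmod (Vint f x a b) <= 2 * B * (b - a).
Proof. by move=> ab cf fB; rewrite VintE; exact: cint_bound. Qed.

Lemma rect_bound f a b c d B : a <= b -> c <= d -> bccts f a b c d ->
  (forall z, inrect a b c d z -> (Re z == a) || (Re z == b) || (Im z == c) || (Im z == d)
    -> cmod (f z) <= B) ->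
  cmod (rect f a b c d) <= 4 * B * (b - a + (d - c)).
Proof.
move=> ab cd [h1 h2 h3 h4] fB.
have H y : (y == c) || (y == d) -> forall x, a <= x <= b -> cmod (f (x +i* y)) <= B.
  move=> ycd x xab; apply: fB; rewrite /inrect /= ?xab/=.
    by case/orP: ycd => /eqP ->; rewrite lexx ?cd.
  by case/orP: ycd => ->; rewrite ?orbT.
have V x : (x == a) || (x == b) -> forall y, c <= y <= d -> cmod (f (x +i* y)) <= B.
  move=> xab y ycd; apply: fB; rewrite /inrect /= ?ycd ?andbT/=.
    by case/orP: xab => /eqP ->; rewrite lexx ?ab.
  by case/orP: xab => ->; rewrite ?orbT.
have k1 := Hint_bound ab h1 (H c _); rewrite eqxx/= in k1; have {}k1 := k1 isT.
have k2 := Hint_bound ab h2 (H d _); rewrite eqxx/= orbT in k2; have {}k2 := k2 isT.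
have k3 := Vint_bound cd h3 (V a _); rewrite eqxx/= in k3; have {}k3 := k3 isT.
have k4 := Vint_bound cd h4 (V b _); rewrite eqxx/= orbT in k4; have {}k4 := k4 isT.
rewrite rectE; apply: (le_trans (cmodB _ _)); rewrite cmodM cmodi mul1r.
have := cmodB (Hint f c a b + 'i * Vint f b c d) (Hint f d a b).
have := cmodD (Hint f c a b) ('i * Vint f b c d).
rewrite cmodM cmodi mul1r => l1 l2; lra.
Qed.

Lemma rectD f g a b c d : bccts f a b c d -> bccts g a b c d ->
  rect (fun z => f z + g z) a b c d = rect f a b c d + rect g a b c d.
Proof.
move=> [h1 h2 h3 h4] [k1 k2 k3 k4].
rewrite !rectE !HintE !VintE !cintD//; ring.
Qed.

Lemma rectZ w f a b c d : bccts f a b c d ->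
  rect (fun z => w * f z) a b c d = w * rect f a b c d.
Proof.
move=> [h1 h2 h3 h4].
rewrite !rectE !HintE !VintE !cintZ//; ring.
Qed.

Lemma rect_eq f g a b c d : a <= b -> c <= d ->
  (forall z, inrect a b c d z -> (Re z == a) || (Re z == b) || (Im z == c) || (Im z == d)
    -> f z = g z) -> rect f a b c d = rect g a b c d.
Proof.
move=> ab cd fg; rewrite !rectE !HintE !VintE; congr (_ + 'i * _ - _ - 'i * _);
  apply: cint_eq => x xab; apply: fg; rewrite /inrect /= ?xab ?lexx ?ab ?cd ?eqxx ?orbT//.
Qed.

Lemma bcctsD f g a b c d : bccts f a b c d -> bccts g a b c d ->
  bccts (fun z => f z + g z) a b c d.
Proof. by move=> [? ? ? ?] [? ? ? ?]; split; exact: cctsD. Qed.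

Lemma bcctsZ w f a b c d : bccts f a b c d -> bccts (fun z => w * f z) a b c d.
Proof. by move=> [? ? ? ?]; split; exact: cctsZ. Qed.

Lemma bccts_const w a b c d : bccts (fun=> w) a b c d.
Proof. by split; split => x _; exact: cvg_cst. Qed.

Lemma rect_sum (F : nat -> C -> C) m a b c d : (forall j, bccts (F j) a b c d) ->
  bccts (fun z => \sum_(j < m) F j z) a b c d /\
  rect (fun z => \sum_(j < m) F j z) a b c d = \sum_(j < m) rect (F j) a b c d.
Proof.
move=> bF; elim: m => [|m [IH1 IH2]].
  rewrite (_ : (fun z => _) = fun=> 0 * 0).
    split; first exact: bccts_const.
    by rewrite rectZ ?mul0r ?big_ord0//; exact: bccts_const.
  by apply/funext => z; rewrite big_ord0 mulr0.
rewrite (_ : (fun z => _) = fun z => \sum_(j < m) F j z + F m z).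
  split; first exact: bcctsD.
  by rewrite rectD// IH2 big_ord_recr.
by apply/funext => z; rewrite big_ord_recr.
Qed.

(* Nested quartering: a property of the boxes [x, x + W / 2^n] x [y, y + H / 2^n]
   that is stable under gluing four quarters holds globally if it holds at
   small scales around each point. *)
Lemma quarter_ind (P : nat -> R -> R -> Prop) (W H a c : R) : 0 <= W -> 0 <= H ->
  (forall n x y, P n.+1 x y -> P n.+1 (x + W / 2 ^+ n.+1) y ->
     P n.+1 x (y + H / 2 ^+ n.+1) ->
     P n.+1 (x + W / 2 ^+ n.+1) (y + H / 2 ^+ n.+1) -> P n x y) ->
  (forall z, inrect a (a + W) c (c + H) z ->
     exists N, forall n, (N <= n)%N -> forall x y,
       inrect x (x + W / 2 ^+ n) y (y + H / 2 ^+ n) z ->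
       P n x y) ->
  P 0%N a c.
Proof.
move=> W0 H0 glue loc; apply: contrapT => nP.
(* By gluing, a failing box has a failing quarter; for a box that does not fail, any quarter will
   do. *)
have step (np : nat * (R * R)) : exists q : R * R,
    (~ P np.1 np.2.1 np.2.2 -> ~ P np.1.+1 q.1 q.2) /\
    [/\ np.2.1 <= q.1, q.1 + W / 2 ^+ np.1.+1 <= np.2.1 + W / 2 ^+ np.1,
        np.2.2 <= q.2 & q.2 + H / 2 ^+ np.1.+1 <= np.2.2 + H / 2 ^+ np.1].
  case: np => n [x y] /=.
  have half V : V / 2 ^+ n = V / 2 ^+ n.+1 + V / 2 ^+ n.+1 :> R.
    by rewrite exprS; field; rewrite expf_neq0.
  have Vp V : 0 <= V -> 0 <= V / 2 ^+ n.+1 :> R.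
    by move=> V0; rewrite divr_ge0// exprn_ge0.
  have := Vp _ W0; have := Vp _ H0; rewrite !half => HH WW.
  have [p1|] := pselect (P n.+1 x y); last by exists (x, y) => /=; split=> //; split; lra.
  have [p2|] := pselect (P n.+1 (x + W / 2 ^+ n.+1) y); last first.
    by exists (x + W / 2 ^+ n.+1, y) => /=; split=> //; split; lra.
  have [p3|] := pselect (P n.+1 x (y + H / 2 ^+ n.+1)); last first.
    by exists (x, y + H / 2 ^+ n.+1) => /=; split=> //; split; lra.
  have [p4|] := pselect (P n.+1 (x + W / 2 ^+ n.+1) (y + H / 2 ^+ n.+1)); last first.
    by exists (x + W / 2 ^+ n.+1, y + H / 2 ^+ n.+1) => /=; split=> //; split; lra.
  exists (x, y) => /=; split; last by split; lra.
  by move=> np; exfalso; apply: np; exact: glue.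
have [nxt nxtP] := choice step.
pose u := fix u n : R * R := if n is m.+1 then nxt (m, u m) else (a, c).
have nPu n : ~ P n (u n).1 (u n).2.
  by elim: n => [//|n IH] /=; have [/(_ IH)] := nxtP (n, u n).
have mono n : [/\ (u n).1 <= (u n.+1).1,
    (u n.+1).1 + W / 2 ^+ n.+1 <= (u n).1 + W / 2 ^+ n,
    (u n).2 <= (u n.+1).2 & (u n.+1).2 + H / 2 ^+ n.+1 <= (u n).2 + H / 2 ^+ n].
  by have [] := nxtP (n, u n).
(* Left ends increase and right ends decrease, so the supremum of the left ends belongs to every
   interval. *)
have sup_itv (v : nat -> R) (V : R) : 0 <= V -> (forall n, v n <= v n.+1) ->
    (forall n, v n.+1 + V / 2 ^+ n.+1 <= v n + V / 2 ^+ n) ->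
    exists s, forall n, v n <= s <= v n + V / 2 ^+ n.
  move=> V0 v1 v2.
  have up n k : v n <= v (n + k)%N.
    by elim: k => [|k IH]; rewrite ?addn0// addnS (le_trans IH).
  have dn n k : v (n + k)%N + V / 2 ^+ (n + k) <= v n + V / 2 ^+ n.
    by elim: k => [|k IH]; rewrite ?addn0// addnS (le_trans (v2 _)).
  have ub n m : v m <= v n + V / 2 ^+ n.
    have [mn|/ltnW nm] := leqP m n.
      rewrite -(subnKC mn) (le_trans (up m (n - m)%N))// lerDl.
      by rewrite divr_ge0// exprn_ge0.
    rewrite -(subnKC nm); apply: le_trans (dn n (m - n)%N); rewrite lerDl.
    by rewrite divr_ge0// exprn_ge0.
  exists (sup (range v)) => n; apply/andP; split.
    apply: ub_le_sup; last by exists n.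
    by exists (v 0%N + V / 2 ^+ 0) => _ [m _ <-].
  apply: sup_le_ub; first by exists (v 0%N), 0%N.
  by move=> _ [m _ <-].
have [x0 x0P] : exists s, forall n, (u n).1 <= s <= (u n).1 + W / 2 ^+ n.
  by apply: (sup_itv (fun n => (u n).1)) => // n; have [] := mono n.
have [y0 y0P] : exists s, forall n, (u n).2 <= s <= (u n).2 + H / 2 ^+ n.
  by apply: (sup_itv (fun n => (u n).2)) => // n; have [] := mono n.
have [|N NP] := loc (x0 +i* y0).
  by rewrite /inrect /=; have := x0P 0%N; have := y0P 0%N; rewrite /= !expr0 !divr1 => -> ->.
by apply: (nPu N); apply: NP => //; rewrite /inrect /= x0P y0P.
Qed.

End Rectangle.

(** * Cauchy theory *)

Section Cauchy.
Variable R : realType.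
Local Notation C := R[i].
Local Notation Re := complex.Re.
Local Notation Im := complex.Im.
Implicit Types (f g F : C -> C) (a b c d x y r s B : R) (p w z h : C).

Lemma inrect_dist a b c d z w : inrect a b c d z -> inrect a b c d w ->
  cmod (w - z) <= (b - a) + (d - c).
Proof.
move=> /andP[/andP[z1 z2] /andP[z3 z4]] /andP[/andP[w1 w2] /andP[w3 w4]].
apply: (le_trans (cmod_leD _)); rewrite ReB ImB.
by apply: lerD; rewrite ler_norml; apply/andP; split; lra.
Qed.

Lemma rect_glue f x y u v B : 0 <= u -> 0 <= v ->
  holr f x (x + u + u) y (y + v + v) ->
  cmod (rect f x (x + u) y (y + v)) <= B ->
  cmod (rect f (x + u) (x + u + u) y (y + v)) <= B ->
  cmod (rect f x (x + u) (y + v) (y + v + v)) <= B ->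
  cmod (rect f (x + u) (x + u + u) (y + v) (y + v + v)) <= B ->
  cmod (rect f x (x + u + u) y (y + v + v)) <= B + B + (B + B).
Proof.
move=> u0 v0 hr p1 p2 p3 p4.
rewrite (@rect_splitx _ f x (x + u)); [|lra|lra|by apply: holr_bccts => //; lra].
rewrite (@rect_splity _ f x (x + u) y (y + v)); [|lra|lra|]; last first.
  by apply: holr_bccts; [lra|lra|]; apply: holr_sub hr; lra.
rewrite (@rect_splity _ f (x + u) _ y (y + v)); [|lra|lra|]; last first.
  by apply: holr_bccts; [lra|lra|]; apply: holr_sub hr; lra.
apply: le_trans (cmodD _ _) _; apply: lerD.
  by apply: le_trans (cmodD _ _) _; apply: lerD.
by apply: le_trans (cmodD _ _) _; apply: lerD.
Qed.

(** The bound [e / 4 ^+ n] is what gluing four quarters preserves. At small scale [f] differs from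
    an affine function by a small multiple of the diameter, and the affine function has a
    primitive. *)
Theorem goursat f a b c d : a <= b -> c <= d -> holr f a b c d ->
  rect f a b c d = 0.
Proof.
move=> ab cd hf; apply/eqP; rewrite -cmod_eq0 eq_le cmod_ge0 andbT.
pose W := b - a; pose H := d - c.
have W0 : 0 <= W by rewrite subr_ge0.
have H0 : 0 <= H by rewrite subr_ge0.
have bE : b = a + W by rewrite /W addrC subrK.
have dE : d = c + H by rewrite /H addrC subrK.
clearbody W H; subst b d => {ab cd}.
suff small (e : R) : 0 < e -> cmod (rect f a (a + W) c (c + H)) <= e.
  by apply/ler_addgt0Pr => e e0; rewrite add0r small.
move=> e0.
(* The premises keep the small box inside the given rectangle, where [f] is differentiable. *)
pose P n x y := a <= x -> x + W / 2 ^+ n <= a + W ->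
  c <= y -> y + H / 2 ^+ n <= c + H ->
  cmod (rect f x (x + W / 2 ^+ n) y (y + H / 2 ^+ n)) <= e / 4 ^+ n.
have hp (V : R) n : 0 <= V -> 0 <= V / 2 ^+ n.
  by move=> V0; rewrite divr_ge0// exprn_ge0.
have half V n : V / 2 ^+ n = V / 2 ^+ n.+1 + V / 2 ^+ n.+1 :> R.
  by rewrite exprS; field; rewrite expf_neq0.
suff : P 0%N a c by rewrite /P expr0 !divr1; apply; rewrite ?lexx.
apply: (quarter_ind W0 H0) => [n x y|z zr].
  have := hp W n.+1 W0; have := hp H n.+1 H0; rewrite /P (half W n) (half H n).
  move: (H / 2 ^+ n.+1) (W / 2 ^+ n.+1) => h w; clear half hp P.
  rewrite !addrA => hh ww p1 p2 p3 p4 x1 x2 y1 y2.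
  have -> : e / 4 ^+ n = e / 4 ^+ n.+1 + e / 4 ^+ n.+1 + (e / 4 ^+ n.+1 + e / 4 ^+ n.+1).
    by rewrite exprS; field; rewrite expf_neq0.
  by apply: rect_glue => //; [apply: holr_sub hf|apply: p1|apply: p2|apply: p3|apply: p4];
    move: x1 x2 y1 y2 hh ww; clear; lra.
have [l df] : cdiff f z by exact: hf.
(* With approximation error [e * K] times the distance, a box of perimeter scale [(W + H) / 2 ^+ n]
   contributes [4 * e * K * ((W + H) / 2 ^+ n) ^+ 2], at most [e / 4 ^+ n]. The [+ 1] covers
   degenerate rectangles. *)
pose K := (4 * (W + H) ^+ 2 + 1)^-1.
have K0 : 0 < K by rewrite invr_gt0 ltr_wpDl// mulr_ge0 ?sqr_ge0.
have [dl dl0 fd] := df _ (mulr_gt0 e0 K0).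
have WH0 : 0 < W + H + 1 by lra.
have [N NP] : exists N, forall n, (N <= n)%N -> (W + H) / 2 ^+ n < dl.
  exists (Num.truncn ((W + H) / dl)).+1 => n Nn.
  rewrite ltr_pdivrMr ?exprn_gt0// mulrC -ltr_pdivrMr//.
  have k1 : (W + H) / dl < (Num.truncn ((W + H) / dl)).+1%:R.
    by apply: truncnS_gt.
  apply: (lt_le_trans k1); apply: (@le_trans _ _ n%:R); first by rewrite ler_nat.
  by rewrite -natrX ler_nat ltnW// ltn_expl.
exists N => n /NP ndl x y zxy x1 x2 y1 y2.
have ww := hp W n W0; have hh := hp H n H0.
have wh : W / 2 ^+ n + H / 2 ^+ n = (W + H) / 2 ^+ n by rewrite mulrDl.
move: (H / 2 ^+ n) (W / 2 ^+ n) zxy x1 x2 y1 y2 hh ww wh => h w zxy x1 x2 y1 y2 hh ww wh.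
clear NP hp half P.
have hr : holr f x (x + w) y (y + h) by apply: holr_sub hf.
pose A v := f z + l * (v - z).
have dA v : cder A v l.
  apply: cder_eq (cderD (cder_const (f z) v) (cderZ l (cderB (cder_id v) (cder_const z v)))) _.
  by ring.
pose PA v := f z * v + l * ((v - z) ^+ 2 / 2%:R).
have dPA v : cder PA v (A v).
  have := cderD (cderZ (f z) (cder_id v))
   (cderZ l (cderM (cderX 2 (cderB (cder_id v) (cder_const z v))) (cder_const (2%:R^-1) v))).
  by move=> /cder_eq; apply; rewrite /A /= expr1 subr0 !mulr1 mulr0 addr0; field.
have bA : bccts A x (x + w) y (y + h).
  by apply: holr_bccts; [lra|lra|move=> v' _; exists l].
have bf : bccts f x (x + w) y (y + h) by apply: holr_bccts => //; lra.
have bE : bccts (fun v => f v - A v) x (x + w) y (y + h).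
  apply: holr_bccts; [lra|lra|move=> v' vr; apply: cdiffB; first exact: hr].
  by exists l.
rewrite (_ : rect f _ _ _ _ = rect (fun v => (f v - A v) + A v) x (x + w) y (y + h)); last first.
  by apply: rect_eq; [lra|lra|move=> v' _ _; rewrite subrK].
rewrite rectD// (@rect_primitive _ A PA) ?addr0//; [|lra|lra].

apply: (le_trans (@rect_bound _ _ _ _ _ _ (e * K * (w + h)) _ _ bE _)); [lra|lra| |].
  move=> v vr _; rewrite /A opprD addrA.
  have vz := inrect_dist zxy vr; rewrite ![_ + w]addrC ![_ + h]addrC !addrK in vz.
  have := fd (v - z); rewrite [z + _]addrC subrK => fv.
  apply: le_trans (fv _) _; first by apply: le_lt_trans vz _; rewrite wh.
  by rewrite ler_wpM2l// mulr_ge0// ltW.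
rewrite [x + w]addrC [y + h]addrC !addrK wh.
have -> : 4 * (e * K * ((W + H) / 2 ^+ n)) * ((W + H) / 2 ^+ n) =
    e / 4 ^+ n * (4 * (W + H) ^+ 2 * K); last first.
  rewrite ler_piMr ?divr_ge0 ?exprn_ge0 ?(ltW e0)//.
  by rewrite /K ler_pdivrMr ?mul1r ?lerDl// -invr_gt0.
have -> : (4 : R) ^+ n = (2 ^+ n) ^+ 2 by rewrite -exprM mulnC exprM; congr (_ ^+ _); ring.
by field; rewrite expf_neq0.
Qed.

(** Compactness by the same bisection: a differentiable function is locally bounded, and bounds on
    four quarters add up to a bound on their union. *)
Lemma rect_bounded f a b c d : a <= b -> c <= d -> holr f a b c d ->
  exists2 B, 0 <= B & forall z, inrect a b c d z -> cmod (f z) <= B.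
Proof.
move=> ab cd hf.
pose W := b - a; pose H := d - c.
have W0 : 0 <= W by rewrite subr_ge0.
have H0 : 0 <= H by rewrite subr_ge0.
have bE : b = a + W by rewrite /W addrC subrK.
have dE : d = c + H by rewrite /H addrC subrK.
clearbody W H; subst b d => {ab cd}.
have hp (V : R) n : 0 <= V -> 0 <= V / 2 ^+ n.
  by move=> V0; rewrite divr_ge0// exprn_ge0.
have half V n : V / 2 ^+ n = V / 2 ^+ n.+1 + V / 2 ^+ n.+1 :> R.
  by rewrite exprS; field; rewrite expf_neq0.
pose P n x y := exists2 B : R, 0 <= B &
  forall z, inrect x (x + W / 2 ^+ n) y (y + H / 2 ^+ n) z -> cmod (f z) <= B.
have : P 0%N a c; last by rewrite /P expr0 !divr1.
apply: (quarter_ind W0 H0) => [n x y|z zr].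
  rewrite /P (half W n) (half H n); set h := H / _; set w := W / _.
  move=> [B1 B10 b1] [B2 B20 b2] [B3 B30 b3] [B4 B40 b4].
  exists (B1 + B2 + B3 + B4) => [|z /andP[/andP[z1 z2] /andP[z3 z4]]]; first by lra.
  have [h1|h1] := leP (Re z) (x + w); have [h2|h2] := leP (Im z) (y + h).
  - by apply: le_trans (b1 z _) _; [rewrite /inrect z1 h1 z3 h2|lra].
  - by apply: le_trans (b3 z _) _; [rewrite /inrect z1 h1 -!addrA z4 (ltW h2)|lra].
  - by apply: le_trans (b2 z _) _; [rewrite /inrect z3 h2 -!addrA z2 (ltW h1)|lra].
  - by apply: le_trans (b4 z _) _; [rewrite /inrect -!addrA z4 (ltW h2) z2 (ltW h1)|lra].
have [l df] : cdiff f z by exact: hf.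
have [dl dl0 fd] := cder_cont df ltr01.
have [N NP] : exists N, forall n, (N <= n)%N -> (W + H) / 2 ^+ n < dl.
  exists (Num.truncn ((W + H) / dl)).+1 => n Nn.
  rewrite ltr_pdivrMr ?exprn_gt0// mulrC -ltr_pdivrMr//.
  have k1 : (W + H) / dl < (Num.truncn ((W + H) / dl)).+1%:R.
    by apply: truncnS_gt.
  apply: (lt_le_trans k1); apply: (@le_trans _ _ n%:R); first by rewrite ler_nat.
  by rewrite -natrX ler_nat ltnW// ltn_expl.
exists N => n /NP ndl x y zxy; exists (cmod (f z) + 1) => [|v vr].
  by rewrite addr_ge0// cmod_ge0.
have vz := inrect_dist zxy vr; rewrite ![_ + _ / _]addrC !addrK -mulrDl in vz.
have := fd _ (le_lt_trans vz ndl); rewrite [z + _]addrC subrK => fv.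
have := cmodD (f v - f z) (f z); rewrite subrK; lra.
Qed.

Lemma bd_bccts f a b c d : a <= b -> c <= d ->
  (forall z, inrect a b c d z ->
    (Re z == a) || (Re z == b) || (Im z == c) || (Im z == d) -> cdiff f z) ->
  bccts f a b c d.
Proof.
by move=> ab cd df; split; (apply: cdiff_Hccts || apply: cdiff_Vccts) => x xab;
  apply: df; rewrite /inrect /= ?xab ?lexx ?ab ?cd ?eqxx ?orbT.
Qed.

(** Extending the vertical sides of the inner rectangle cuts the region between the two into four
    rectangles (left, right, below, above), and Goursat kills each of them. *)
Lemma rect_annulus f A B0 c0 D a b c d :
  A <= a -> a <= b -> b <= B0 -> c0 <= c -> c <= d -> d <= D ->
  (forall z, inrect A B0 c0 D z -> ~~ ((a < Re z < b) && (c < Im z < d)) ->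
     cdiff f z) ->
  rect f A B0 c0 D = rect f a b c d.
Proof.
move=> Aa ab bB Cc cd dD df.
have AB : A <= B0 by rewrite (le_trans Aa)// (le_trans ab).
have CD : c0 <= D by rewrite (le_trans Cc)// (le_trans cd).
have aB : a <= B0 by exact: le_trans bB.
have cD : c <= D by exact: le_trans dD.
have Ab : A <= b by exact: le_trans ab.
have Cd : c0 <= d by exact: le_trans cd.
have sub x1 x2 y1 y2 : A <= x1 -> x2 <= B0 -> c0 <= y1 -> y2 <= D ->
    forall z, inrect x1 x2 y1 y2 z -> inrect A B0 c0 D z.
  move=> k1 k2 k3 k4 z /andP[/andP[z1 z2] /andP[z3 z4]]; rewrite /inrect.
  by rewrite (le_trans k1 z1) (le_trans z2 k2) (le_trans k3 z3) (le_trans z4 k4).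
rewrite (rect_splitx Aa aB); last first.
  apply: bd_bccts => // z zr /orP[/orP[/orP[]|]|] /eqP zE; apply: df => //;
  by rewrite negb_and; apply/orP; rewrite !negb_and -!leNgt zE ?Aa ?bB ?Cc ?dD ?orbT; auto.
rewrite (rect_splitx ab bB); last first.
  apply: bd_bccts => // z zr /orP[/orP[/orP[]|]|] /eqP zE; apply: df;
    rewrite ?(sub _ _ _ _ _ _ _ _ _ zr)//;
  by rewrite negb_and; apply/orP; rewrite !negb_and -!leNgt zE ?lexx ?Aa ?bB ?Cc ?dD ?orbT; auto.
rewrite (rect_splity (a := a) Cc cD); last first.
  apply: bd_bccts => // z zr /orP[/orP[/orP[]|]|] /eqP zE; apply: df;
    rewrite ?(sub _ _ _ _ _ _ _ _ _ zr)//;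
  by rewrite negb_and; apply/orP; rewrite !negb_and -!leNgt zE ?lexx ?Aa ?bB ?Cc ?dD ?orbT; auto.
rewrite (rect_splity (c := c) cd dD); last first.
  apply: bd_bccts => // z zr /orP[/orP[/orP[]|]|] /eqP zE; apply: df;
    rewrite ?(sub _ _ _ _ _ _ _ _ _ zr)//;
  by rewrite negb_and; apply/orP; rewrite !negb_and -!leNgt zE ?lexx ?Aa ?bB ?Cc ?dD ?orbT; auto.
rewrite [rect f A a _ _]goursat//; last first.
  move=> z zr; apply: df; first exact: sub zr.
  by case/andP: zr => /andP[_ z1] _; rewrite !negb_and -!leNgt z1.
rewrite [rect f b _ _ _]goursat//; last first.
  move=> z zr; apply: df; first exact: sub zr.
  by case/andP: zr => /andP[z1 _] _; rewrite !negb_and -!leNgt z1 orbT.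
rewrite [rect f _ _ c0 _]goursat//; last first.
  move=> z zr; apply: df; first exact: sub zr.
  by case/andP: zr => _ /andP[_ z1]; rewrite !negb_and -!leNgt z1 orbT.
rewrite [rect f _ _ d _]goursat//; last first.
  move=> z zr; apply: df; first exact: sub zr.
  by case/andP: zr => _ /andP[z1 _]; rewrite !negb_and -!leNgt z1 !orbT.
by rewrite !add0r !addr0.
Qed.

(** Squares of half-side [r] play the part of circles throughout, integrals being taken along
    horizontal and vertical segments. *)
Definition sq f p r := rect f (Re p - r) (Re p + r) (Im p - r) (Im p + r).
Definition insq p r z := inrect (Re p - r) (Re p + r) (Im p - r) (Im p + r) z.

Lemma insqP p r z : insq p r z = (`|Re (z - p)| <= r) && (`|Im (z - p)| <= r).
Proof.
by rewrite /insq /inrect ReB ImB !ler_distl.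
Qed.

Lemma insq_cmod p r z : cmod (z - p) <= r -> insq p r z.
Proof.
by move=> zp; rewrite insqP !(le_trans _ zp) ?cmod_Re ?cmod_Im.
Qed.

Lemma cmod_insq p r z : insq p r z -> cmod (z - p) <= 2 * r.
Proof.
rewrite insqP => /andP[z1 z2]; apply: (le_trans (cmod_leD _)).
by rewrite mulr2n mulrDl !mul1r lerD.
Qed.

Lemma insq_bd p r z : 0 <= r -> insq p r z ->
  (Re z == Re p - r) || (Re z == Re p + r) || (Im z == Im p - r) ||
    (Im z == Im p + r) -> r <= cmod (z - p).
Proof.
move=> r0 _ /orP[/orP[/orP[]|]|] /eqP zE.
- apply: le_trans (cmod_Re _); rewrite ReB zE (_ : _ - _ - _ = - r); last by ring.
  by rewrite normrN ger0_norm.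
- apply: le_trans (cmod_Re _); rewrite ReB zE (_ : _ + _ - _ = r); last by ring.
  by rewrite ger0_norm.
- apply: le_trans (cmod_Im _); rewrite ImB zE (_ : _ - _ - _ = - r); last by ring.
  by rewrite normrN ger0_norm.
- apply: le_trans (cmod_Im _); rewrite ImB zE (_ : _ + _ - _ = r); last by ring.
  by rewrite ger0_norm.
Qed.

Lemma rect_punctured f A B0 c0 D p r : 0 < r ->
  A <= Re p - r -> Re p + r <= B0 -> c0 <= Im p - r -> Im p + r <= D ->
  (forall z, inrect A B0 c0 D z -> z != p -> cdiff f z) ->
  rect f A B0 c0 D = sq f p r.
Proof.
move=> r0 h1 h2 h3 h4 df; apply: rect_annulus => //; [lra|lra|].
move=> z zr nz; apply: df => //; apply: contraNneq nz => ->.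
by rewrite !gtrBl !ltrDl r0.
Qed.

(** The integral equals that over any small square around [p], which is [O(M * r)], hence smaller
    than every [e]. *)
Lemma rect_removable f A B0 c0 D p M (dl : R) : A < Re p < B0 -> c0 < Im p < D ->
  (forall z, inrect A B0 c0 D z -> z != p -> cdiff f z) ->
  0 < dl -> (forall z, z != p -> cmod (z - p) < dl -> cmod (f z) <= M) ->
  rect f A B0 c0 D = 0.
Proof.
move=> /andP[h1 h2] /andP[h3 h4] df dl0 fM.
apply/eqP; rewrite -cmod_eq0 eq_le cmod_ge0 andbT.
suff small (e : R) : 0 < e -> cmod (rect f A B0 c0 D) <= e.
  by apply/ler_addgt0Pr => e e0; rewrite add0r small.
move=> e0.
have M0 : 0 < `|M| + 1 by rewrite ltr_wpDl.
pose r := Num.min (Num.min (Num.min (Re p - A) (B0 - Re p))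
  (Num.min (Im p - c0) (D - Im p))) (Num.min (dl / 4) (e / (16 * (`|M| + 1)))).
have r0 : 0 < r by rewrite !lt_min !subr_gt0 h1 h2 h3 h4 !divr_gt0// mulr_gt0.
have [r1 r2 r3 r4 [r5 r6]] : [/\ r <= Re p - A, r <= B0 - Re p, r <= Im p - c0,
    r <= D - Im p & r <= dl / 4 /\ r <= e / (16 * (`|M| + 1))].
  have : r <= r by []; rewrite {2}/r !le_min.
  by move=> /andP[/andP[/andP[-> ->] /andP[-> ->]] /andP[-> ->]].
clearbody r; rewrite (@rect_punctured f A B0 c0 D p r)//; [|clear -r1 r2 r3 r4; lra..].
have dfb z : insq p r z -> z != p -> cdiff f z.
  move=> /andP[/andP[z1 z2] /andP[z3 z4]]; apply: df.
  by rewrite /inrect; apply/andP; split; apply/andP; split; clear -r1 r2 r3 r4 z1 z2 z3 z4; lra.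
have zp z : insq p r z -> (Re z == Re p - r) || (Re z == Re p + r) ||
    (Im z == Im p - r) || (Im z == Im p + r) -> z != p.
  move=> z1 z2; rewrite -subr_eq0 -cmod_gt0.
  by apply: lt_le_trans (insq_bd (ltW r0) z1 z2).
have := @rect_bound _ f (Re p - r) (Re p + r) (Im p - r) (Im p + r) (`|M| + 1).
move=> /(_ _ _ _ _)/le_trans -> //; [clear -r0; lra|clear -r0; lra| | |].
- apply: bd_bccts; [clear -r0; lra|clear -r0; lra|] => z z1 z2; apply: dfb => //; exact: zp.
- move=> z z1 z2; apply: le_trans (fM _ (zp _ z1 z2) _) _.
    by apply: le_lt_trans (cmod_insq z1) _; clear -r5 dl0; lra.
  by rewrite (le_trans (ler_norm _))// lerDl.
- rewrite (_ : Re p + r - (Re p - r) + (Im p + r - (Im p - r)) = 4 * r); last by ring.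
  move: r6; rewrite ler_pdivlMr; last by rewrite mulr_gt0.
  by move=> ?; lra.
Qed.

(** The contribution of a pair of opposite sides of a square to its winding number: the primitive
    [2 * atan ((x - q) / r)] runs from [- pi / 2] to [pi / 2]. *)
Lemma rint_atan (q r : R) : 0 < r ->
  (forall x : R, {for x, continuous (fun x => 2 * r / ((x - q) ^+ 2 + r ^+ 2))}) ->
  rint (fun x => 2 * r / ((x - q) ^+ 2 + r ^+ 2)) (q - r) (q + r) = pi.
Proof.
move=> r0 cf.
have dF x : is_derive x 1 (fun x => 2 * atan ((x - q) / r)) (2 * r / ((x - q) ^+ 2 + r ^+ 2)).
  have dg : is_derive x 1 (fun x => (x - q) / r) r^-1.
    apply: is_derive_eps => e e0; exists 1 => // h _.
    rewrite (_ : _ - _ - _ = 0) ?normr0 ?mulr_ge0 ?(ltW e0)//.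
    by field; rewrite gt_eqF.
  apply: is_derive_eq (is_deriveZ 2 (is_derive1_comp (is_derive1_atan _) dg)) _.
  have xr : (x - q) ^+ 2 + r ^+ 2 != 0 by rewrite gt_eqF// ltr_wpDl ?sqr_ge0 ?exprn_gt0.
  rewrite /GRing.scale/=; field.
  by rewrite !(gt_eqF, ltr_wpDl, sqr_ge0, exprn_gt0).
rewrite (rint_FTC (F := fun x => 2 * atan ((x - q) / r)));
  [|by lra|by move=> x _; exact: cf].
rewrite (_ : (q + r - q) / r = 1); last by field; rewrite gt_eqF.
rewrite (_ : (q - r - q) / r = - 1); last by field; rewrite gt_eqF.
by rewrite atanN atan1; field.
Qed.

Lemma rint0 a b : rint (fun=> 0 : R) a b = 0.
Proof.
rewrite -[RHS](mul0r (rint (fun=> 0) a b)) -rintZ.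
  by apply: rint_eq => x _; rewrite mul0r.
by move=> x _; exact: cvg_cst.
Qed.

Lemma subV (x y : C) (S : R) : S != 0 -> x * y = S%:C -> x^-1 - y^-1 = (y - x) / S%:C.
Proof.
move=> S0 xyS; have SC : S%:C != 0 by rewrite -cmod_eq0 cmodR normr_eq0.
have := SC; rewrite -xyS mulf_eq0 negb_or => /andP[x0 y0].
by field; rewrite x0 y0.
Qed.

Lemma divCR (z : C) (S : R) : z / S%:C = (Re z / S) +i* (Im z / S).
Proof.
rewrite -fmorphV; apply: complex_eq; rewrite ?ReM ?ImM /=; ring.
Qed.

Definition twopii : C := 0 +i* (pi *+ 2).

(** Opposite sides are paired before integrating: the difference of the two inverses is a multiple
    of the real integrand of [rint_atan]. Each pair contributes ['i * pi]. *)
Lemma sq_inv p r : 0 < r -> sq (fun w => (w - p)^-1) p r = twopii.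
Proof.
move=> r0.
have dinv w : w != p -> cdiff (fun w => (w - p)^-1) w.
  move=> wp; apply: cdiffV; first by rewrite subr_eq0.
  by apply: cdiffB; [exact: cdiff_id|exact: cdiff_const].
have bb : bccts (fun w => (w - p)^-1) (Re p - r) (Re p + r) (Im p - r) (Im p + r).
  apply: bd_bccts; [lra|lra|] => z z1 z2; apply: dinv.
  by rewrite -subr_eq0 -cmod_gt0 (lt_le_trans r0)// insq_bd ?ltW.
case: bb => b1 b2 b3 b4.
have cont (q : R) : forall x : R, {for x, continuous (fun x => 2 * r / ((x - q) ^+ 2 + r ^+ 2))}.
  move=> x; apply: cvgM; first exact: cvg_cst.
  have n0 : (x - q) ^+ 2 + r ^+ 2 != 0 by rewrite gt_eqF// ltr_wpDl ?sqr_ge0 ?exprn_gt0.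
  apply: cvgV => //; apply: cvgD; last exact: cvg_cst.
  by apply: cvgM; (apply: cvgB; [exact: cvg_id|exact: cvg_cst]).
have nz (x q : R) : (x - q) ^+ 2 + r ^+ 2 != 0.
  by rewrite gt_eqF// ltr_wpDl ?sqr_ge0 ?exprn_gt0.
have H : Hint (fun w => (w - p)^-1) (Im p - r) (Re p - r) (Re p + r)
    - Hint (fun w => (w - p)^-1) (Im p + r) (Re p - r) (Re p + r) = 0 +i* pi.
  rewrite !HintE cintB//; last exact: cctsZ.
  rewrite (@cint_eq _ _ (fun x => 0 +i* (2 * r / ((x - Re p) ^+ 2 + r ^+ 2)))).
    by rewrite /cint /= rint_atan// rint0.
  move=> x _; set S := (x - Re p) ^+ 2 + r ^+ 2.
  rewrite (@subV _ _ S) ?nz//.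
    by rewrite divCR; congr (_ +i* _); rewrite ?ReB ?ImB /=; field; rewrite nz.
  by apply: complex_eq; rewrite ?ReM ?ImM /= ?ReB ?ImB /= /S; ring.
have V : Vint (fun w => (w - p)^-1) (Re p + r) (Im p - r) (Im p + r)
    - Vint (fun w => (w - p)^-1) (Re p - r) (Im p - r) (Im p + r) = pi%:C.
  rewrite !VintE cintB//; last exact: cctsZ.
  rewrite (@cint_eq _ _ (fun x => (2 * r / ((x - Im p) ^+ 2 + r ^+ 2))%:C)).
    by rewrite /cint /= rint_atan// rint0.
  move=> x _; set S := (x - Im p) ^+ 2 + r ^+ 2.
  rewrite (@subV _ _ (- S)) ?oppr_eq0 ?nz//.
    by rewrite divCR; congr (_ +i* _); rewrite ?ReB ?ImB /=; field; rewrite ?oppr_eq0 nz.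
  by apply: complex_eq; rewrite ?ReM ?ImM /= ?ReB ?ImB /= /S; ring.
rewrite /sq rectE (_ : _ - _ - _ = (Hint (fun w => (w - p)^-1) (Im p - r) (Re p - r) (Re p + r)
    - Hint (fun w => (w - p)^-1) (Im p + r) (Re p - r) (Re p + r)) + 'i *
   (Vint (fun w => (w - p)^-1) (Re p + r) (Im p - r) (Im p + r)
    - Vint (fun w => (w - p)^-1) (Re p - r) (Im p - r) (Im p + r))); last by ring.
by rewrite H V; apply: complex_eq; rewrite /= ?mulr2n; ring.
Qed.

Lemma twopii_neq0 : twopii != 0.
Proof. by rewrite eq_complex /= mulrn_eq0/= (gt_eqF (pi_gt0 _)) andbF. Qed.

Lemma cmod_twopii_inv : cmod twopii^-1 <= 4^-1.
Proof.
rewrite cmodV lef_pV2 ?posrE ?cmod_gt0 ?twopii_neq0//.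
apply: le_trans (cmod_Im _); rewrite /= ger0_norm; last by rewrite mulrn_wge0// pi_ge0.
by rewrite mulr2n; have := pi_ge2 R; lra.
Qed.

(** Subtracting [f p] from the numerator leaves a quotient bounded near [p], whose integral
    vanishes; the rest is [f p] times [sq_inv]. *)
Lemma cauchy_formula f a b c d p : a < Re p < b -> c < Im p < d -> holr f a b c d ->
  rect (fun w => f w / (w - p)) a b c d = twopii * f p.
Proof.
move=> pab pcd hf.
have [ap pb] := andP pab; have [cp pd] := andP pcd.
have [l dfp] : cdiff f p by apply: hf; rewrite /inrect !(ltW ap, ltW pb, ltW cp, ltW pd).
have dinv w : w != p -> cdiff (fun w => (w - p)^-1) w.
  move=> wp; apply: cdiffV; first by rewrite subr_eq0.
  by apply: cdiffB; [exact: cdiff_id|exact: cdiff_const].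
have bdp z : (Re z == a) || (Re z == b) || (Im z == c) || (Im z == d) -> z != p.
  by apply: contraTneq => ->; rewrite !(lt_eqF pb, gt_eqF ap, lt_eqF pd, gt_eqF cp).
have ab : a <= b by rewrite ltW// (lt_trans ap).
have cd : c <= d by rewrite ltW// (lt_trans cp).
pose r := Num.min (Num.min (Re p - a) (b - Re p)) (Num.min (Im p - c) (d - Im p)).
have r0 : 0 < r by rewrite !lt_min !subr_gt0 ap pb cp pd.
have [r1 r2 r3 r4] : [/\ r <= Re p - a, r <= b - Re p, r <= Im p - c & r <= d - Im p].
  have : r <= r by []; rewrite {2}/r !le_min.
  by move=> /andP[/andP[-> ->] /andP[-> ->]].
rewrite (@rect_eq _ _ (fun w => (f w - f p) / (w - p) + f p * (w - p)^-1))//; last first.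
  by move=> z _ _; ring.
have dq z : inrect a b c d z -> z != p -> cdiff (fun w => (f w - f p) / (w - p)) z.
  move=> zr zp; apply: cdiffM; last exact: dinv.
  by apply: cdiffB; [exact: hf|exact: cdiff_const].
rewrite rectD; last 2 first.
- by apply: bd_bccts => // z zr /bdp zp; exact: dq.
- apply: bd_bccts => // z zr /bdp zp; apply: cdiffM; [exact: cdiff_const|exact: dinv].
rewrite rectZ; last by apply: bd_bccts => // z zr /bdp zp; exact: dinv.
rewrite (@rect_punctured (fun w => (w - p)^-1) a b c d p r)//; [|lra|lra|lra|lra|]; last first.
  by move=> z _; exact: dinv.
have [dl dl0 fd] := cder_lip dfp.
rewrite (@rect_removable _ a b c d p (cmod l + 1) dl)//; last first.
  move=> z zp zd; have := fd _ zd; rewrite [p + _]addrC subrK => h.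
  by rewrite cmodM cmodV ler_pdivrMr ?cmod_gt0 ?subr_eq0.
by rewrite add0r sq_inv// mulrC.
Qed.

End Cauchy.

(** * Taylor expansion with explicit remainder, and its consequences *)

Section Taylor.
Variable R : realType.
Local Notation C := R[i].
Local Notation Re := complex.Re.
Local Notation Im := complex.Im.
Local Notation twopii := (twopii R).
Implicit Types (f g F : C -> C) (r s B : R) (p a z w h : C) (j n : nat).

(** The Taylor coefficient of order [j] at [a], as the contour integral of Cauchy. *)
Definition tcoef f a r j : C := twopii^-1 * sq (fun w => f w / (w - a) ^+ j.+1) a r.

Lemma cdiff_pole f a z j : z != a -> cdiff f z -> cdiff (fun w => f w / (w - a) ^+ j) z.
Proof.
move=> za df; apply: cdiffM => //; apply: cdiffV; first by rewrite expf_neq0// subr_eq0.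
by apply: cdiffX; apply: cdiffB; [exact: cdiff_id|exact: cdiff_const].
Qed.

Lemma sq_bound f a r B : 0 <= r ->
  (forall z, insq a r z -> r <= cmod (z - a) -> cdiff f z) ->
  (forall z, insq a r z -> r <= cmod (z - a) -> cmod (f z) <= B) ->
  cmod (sq f a r) <= 16 * r * B.
Proof.
move=> r0 df fB; apply: (@le_trans _ _ (4 * B * (Re a + r - (Re a - r) + (Im a + r - (Im a - r))))).
  apply: rect_bound; [lra|lra| |].
    by apply: bd_bccts; [lra|lra|] => z z1 z2; apply: df => //; exact: insq_bd.
  by move=> z z1 z2; apply: fB => //; exact: insq_bd.
by rewrite (_ : 4 * B * _ = 16 * r * B)//; ring.
Qed.

(** Cauchy's estimate. The constant is 16 from the perimeter in [sq_bound], times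
    [1 / 4 >= 1 / (2 pi)]. *)
Lemma tcoef_bound f a r B j : 0 < r -> (forall z, insq a r z -> cdiff f z) ->
  (forall z, insq a r z -> cmod (f z) <= B) ->
  cmod (tcoef f a r j) <= 4 * B / r ^+ j.
Proof.
move=> r0 df fB; rewrite cmodM.
have B0 : 0 <= B.
  by apply: le_trans (fB a _); [exact: cmod_ge0|apply: insq_cmod; rewrite subrr cmod0 ltW].
apply: (@le_trans _ _ (4^-1 * (16 * r * (B / r ^+ j.+1)))).
  apply: ler_pM; rewrite ?cmod_ge0 ?cmod_twopii_inv//.
  apply: sq_bound; [exact: ltW| |] => z z1 z2.
    by apply: cdiff_pole; [rewrite -subr_eq0 -cmod_gt0 (lt_le_trans r0)|exact: df].
  rewrite cmodM cmodV cmodX ler_pM ?invr_ge0 ?exprn_ge0 ?cmod_ge0 ?fB//.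
  rewrite lef_pV2 ?posrE ?exprn_gt0 ?(lt_le_trans r0)//.
  by rewrite lerXn2r// nnegrE ?cmod_ge0 ?ltW.
by rewrite le_eqVlt; apply/orP; left; apply/eqP; rewrite exprS; field; rewrite expf_neq0 gt_eqF.
Qed.

Lemma tcoef_radius f a r s j : 0 < s -> s <= r ->
  (forall z, insq a r z -> cdiff f z) -> tcoef f a r j = tcoef f a s j.
Proof.
move=> s0 sr df; congr (_ * _).
apply: rect_punctured => //; [lra|lra|lra|lra|].
by move=> z zr za; apply: cdiff_pole => //; exact: df.
Qed.

Lemma geom_inv (u h : C) n : u != 0 -> u != h ->
  (u - h)^-1 = \sum_(j < n) h ^+ j / u ^+ j.+1 + h ^+ n / (u ^+ n * (u - h)).
Proof.
move=> u0 uh; elim: n => [|n IH]; first by rewrite big_ord0 add0r !expr0 !mul1r.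
rewrite big_ord_recr /= {1}IH -addrA; congr (_ + _).
rewrite -subr_eq0 in uh; rewrite !exprS; field.
by rewrite uh u0 expf_neq0.
Qed.

(** The finite geometric expansion of [1 / (w - a - h)] is inserted into Cauchy's formula. On the
    boundary [|w - a| >= r], which gives both the power of [|h| / r] and the denominator
    [r - |h|]. *)
Lemma taylor f a r B n h : 0 < r -> (forall z, insq a r z -> cdiff f z) ->
  (forall z, insq a r z -> cmod (f z) <= B) -> cmod h < r ->
  cmod (f (a + h) - \sum_(j < n) tcoef f a r j * h ^+ j) <=
  4 * r * B * (cmod h / r) ^+ n / (r - cmod h).
Proof.
move=> r0 df fB hr.
have B0 : 0 <= B.
  by apply: le_trans (fB a _); [exact: cmod_ge0|apply: insq_cmod; rewrite subrr cmod0 ltW].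
have bd z : r <= cmod (z - a) -> z - a != 0 /\ z - a != h.
  move=> rz; split; first by rewrite -cmod_gt0 (lt_le_trans r0).
  by apply: contraTneq rz => ->; rewrite -ltNge.
have cf : sq (fun w => f w / (w - (a + h))) a r = twopii * f (a + h).
  have [h1 h2] := (cmod_Re h, cmod_Im h).
  rewrite !ler_norml in h1 h2; case/andP: h1 => ? ?; case/andP: h2 => ? ?.
  by apply: cauchy_formula => //; rewrite ?ReD ?ImD; apply/andP; split; lra.
pose rem w := f w * (h ^+ n / ((w - a) ^+ n * (w - a - h))).
have dT (j : nat) z : insq a r z -> r <= cmod (z - a) ->
    cdiff (fun w => h ^+ j * (f w / (w - a) ^+ j.+1)) z.
  move=> z1 /bd[z2 _]; apply: cdiffM; first exact: cdiff_const.
  by apply: cdiff_pole; [rewrite -subr_eq0|exact: df].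
have drem z : insq a r z -> r <= cmod (z - a) -> cdiff rem z.
  move=> z1 /bd[z2 z3]; apply: cdiffM; first exact: df.
  apply: cdiffM; first exact: cdiff_const.
  have dza : cdiff (fun w => w - a) z by apply: cdiffB; [exact: cdiff_id|exact: cdiff_const].
  apply: cdiffV; first by rewrite mulf_neq0 ?expf_neq0// subr_eq0.
  by apply: cdiffM; [exact: cdiffX|apply: cdiffB => //; exact: cdiff_const].
have key : twopii * f (a + h) =
    \sum_(j < n) h ^+ j * sq (fun w => f w / (w - a) ^+ j.+1) a r + sq rem a r.
  have bT j : bccts (fun w => f w / (w - a) ^+ j.+1)
      (Re a - r) (Re a + r) (Im a - r) (Im a + r).
    apply: bd_bccts => [| |z z1 /(insq_bd (ltW r0) z1)/bd[z2 _]]; [lra|lra|].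
    by apply: cdiff_pole; [rewrite -subr_eq0|exact: df].
  have [S1 S2] := rect_sum n (fun j => bcctsZ (h ^+ j) (bT j)).
  have brem : bccts rem (Re a - r) (Re a + r) (Im a - r) (Im a + r).
    by apply: bd_bccts => [| |z z1 /(insq_bd (ltW r0) z1)]; [lra|lra|exact: drem].
  rewrite -cf /sq; under eq_bigr do rewrite -rectZ//.
  rewrite -S2 -rectD//; apply: rect_eq => [| |z z1 /(insq_bd (ltW r0) z1)/bd[z2 z3]].
  - by lra.
  - by lra.
  rewrite opprD addrA (geom_inv n z2 z3) mulrDr mulr_sumr; congr (_ + _).
  by apply: eq_bigr => j _; ring.
have -> : f (a + h) - \sum_(j < n) tcoef f a r j * h ^+ j = twopii^-1 * sq rem a r.
  apply: (mulfI (twopii_neq0 R)); rewrite mulrBr key mulrA divff ?twopii_neq0// mul1r.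
  rewrite mulr_sumr addrAC -sumrB big1 ?add0r// => j _.
  by rewrite /tcoef -mulrA mulVKf ?twopii_neq0// mulrC subrr.
rewrite cmodM.
apply: (@le_trans _ _ (4^-1 * (16 * r * (B * (cmod h ^+ n / (r ^+ n * (r - cmod h))))))).
  apply: ler_pM; rewrite ?cmod_ge0 ?cmod_twopii_inv//.
  apply: sq_bound; [exact: ltW|exact: drem|] => z z1 z2.
  rewrite !cmodM cmodV cmodM !cmodX ler_pM ?mulr_ge0 ?invr_ge0 ?mulr_ge0 ?exprn_ge0 ?cmod_ge0 ?fB//.
  rewrite ler_wpM2l ?exprn_ge0 ?cmod_ge0//.
  have zh : r - cmod h <= cmod (z - a - h).
    by apply: le_trans (cmod_lb _ _); rewrite cmodN lerD2r.
  have rh : 0 < r - cmod h by rewrite subr_gt0.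
  have p1 := lt_le_trans r0 z2; have p2 := lt_le_trans rh zh.
  rewrite lef_pV2 ?posrE ?mulr_gt0 ?exprn_gt0//.
  rewrite ler_pM ?exprn_ge0 ?(ltW r0) ?(ltW rh)//.
  by rewrite lerXn2r// nnegrE ?cmod_ge0 ?ltW.
rewrite le_eqVlt; apply/orP; left; apply/eqP; rewrite expr_div_n; field.
by rewrite subr_eq0 (gt_eqF hr) expf_neq0// gt_eqF.
Qed.

Lemma insq_sub p r s : s <= r -> forall z, insq p s z -> insq p r z.
Proof.
by move=> sr z; rewrite !insqP => /andP[z1 z2]; rewrite (le_trans z1)// (le_trans z2).
Qed.

Lemma insq_shift p z r s w : insq p r z -> insq z s w -> insq p (r + s) w.
Proof.
rewrite !insqP => /andP[z1 z2] /andP[w1 w2].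
rewrite (_ : w - p = (z - p) + (w - z)); last by ring.
by rewrite ReD ImD !(le_trans (ler_normD _ _))// lerD.
Qed.

(* Two-constants inequality: a bound [B] on the large square and a small bound
   [e] on the small one interpolate, through the Taylor coefficients. *)
Lemma two_constants f a r s B (e : R) n h : 0 < s -> s <= r ->
  (forall z, insq a r z -> cdiff f z) ->
  (forall z, insq a r z -> cmod (f z) <= B) ->
  (forall z, insq a s z -> cmod (f z) <= e) -> cmod h < r ->
  cmod (f (a + h)) <= \sum_(j < n) 4 * e * (cmod h / s) ^+ j +
    4 * r * B * (cmod h / r) ^+ n / (r - cmod h).
Proof.
move=> s0 sr df fB fe hr; have r0 := lt_le_trans s0 sr.
rewrite -[f (a + h)](subrK (\sum_(j < n) tcoef f a r j * h ^+ j)) addrC.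
apply: (le_trans (cmodD _ _)); apply: lerD; last exact: taylor.
apply: (le_trans (cmod_sum _ _ _)); apply: ler_sum => j _.
rewrite cmodM cmodX (tcoef_radius j s0 sr df) expr_div_n mulrA mulrAC.
rewrite ler_wpM2r ?exprn_ge0 ?cmod_ge0//.
by apply: tcoef_bound => // z /(insq_sub sr); exact: df.
Qed.

Lemma insq_bounded f a r : 0 <= r -> (forall z, insq a r z -> cdiff f z) ->
  exists2 B : R, 0 <= B & forall z, insq a r z -> cmod (f z) <= B.
Proof. by move=> r0 df; apply: rect_bounded => //; lra. Qed.

Lemma taylor0 f a r : 0 < r -> (forall z, insq a r z -> cdiff f z) ->
  tcoef f a r 0 = f a.
Proof.
move=> r0 df; have [B B0 fB] := insq_bounded (ltW r0) df.
have := @taylor f a r B 1 0 r0 df fB; rewrite cmod0 => /(_ r0).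
rewrite addr0 big_ord1 expr0 mulr1 mul0r expr1 mulr0 mul0r => h.
apply/eqP; rewrite eq_sym -subr_eq0 -cmod_eq0 eq_le cmod_ge0 andbT.
by apply: le_trans h _; rewrite ?mul0r.
Qed.

Lemma taylor_loc f a r B n h : 0 < r -> (forall z, insq a r z -> cdiff f z) ->
  (forall z, insq a r z -> cmod (f z) <= B) -> cmod h <= r / 2 ->
  cmod (f (a + h) - \sum_(j < n) tcoef f a r j * h ^+ j) <=
  8 * B / r ^+ n * cmod h ^+ n.
Proof.
move=> r0 df fB hr; have hr' : cmod h < r by lra.
have B0 : 0 <= B.
  by apply: le_trans (fB a _); [exact: cmod_ge0|apply: insq_cmod; rewrite subrr cmod0 ltW].
apply: (le_trans (taylor n r0 df fB hr')).
rewrite expr_div_n ler_pdivrMr ?subr_gt0//.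
rewrite (_ : 4 * r * B * _ = 8 * B / r ^+ n * cmod h ^+ n * (r / 2)); last by field; rewrite expf_neq0// gt_eqF.
rewrite ler_wpM2l//; last by lra.
by rewrite mulr_ge0 ?exprn_ge0 ?cmod_ge0// divr_ge0 ?exprn_ge0 ?mulr_ge0 ?(ltW r0).
Qed.

Lemma tcoef_cder f a r : 0 < r -> (forall z, insq a r z -> cdiff f z) ->
  cder f a (tcoef f a r 1).
Proof.
move=> r0 df e e0; have [B B0 fB] := insq_bounded (ltW r0) df.
have K0 : 0 < 8 * B / r ^+ 2 + 1.
  by rewrite ltr_wpDl// divr_ge0 ?exprn_ge0 ?mulr_ge0 ?(ltW r0).
exists (Num.min (r / 2) (e / (8 * B / r ^+ 2 + 1))) => [|h].
  by rewrite lt_min !divr_gt0.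
rewrite lt_min => /andP[/ltW h1 h2].
have := taylor_loc 2 r0 df fB h1.
rewrite big_ord_recr /= big_ord1 expr0 expr1 mulr1 taylor0// opprD addrA => /le_trans; apply.
rewrite expr2 mulrA ler_wpM2r ?cmod_ge0//.
move: h2; rewrite ltr_pdivlMr// => /ltW h2; apply: le_trans h2.
by rewrite mulrC ler_wpM2l ?cmod_ge0// lerDl.
Qed.

Definition cdv f z : C := xget 0 [set l | cder f z l].

Lemma cdvP f z : cdiff f z -> cder f z (cdv f z).
Proof. by move=> [l df]; rewrite /cdv; case: xgetP => [//|/(_ l)]. Qed.

(* Expanding at [z] and at [w = z + h] to third order and evaluating at
   [w + h] and [w - h] expresses [f' w] through the expansion at [z]. *)
Lemma cdiff_cdv f p r : 0 < r -> (forall z, insq p r z -> cdiff f z) ->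
  cdiff (cdv f) p.
Proof.
move=> r0 df; have [B B0 fB] := insq_bounded (ltW r0) df.
pose s := r / 2; have s0 : 0 < s by rewrite divr_gt0.
have dw w : insq p s w -> forall z, insq w s z -> cdiff f z /\ cmod (f z) <= B.
  move=> pw z wz; have := insq_shift pw wz.
  by rewrite (_ : s + s = r) => [pz|]; [split; [exact: df|exact: fB]|rewrite /s; field].
pose K := 8 * B / s ^+ 3.
have K0 : 0 <= K by apply: divr_ge0; [exact: mulr_ge0|exact: exprn_ge0 (ltW s0)].
have pp : insq p s p by apply: insq_cmod; rewrite subrr cmod0 ltW.
have T w k : insq p s w -> cmod k <= s / 2 -> 
    cmod (f (w + k) - (f w + cdv f w * k + tcoef f w s 2 * k ^+ 2)) <= K * cmod k ^+ 3.
  move=> /dw pw ks.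
  have d1 z : insq w s z -> cdiff f z by case/pw.
  have d2 z : insq w s z -> cmod (f z) <= B by case/pw.
  have := taylor_loc 3 s0 d1 d2 ks.
  rewrite !big_ord_recr big_ord0 /= add0r expr0 expr1 mulr1 taylor0//.
  have -> // : tcoef f w s 1 = cdv f w.
  apply: cder_unique (tcoef_cder s0 d1) (cdvP _).
  by apply: d1; apply: insq_cmod; rewrite subrr cmod0 ltW.
clearbody K; exists (2 * tcoef f p s 2) => e e0.
exists (Num.min (s / 4) (e / (5 * K + 1))) => [|h].
  by rewrite lt_min !divr_gt0// ltr_wpDl// mulr_ge0.
rewrite lt_min => /andP[h1 h2].
have [->|h0] := eqVneq h 0.
  by rewrite addr0 subrr mulr0 subrr cmod0 mulr0.
have hp : 0 < cmod h by rewrite cmod_gt0.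
have ph : insq p s (p + h) by apply: insq_cmod; rewrite [p + h]addrC addrK; lra.
have hs : cmod h <= s / 2 by lra.
have hs' : cmod (- h) <= s / 2 by rewrite cmodN.
have hs2 : cmod (2 * h) <= s / 2.
  by rewrite cmodM cmod_nat; lra.
have t1 := T _ _ ph hs; have t2 := T _ _ ph hs'; have t3 := T _ _ pp hs2.
rewrite cmodN addrK in t2.
rewrite -addrA (_ : h + h = 2 * h) in t1; last by ring.
(* The quadratic terms at [p + h] cancel between the increments [h] and [- h]; the constant is
   [10 = 1 + 1 + 2 ^ 3]. *)
have E : cmod (2 * h * (cdv f (p + h) - cdv f p - 2 * tcoef f p s 2 * h)) <= 10 * K * cmod h ^+ 3.
  rewrite (_ : _ * _ = (f p - (f (p + h) + cdv f (p + h) * - h + tcoef f (p + h) s 2 * (- h) ^+ 2)) -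
     (f (p + 2 * h) - (f (p + h) + cdv f (p + h) * h + tcoef f (p + h) s 2 * h ^+ 2)) +
     (f (p + 2 * h) - (f p + cdv f p * (2 * h) + tcoef f p s 2 * (2 * h) ^+ 2))); last by ring.
  apply: (le_trans (cmodD _ _)); apply: (@le_trans _ _ (K * cmod h ^+ 3 + K * cmod h ^+ 3 + K * (2 * cmod h) ^+ 3)).
    apply: lerD; first by apply: (le_trans (cmodB _ _)); exact: lerD.
    apply: le_trans t3 _.
    by rewrite cmodM cmod_nat.
  by rewrite exprMn; lra.
move: E; rewrite !cmodM cmod_nat.
rewrite (_ : 10 * K * _ = 2 * cmod h * (5 * K * cmod h * cmod h)); last by ring.
rewrite ler_pM2l ?mulr_gt0// => /le_trans; apply.
rewrite ler_wpM2r ?cmod_ge0//.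
move: h2; rewrite ltr_pdivlMr ?ltr_wpDl ?mulr_ge0// => /ltW; apply: le_trans.
by rewrite mulrC ler_wpM2l ?cmod_ge0// lerDl.
Qed.

(* [f w / (w - p)], extended by [f' p]; used only when [f p = 0]. *)
Definition cquo f p w : C := if w == p then cdv f p else f w / (w - p).

Lemma cquoE f p w : w != p -> cquo f p w = f w / (w - p).
Proof. by rewrite /cquo => /negbTE ->. Qed.

Lemma cquoM f p w : f p = 0 -> f w = (w - p) * cquo f p w.
Proof.
have [->|wp] := eqVneq w p => fp; first by rewrite subrr mul0r.
by rewrite cquoE// mulrC divfK ?subr_eq0.
Qed.

Lemma cdiff_cquo_off f p z : z != p -> cdiff f z -> cdiff (cquo f p) z.
Proof.
move=> zp df.
have [l dg] : cdiff (fun w => f w / (w - p)) z.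
  apply: cdiffM => //; apply: cdiffV; first by rewrite subr_eq0.
  by apply: cdiffB; [exact: cdiff_id|exact: cdiff_const].
exists l; apply: (cder_near (d := cmod (z - p))) dg; first by rewrite cmod_gt0 subr_eq0.
move=> h hz; rewrite cquoE//; apply: contraTneq hz => zh.
by rewrite -leNgt -cmodN -zh (_ : - (z - (z + h)) = h)//; ring.
Qed.

(** Only the point [p] needs an argument: there the second-order Taylor expansion of [f], divided by
    [h], shows that the derivative of the quotient is the coefficient of order 2. *)
Lemma cdiff_cquo f p r : 0 < r -> (forall z, insq p r z -> cdiff f z) -> f p = 0 ->
  forall z, cdiff f z -> cdiff (cquo f p) z.
Proof.
move=> r0 df fp0 z dfz; have [->|zp] := eqVneq z p; last exact: cdiff_cquo_off.
have [B B0 fB] := insq_bounded (ltW r0) df.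
exists (tcoef f p r 2) => e e0.
have K0 : 0 <= 8 * B / r ^+ 3 by rewrite divr_ge0 ?exprn_ge0 ?mulr_ge0 ?(ltW r0).
exists (Num.min (r / 2) (e / (8 * B / r ^+ 3 + 1))) => [|h].
  by rewrite lt_min !divr_gt0// ltr_wpDl.
rewrite lt_min => /andP[/ltW h1 h2].
have [->|h0] := eqVneq h 0.
  by rewrite addr0 subrr mulr0 subrr cmod0 mulr0.
have hp : 0 < cmod h by rewrite cmod_gt0.
have := taylor_loc 3 r0 df fB h1.
rewrite !big_ord_recr big_ord0 /= add0r expr0 expr1 mulr1 taylor0// fp0 add0r.
have -> : tcoef f p r 1 = cdv f p.
  apply: cder_unique (tcoef_cder r0 df) (cdvP _).
  by apply: df; apply: insq_cmod; rewrite subrr cmod0 ltW.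
move=> T; rewrite cquoE; last by rewrite -subr_eq0 [p + h]addrC addrK.
rewrite {1}/cquo eqxx [p + h - p]addrAC subrr add0r.
rewrite (_ : _ - _ - _ = h^-1 * (f (p + h) - (cdv f p * h + tcoef f p r 2 * h ^+ 2))); last by field.
rewrite cmodM cmodV ler_pdivrMl//; apply: le_trans T _.
rewrite (_ : 8 * B / r ^+ 3 * cmod h ^+ 3 =
  cmod h * (8 * B / r ^+ 3 * cmod h * cmod h)); last by ring.
rewrite ler_pM2l// ler_pM2r//.
move: h2; rewrite ltr_pdivlMr ?ltr_wpDl// => /ltW; apply: le_trans.
by rewrite mulrC ler_wpM2l ?cmod_ge0// lerDl.
Qed.

End Taylor.

(** * Primitives and logarithms *)

Section MeanValue.
Variable R : realType.
Local Notation C := R[i].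
Local Notation Re := complex.Re.
Local Notation Im := complex.Im.
Implicit Types (f g F : C -> C) (r s B x y : R) (p a z w h : C).

Lemma mvt_ineq_H f F y (a b : R) (c : C) B : a <= b ->
  (forall x, a <= x <= b -> cder F (x +i* y) (f (x +i* y))) ->
  (forall x, a <= x <= b -> cdiff f (x +i* y)) ->
  (forall x, a <= x <= b -> cmod (f (x +i* y) - c) <= B) ->
  cmod (F (b +i* y) - F (a +i* y) - c * (b - a)%:C) <= 2 * B * (b - a).
Proof.
move=> ab dF df fB.
have cf : ccts (fun x => f (x +i* y) - c) a b.
  by apply: (@cdiff_Hccts _ (fun w => f w - c)) => x /df ?; apply: cdiffB => //; exact: cdiff_const.
have := @Hint_FTC _ (fun w => f w - c) (fun w => F w - c * w) y a b ab _ cf.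
move=> E.
have -> : F (b +i* y) - F (a +i* y) - c * (b - a)%:C = Hint (fun w => f w - c) y a b.
  rewrite E => [|x xab].
    have -> : (b - a)%:C = b +i* y - a +i* y.
      by apply: complex_eq; rewrite ?ReB ?ImB /=; ring.
    by ring.
  apply: cderB; first exact: dF.
  by have := cderZ c (cder_id (x +i* y)); rewrite mulr1.
exact: Hint_bound.
Qed.

Lemma mvt_ineq_V f F x (a b : R) (c : C) B : a <= b ->
  (forall y, a <= y <= b -> cder F (x +i* y) (f (x +i* y))) ->
  (forall y, a <= y <= b -> cdiff f (x +i* y)) ->
  (forall y, a <= y <= b -> cmod (f (x +i* y) - c) <= B) ->
  cmod (F (x +i* b) - F (x +i* a) - c * ('i * (b - a)%:C)) <= 2 * B * (b - a).
Proof.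
move=> ab dF df fB.
have cf : ccts (fun y => f (x +i* y) - c) a b.
  by apply: (@cdiff_Vccts _ (fun w => f w - c)) => y /df ?; apply: cdiffB => //; exact: cdiff_const.
have := @Vint_FTC _ (fun w => f w - c) (fun w => F w - c * w) x a b ab _ cf.
move=> E.
have -> : F (x +i* b) - F (x +i* a) - c * ('i * (b - a)%:C) = 'i * Vint (fun w => f w - c) x a b.
  rewrite E => [|y yab].
    have -> : 'i * (b - a)%:C = x +i* b - x +i* a.
      by apply: complex_eq; rewrite ?ReM ?ImM ?ReB ?ImB /=; ring.
    by ring.
  apply: cderB; first exact: dF.
  by have := cderZ c (cder_id (x +i* y)); rewrite mulr1.
by rewrite cmodM cmodi mul1r; exact: Vint_bound.
Qed.

Lemma insq_Re_Im p r x y : insq p r (x +i* y) =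
  (Re p - r <= x <= Re p + r) && (Im p - r <= y <= Im p + r).
Proof. by []. Qed.

Lemma cder0_const F p r : 0 <= r -> (forall z, insq p r z -> cder F z 0) ->
  forall z, insq p r z -> F z = F p.
Proof.
move=> r0 dF; have H y u v : u <= v -> insq p r (u +i* y) -> insq p r (v +i* y) ->
    F (v +i* y) = F (u +i* y).
  move=> uv; rewrite !insq_Re_Im => /andP[/andP[u1 u2] yy] /andP[/andP[v1 v2] _].
  have := @mvt_ineq_H (fun=> 0) F y u v 0 0 uv.
  rewrite !mul0r !subr0 mulr0 mul0r => E; apply/eqP.
  rewrite -subr_eq0 -cmod_eq0 eq_le cmod_ge0 andbT; apply: E => x /andP[x1 x2].
  - by apply: dF; rewrite insq_Re_Im yy (le_trans u1 x1) (le_trans x2 v2).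
  - exact: cdiff_const.
  - by rewrite cmod0.
have V x u v : u <= v -> insq p r (x +i* u) -> insq p r (x +i* v) ->
    F (x +i* v) = F (x +i* u).
  move=> uv; rewrite !insq_Re_Im => /andP[xx /andP[u1 u2]] /andP[_ /andP[v1 v2]].
  have := @mvt_ineq_V (fun=> 0) F x u v 0 0 uv.
  rewrite !mul0r !subr0 mulr0 mul0r => E; apply/eqP.
  rewrite -subr_eq0 -cmod_eq0 eq_le cmod_ge0 andbT; apply: E => y /andP[y1 y2].
  - by apply: dF; rewrite insq_Re_Im xx (le_trans u1 y1) (le_trans y2 v2).
  - exact: cdiff_const.
  - by rewrite cmod0.
case=> x y; rewrite insq_Re_Im => /andP[xx yy].
have pE : p = Re p +i* Im p by case: (p).
have px : Re p - r <= Re p <= Re p + r by lra.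
have py : Im p - r <= Im p <= Im p + r by lra.
have -> : F (x +i* y) = F (Re p +i* y).
  have [h|/ltW h] := leP x (Re p); [apply/esym|]; apply: H => //;
    by rewrite insq_Re_Im ?xx ?yy ?px.
rewrite [in RHS]pE.
have [h|/ltW h] := leP y (Im p); [apply/esym|]; apply: V => //;
  by rewrite insq_Re_Im ?px ?yy ?py.
Qed.

Section Primitive.
Variables (f : C -> C) (p : C) (r : R).
Hypothesis r0 : 0 < r.
Hypothesis df : forall z, insq p r z -> cdiff f z.

Let x0 := Re p - r.
Let y0 := Im p - r.

(** Integration along an L-shaped path from the lower left corner, first horizontal, then vertical.
    By Goursat the other L-shaped path gives the same value ([prim_alt]), so that a horizontal or a
    vertical move of [z] changes one segment only. *)
Definition prim z : C := Hint f y0 x0 (Re z) + 'i * Vint f (Re z) y0 (Im z).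

Let inI x y : Re p - r <= x <= Re p + r -> Im p - r <= y <= Im p + r ->
  cdiff f (x +i* y).
Proof. by move=> xx yy; apply: df; rewrite insq_Re_Im xx yy. Qed.

Lemma prim_alt z : insq p r z ->
  prim z = 'i * Vint f x0 y0 (Im z) + Hint f (Im z) x0 (Re z).
Proof.
move=> /andP[/andP[z1 z2] /andP[z3 z4]].
have := @goursat _ f x0 (Re z) y0 (Im z) z1 z3.
rewrite rectE => E; rewrite /prim; apply/eqP; rewrite -subr_eq0; apply/eqP.
rewrite -E; first by ring.
move=> w /andP[/andP[w1 w2] /andP[w3 w4]]; apply: df; rewrite /insq /inrect.
by rewrite w1 (le_trans w2 z2) w3 (le_trans w4 z4).
Qed.

Let Hsplit y u v : Im p - r <= y <= Im p + r -> Re p - r <= u -> u <= v -> v <= Re p + r ->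
  Hint f y x0 v = Hint f y x0 u + Hint f y u v.
Proof.
move=> yy xu uv vr; rewrite !HintE; apply: cint_cat => //.
by apply: cdiff_Hccts => x /andP[h1 h2]; apply: inI; rewrite ?yy// h1 (le_trans h2).
Qed.

Let Vsplit x u v : Re p - r <= x <= Re p + r -> Im p - r <= u -> u <= v -> v <= Im p + r ->
  Vint f x y0 v = Vint f x y0 u + Vint f x u v.
Proof.
move=> yy xu uv vr; rewrite !VintE; apply: cint_cat => //.
by apply: cdiff_Vccts => y /andP[h1 h2]; apply: inI; rewrite ?yy// h1 (le_trans h2).
Qed.

Let Hdiff y u v c B : Im p - r <= y <= Im p + r -> Re p - r <= u -> u <= v -> v <= Re p + r ->
  (forall x, u <= x <= v -> cmod (f (x +i* y) - c) <= B) ->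
  cmod (Hint f y x0 v - Hint f y x0 u - c * (v - u)%:C) <= 2 * B * (v - u).
Proof.
move=> yy xu uv vr fB; rewrite (@Hsplit y u v)// [X in X - _ - _]addrC addrK.
have dd x : u <= x <= v -> cdiff f (x +i* y).
  by move=> /andP[h1 h2]; apply: inI => //; rewrite (le_trans xu h1) (le_trans h2 vr).
have cc : Hint (fun=> c) y u v = c * (v - u)%:C.
  have := @Hint_FTC _ (fun=> c) (fun w => c * w) y u v uv.
  rewrite -mulrBr (_ : v +i* y - u +i* y = (v - u)%:C); last first.
    by apply: complex_eq; rewrite ?ReB ?ImB /=; ring.
  apply => [x _|]; last by split => ? _; exact: cvg_cst.
  by have := cderZ c (cder_id (x +i* y)); rewrite mulr1.
have cf : ccts (fun x => f (x +i* y)) u v by exact: cdiff_Hccts.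
have cc' : ccts (fun x : R => c) u v by split => ? _; exact: cvg_cst.
rewrite -cc !HintE cintB//; last exact: cctsZ.
apply: cint_bound => //.
by apply: (@cdiff_Hccts _ (fun w => f w - c)) => x /dd ?; apply: cdiffB => //; exact: cdiff_const.
Qed.

Let Vdiff x u v c B : Re p - r <= x <= Re p + r -> Im p - r <= u -> u <= v -> v <= Im p + r ->
  (forall y, u <= y <= v -> cmod (f (x +i* y) - c) <= B) ->
  cmod (Vint f x y0 v - Vint f x y0 u - c * (v - u)%:C) <= 2 * B * (v - u).
Proof.
move=> yy xu uv vr fB; rewrite (@Vsplit x u v)// [X in X - _ - _]addrC addrK.
have dd y : u <= y <= v -> cdiff f (x +i* y).
  by move=> /andP[h1 h2]; apply: inI => //; rewrite (le_trans xu h1) (le_trans h2 vr).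
have i0 : ('i : C) != 0 by rewrite -cmod_eq0 cmodi oner_eq0.
have cc : Vint (fun=> c) x u v = c * (v - u)%:C.
  apply: (mulfI i0).
  have := @Vint_FTC _ (fun=> c) (fun w => c * w) x u v uv.
  rewrite -mulrBr (_ : x +i* v - x +i* u = 'i * (v - u)%:C); last first.
    by apply: complex_eq; rewrite ?ReB ?ImB ?ReM ?ImM /=; ring.
  rewrite mulrCA; apply => [y _|]; last by split => ? _; exact: cvg_cst.
  by have := cderZ c (cder_id (x +i* y)); rewrite mulr1.
have cf : ccts (fun y => f (x +i* y)) u v by exact: cdiff_Vccts.
have cc' : ccts (fun x : R => c) u v by split => ? _; exact: cvg_cst.
rewrite -cc !VintE cintB//; last exact: cctsZ.
apply: cint_bound => //.
by apply: (@cdiff_Vccts _ (fun w => f w - c)) => y /dd ?; apply: cdiffB => //; exact: cdiff_const.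
Qed.

Lemma cder_prim z : Re p - r < Re z < Re p + r -> Im p - r < Im z < Im p + r ->
  cder prim z (f z).
Proof.
move=> /andP[z1 z2] /andP[z3 z4] e e0.
have [l dfz] : cdiff f z by apply: df; rewrite /insq /inrect !(ltW z1, ltW z2, ltW z3, ltW z4).
have [d d0 fd] := cder_cont dfz (divr_gt0 e0 (ltr0Sn _ 3)).
exists (Num.min (d / 2) (Num.min (Num.min (Re z - (Re p - r)) (Re p + r - Re z))
  (Num.min (Im z - (Im p - r)) (Im p + r - Im z)))) => [|h].
  by rewrite !lt_min divr_gt0// !subr_gt0 z1 z2 z3 z4.
rewrite !lt_min => /andP[hd /andP[/andP[h1 h2] /andP[h3 h4]]].
have := cmod_Re h; have := cmod_Im h; rewrite !ler_norml => /andP[i1 i2] /andP[k1 k2].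
pose x := Re z + Re h; pose y := Im z + Im h.
have xr : Re p - r <= x <= Re p + r by rewrite /x; lra.
have yr : Im p - r <= y <= Im p + r by rewrite /y; lra.
have zr : Re p - r <= Re z <= Re p + r by rewrite !ltW.
have zi : Im p - r <= Im z <= Im p + r by rewrite !ltW.
have near u v : `|u - Re z| <= `|Re h| -> `|v - Im z| <= `|Im h| -> cmod (f (u +i* v) - f z) <= e / 4.
  move=> uz vz; have := fd (u +i* v - z); rewrite [z + _]addrC subrK => E.
  apply: ltW; apply: E; apply: le_lt_trans (cmod_leD _) _; rewrite ReB ImB /=.
  have := cmod_Re h; have := cmod_Im h; clear h1 h2 h3 h4 i1 i2 k1 k2 z1 z2 z3 z4 xr yr zr zi; lra.
clear hd h1 h2 h3 h4 i1 i2 k1 k2 z1 z2 z3 z4.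
(* From [z] to [z + h] through the corner [z']: the horizontal increment is read on [prim_alt], the
   vertical one on the definition. *)
pose z' := x +i* Im z.
have z'r : insq p r z' by rewrite insq_Re_Im xr zi.
have zir : insq p r z by rewrite /insq /inrect zr zi.
have A1 : cmod (prim z' - prim z - f z * (Re h)%:C) <= e / 2 * `|Re h|.
  rewrite !prim_alt//= (_ : _ - _ - _ = Hint f (Im z) x0 x - Hint f (Im z) x0 (Re z) - f z * (Re h)%:C); last by ring.
  have [h0|/ltW h0] := leP 0 (Re h).
    have E := @Hdiff (Im z) (Re z) x (f z) (e / 4) zi.
    rewrite ger0_norm// (_ : Re h = x - Re z); last by rewrite /x; ring.
    rewrite (_ : e / 2 * _ = 2 * (e / 4) * (x - Re z)); last by field.
    apply: E; [by case/andP: zr|by rewrite /x lerDl|by case/andP: xr|] => u; rewrite /x => /andP[u1 u2].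
    by apply: near; rewrite ?subrr ?normr0// !ger0_norm//; lra.
  have E := @Hdiff (Im z) x (Re z) (f z) (e / 4) zi.
  rewrite ler0_norm// (_ : Re h = - (Re z - x)); last by rewrite /x; ring.
  rewrite opprK (_ : e / 2 * _ = 2 * (e / 4) * (Re z - x)); last by field.
  rewrite -cmodN (_ : - (_ - _ - _) = Hint f (Im z) x0 (Re z) - Hint f (Im z) x0 x - f z * (Re z - x)%:C); last first.
    by rewrite rmorphN/=; ring.
  apply: E; [by case/andP: xr|by rewrite /x gerDl|by case/andP: zr|] => u; rewrite /x => /andP[u1 u2].
  by apply: near; rewrite ?subrr ?normr0// !ler0_norm//; lra.
have A2 : cmod (prim (z + h) - prim z' - f z * ('i * (Im h)%:C)) <= e / 2 * `|Im h|.
  rewrite /prim ReD ImD /= -/x -/y.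
  rewrite (_ : _ - _ - _ = 'i * (Vint f x y0 y - Vint f x y0 (Im z) - f z * (Im h)%:C)); last by ring.
  rewrite cmodM cmodi mul1r.
  have xz : `|x - Re z| <= `|Re h| by rewrite /x addrAC subrr add0r.
  have [h0|/ltW h0] := leP 0 (Im h).
    have E := @Vdiff x (Im z) y (f z) (e / 4) xr.
    rewrite ger0_norm// (_ : Im h = y - Im z); last by rewrite /y; ring.
    rewrite (_ : e / 2 * _ = 2 * (e / 4) * (y - Im z)); last by field.
    apply: E; [by case/andP: zi|by rewrite /y lerDl|by case/andP: yr|] => u; rewrite /y => /andP[u1 u2].
    by apply: near => //; rewrite !ger0_norm//; lra.
  have E := @Vdiff x y (Im z) (f z) (e / 4) xr.
  rewrite ler0_norm// (_ : Im h = - (Im z - y)); last by rewrite /y; ring.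
  rewrite opprK (_ : e / 2 * _ = 2 * (e / 4) * (Im z - y)); last by field.
  rewrite -cmodN (_ : - (_ - _ - _) = Vint f x y0 (Im z) - Vint f x y0 y - f z * (Im z - y)%:C); last first.
    by rewrite rmorphN/=; ring.
  apply: E; [by case/andP: yr|by rewrite /y gerDl|by case/andP: zi|] => u; rewrite /y => /andP[u1 u2].
  by apply: near => //; rewrite !ler0_norm//; lra.
rewrite (_ : _ - _ - _ = (prim (z + h) - prim z' - f z * ('i * (Im h)%:C)) +
  (prim z' - prim z - f z * (Re h)%:C)); last first.
  have -> : f z * h = f z * (Re h)%:C + f z * ('i * (Im h)%:C).
    by rewrite -mulrDr; congr (_ * _); case: (h) => ? ?; exact: complexDi.
  by ring.
apply: le_trans (cmodD _ _) _; apply: le_trans (lerD A2 A1) _.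
rewrite -mulrDr (_ : e * cmod h = e / 2 * (cmod h + cmod h)); last by field.
by rewrite ler_pM2l ?divr_gt0// lerD ?cmod_Re ?cmod_Im.
Qed.

End Primitive.
End MeanValue.

(** * The exponential, and logarithms of nonvanishing functions *)

Section Exponential.
Variable R : realType.
Local Notation C := R[i].
Local Notation Re := complex.Re.
Local Notation Im := complex.Im.
Implicit Types (f g : C -> C) (r s t : R) (p z w h : C).

Lemma cexpE z : cexp z =
  (expR (Re z) * cos (Im z)) +i* (expR (Re z) * sin (Im z)).
Proof. by apply: complex_eq; rewrite /cexp ?ReM ?ImM /=; ring. Qed.

Lemma cexpD z w : cexp (z + w) = cexp z * cexp w.
Proof.
rewrite !cexpE ReD ImD expRD cosD sinD.
by apply: complex_eq; rewrite ?ReM ?ImM /=; ring.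
Qed.

Lemma cexp0 : cexp (0 : C) = 1.
Proof. by rewrite cexpE /= expR0 cos0 sin0 mulr1 mulr0. Qed.

Lemma cmod_cexp z : cmod (cexp z) = expR (Re z).
Proof.
rewrite cexpE cmodE /= !exprMn -mulrDr cos2Dsin2 mulr1 sqrtr_sqr.
by rewrite ger0_norm ?expR_ge0.
Qed.

Lemma cexp_neq0 z : cexp z != 0.
Proof. by rewrite -cmod_gt0 cmod_cexp expR_gt0. Qed.

Lemma cexpN z : cexp (- z) = (cexp z)^-1.
Proof.
by apply: (mulfI (cexp_neq0 z)); rewrite -cexpD subrr cexp0 divff ?cexp_neq0.
Qed.

Lemma cexpR r : cexp r%:C = (expR r)%:C.
Proof. by rewrite cexpE /= cos0 sin0 mulr1 mulr0. Qed.

Lemma cexp_near0 (e : R) : 0 < e -> exists2 d : R, 0 < d &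
  forall h, cmod h < d -> cmod (cexp h - 1 - h) <= e * cmod h.
Proof.
(* The errors [A] and [B] below add up to [e1 * |x| + 8 * e1 * |y|], whence the 9. *)
move=> e0; pose e1 := Num.min 1 (e / 9).
have e10 : 0 < e1 by rewrite lt_min ltr01 divr_gt0.
have [e11 e12] : e1 <= 1 /\ e1 <= e / 9.
  by apply/andP; rewrite -le_min.
clearbody e1.
have [d1 d10 D1] := eps_is_derive (is_derive_expR (0 : R)) e10.
have [d2 d20 D2] := eps_is_derive (is_derive_cos (0 : R)) e10.
have [d3 d30 D3] := eps_is_derive (is_derive_sin (0 : R)) e10.
exists (Num.min e1 (Num.min d1 (Num.min d2 d3))) => [|h].
  by rewrite !lt_min e10 d10 d20 d30.
rewrite !lt_min => /and4P[h0 h1 h2 h3].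
have [hx hy] := (cmod_Re h, cmod_Im h).
set x := Re h in hx *; set y := Im h in hy *.
have := D1 x (le_lt_trans hx h1); have := D2 y (le_lt_trans hy h2).
have := D3 y (le_lt_trans hy h3).
rewrite !add0r expR0 cos0 sin0 oppr0 !mul1r mul0r !subr0 => s1 c1 x1.
rewrite ?addr0 in s1.
have x3 : expR x <= 3.
  have : expR x - 1 - x <= e1 * `|x| by apply: le_trans x1; exact: ler_norm.
  have : e1 * `|x| <= 1 * 1 by apply: ler_pM => //; [exact: ltW|lra].
  by have := ler_norm x; lra.
have x2 : `|expR x - 1| <= 2 * e1.
  have -> : expR x - 1 = (expR x - 1 - x) + x by ring.
  apply: le_trans (ler_normD _ _) _.
  have : e1 * `|x| <= 1 * `|x| by rewrite ler_wpM2r.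
  by lra.
apply: le_trans (cmod_leD _) _.
rewrite !ReB !ImB cexpE /= -/x -/y.
have A : `|expR x * cos y - 1 - x| <= 3 * (e1 * `|y|) + e1 * `|x|.
  have -> : expR x * cos y - 1 - x = expR x * (cos y - 1) + (expR x - 1 - x) by ring.
  apply: le_trans (ler_normD _ _) _; apply: lerD => //.
  by rewrite normrM (ger0_norm (expR_ge0 _)) ler_pM ?expR_ge0.
have B : `|expR x * sin y - 0 - y| <= 3 * (e1 * `|y|) + 2 * e1 * `|y|.
  have -> : expR x * sin y - 0 - y = expR x * (sin y - y) + (expR x - 1) * y by ring.
  apply: le_trans (ler_normD _ _) _; rewrite !normrM; apply: lerD.
    by rewrite (ger0_norm (expR_ge0 _)) ler_pM ?expR_ge0.
  by rewrite ler_wpM2r.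
apply: le_trans (lerD A B) _.
apply: (@le_trans _ _ (9 * e1 * cmod h)).
  have : e1 * `|y| <= e1 * cmod h by rewrite ler_wpM2l// ltW.
  have : e1 * `|x| <= e1 * cmod h by rewrite ler_wpM2l// ltW.
  by lra.
by rewrite ler_wpM2r ?cmod_ge0//; lra.
Qed.

Lemma cder_cexp z : cder (@cexp R) z (cexp z).
Proof.
move=> e e0; have ez : 0 < e / expR (Re z) by rewrite divr_gt0 ?expR_gt0.
have [d d0 hd] := cexp_near0 ez; exists d => // h /hd {}hd.
have -> : cexp (z + h) - cexp z - cexp z * h = cexp z * (cexp h - 1 - h).
  by rewrite cexpD; ring.
rewrite cmodM cmod_cexp mulrC -ler_pdivlMr ?expR_gt0//; apply: le_trans hd _.
by rewrite mulrAC.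
Qed.

Lemma cdiff_cexp z : cdiff (@cexp R) z.
Proof. by exists (cexp z); exact: cder_cexp. Qed.

(** [g] is a primitive of [f' / f], and [f * exp (- g)] is constant, having derivative 0. The
    intermediate square of half-side [s] leaves room on its outside for [f'] to be differentiable
    and on its inside for the primitive. *)
Lemma clog_exists f p r t : 0 < t < r ->
  (forall z, insq p r z -> cdiff f z) -> (forall z, insq p r z -> f z != 0) ->
  exists2 g, g p = 0 & forall z, insq p t z ->
    cdiff g z /\ f z = f p * cexp (g z).
Proof.
move=> /andP[t0 tr] df f0.
pose s := (t + r) / 2; have [ts sr] : t < s /\ s < r by rewrite /s; lra.
have s0 : 0 < s by exact: lt_trans ts.
pose phi z := cdv f z / f z.
have dphi z : insq p s z -> cdiff phi z.
  move=> zs; have zr := insq_sub (ltW sr) zs.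
  apply: cdiffM; last by apply: cdiffV; [exact: f0|exact: df].
  apply: (@cdiff_cdv _ f z (r - s)); first by rewrite subr_gt0.
  by move=> w /(insq_shift zs); rewrite addrC subrK; exact: df.
pose G := prim phi p s.
have tG z : insq p t z -> cder G z (phi z).
  by move=> /andP[/andP[z1 z2] /andP[z3 z4]]; apply: cder_prim => //; lra.
exists (fun z => G z - G p); first by rewrite subrr.
have dg z : insq p t z -> cder (fun z => G z - G p) z (phi z).
  by move=> /tG dG; apply: cder_eq (cderB dG (cder_const (G p) z)) _; rewrite subr0.
move=> z zt; split; first by exists (phi z); exact: dg.
pose Q z := f z * cexp (- (G z - G p)).
have dQ w : insq p t w -> cder Q w 0.
  move=> wt; have wr := insq_sub (ltW tr) wt.
  have := cderM (cdvP (df _ wr)) (cder_comp (cderN (dg _ wt)) (cder_cexp _)).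
  by move=> /cder_eq; apply; rewrite /= /phi; field; exact: f0.
have := cder0_const (ltW t0) dQ zt; rewrite /Q subrr oppr0 cexp0 mulr1 => <-.
by rewrite cexpN divfK// cexp_neq0.
Qed.

End Exponential.

(** * Dirichlet series *)

Section DirichletSeries.
Variable R : realType.
Local Notation C := R[i].
Local Notation Re := complex.Re.
Local Notation Im := complex.Im.
Implicit Types (f g : C -> C) (r c x y B : R) (p z w h s a : C) (m n L : nat).

Lemma exprn_small (q e : R) : 0 <= q < 1 -> 0 < e -> exists n, q ^+ n < e.
Proof.
move=> /andP[q0 q1] e0.
have : `|q| < 1 by rewrite ger0_norm.
move=> /cvg_expr/cvgrPdist_lt/(_ e e0)[N _ /(_ N (leqnn N))] /=.
by rewrite sub0r normrN ger0_norm ?exprn_ge0// => ?; exists N.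
Qed.

(** Since [|h| <= r - k], the ratio [|h| / r] is at most [1 - k / rm]: first the number [n] of
    Taylor terms is chosen to make the tail at most [eta / 2], then [e] to make the first [n] terms
    at most [eta / 2]. The point is that [e] is uniform in [r], [f] and [a]. *)
Lemma two_constants_small (s0 rm k B eta : R) : 0 < s0 -> s0 <= rm -> 0 < k ->
  0 <= B -> 0 < eta -> exists2 e : R, 0 < e &
  forall r f a, s0 <= r <= rm -> (forall z, insq a r z -> cdiff f z) ->
    (forall z, insq a r z -> cmod (f z) <= B) ->
    (forall z, insq a s0 z -> cmod (f z) <= e) ->
    forall h, cmod h <= r - k -> cmod (f (a + h)) <= eta.
Proof.
move=> s00 s0rm k0 B0 eta0; have rm0 := lt_le_trans s00 s0rm.
(* If [rm < k], no [h] satisfies [|h| <= r - k], and any [e] will do. *)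
have [krm|rmk] := leP k rm; last first.
  exists 1 => // r f a /andP[_ rrm] _ _ _ h hr.
  by have := cmod_ge0 h; lra.
have q01 : 0 <= 1 - k / rm < 1.
  by rewrite subr_ge0 ler_pdivrMr// mul1r krm /= gtrBl divr_gt0.
have X1 : 1 <= rm / s0 by rewrite ler_pdivlMr// mul1r.
have A0 : 0 < 4 * rm * B / k + 1.
  by rewrite ltr_wpDl// divr_ge0// ?mulr_ge0// ltW.
have eA : 0 < eta / 2 / (4 * rm * B / k + 1) by rewrite !divr_gt0.
have [n qn] := exprn_small q01 eA.
have D0 : 0 < 4 * n%:R * (rm / s0) ^+ n + 1.
  by rewrite ltr_wpDl// !mulr_ge0// exprn_ge0// (le_trans _ X1).
exists (eta / 2 / (4 * n%:R * (rm / s0) ^+ n + 1)); first by rewrite !divr_gt0.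
move=> r f a /andP[s0r rrm] df fB fe h hr.
have r0 := lt_le_trans s00 s0r.
have hr' : cmod h < r by lra.
apply: le_trans (two_constants n s00 s0r df fB fe hr') _.
apply: (@le_trans _ _ (eta / 2 + eta / 2)); last by lra.
set e := eta / 2 / _.
have e0 : 0 < e by rewrite !divr_gt0.
apply: lerD.
  apply: (@le_trans _ _ (\sum_(j < n) 4 * e * (rm / s0) ^+ n)).
    apply: ler_sum => j _; rewrite ler_wpM2l//; first by rewrite mulr_ge0// ltW.
    apply: (@le_trans _ _ ((rm / s0) ^+ j)).
      apply: lerXn2r; rewrite ?nnegrE ?divr_ge0 ?cmod_ge0 ?(ltW rm0) ?(ltW s00)//.
      by rewrite ler_pM2r ?invr_gt0//; lra.
    by rewrite ler_weXn2l// ltnW.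
  rewrite sumr_const card_ord -[leLHS]mulr_natr.
  rewrite (_ : _ * n%:R = e * (4 * n%:R * (rm / s0) ^+ n)); last by ring.
  rewrite /e -mulrA ler_piMr ?divr_ge0 ?(ltW eta0)//.
  by rewrite mulrC ler_pdivrMr// mul1r lerDl.
apply: (@le_trans _ _ ((4 * rm * B / k + 1) * (1 - k / rm) ^+ n)); last first.
  by rewrite mulrC -ler_pdivlMr// ltW.
have hq : cmod h / r <= 1 - k / rm.
  apply: (@le_trans _ _ (1 - k / r)).
    by rewrite ler_pdivrMr// mulrBl mul1r divfK// gt_eqF.
  by rewrite lerD2l lerN2 ler_pM2l// lef_pV2.
have hqn : (cmod h / r) ^+ n <= (1 - k / rm) ^+ n.
  apply: lerXn2r; rewrite ?nnegrE ?divr_ge0 ?cmod_ge0 ?(ltW r0)//.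
  by case/andP: q01.
have qn0 : 0 <= (1 - k / rm) ^+ n by rewrite exprn_ge0//; case/andP: q01.
apply: (@le_trans _ _ (4 * rm * B / k * (1 - k / rm) ^+ n)); last first.
  by rewrite ler_wpM2r// lerDl.
have rk : k <= r - cmod h by lra.
rewrite (_ : 4 * rm * B / k * _ = 4 * rm * B * (1 - k / rm) ^+ n / k); last by ring.
apply: ler_pM; rewrite ?mulr_ge0 ?exprn_ge0 ?divr_ge0 ?invr_ge0 ?cmod_ge0 ?(ltW r0)//.
  by rewrite subr_ge0 ltW.
  apply: ler_pM; rewrite ?mulr_ge0 ?exprn_ge0 ?divr_ge0 ?cmod_ge0 ?(ltW r0)//.
  by rewrite ler_wpM2r// ler_wpM2l.
by rewrite lef_pV2 ?posrE// subr_gt0.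
Qed.

Definition dterm m s : C := cexp (- (s * (ln (m%:R : R))%:C)).

Lemma dtermE m s : dterm m s = (natcpow m s)^-1.
Proof. by rewrite /dterm cexpN. Qed.

Lemma cmod_dterm m s : cmod (dterm m s) = expR (- (Re s * ln m%:R)).
Proof. by rewrite cmod_cexp ReN ReM /= mulr0 subr0. Qed.

Lemma cmod_dterm_pow m s : cmod (dterm m.+1 s) = (m.+1)%:R `^ (- Re s).
Proof. by rewrite cmod_dterm /powR pnatr_eq0/= mulNr. Qed.

Lemma cdiff_dterm m s : cdiff (dterm m) s.
Proof.
have := cdiff_comp (cdiffB (cdiff_const 0 s) (cdiffM (cdiff_id s)
  (cdiff_const ((ln (m%:R : R))%:C) s))) (cdiff_cexp _).
by apply: cdiff_ext => w; rewrite /dterm sub0r.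
Qed.

(** The discrete counterpart of integrating [x ^ (- 1 - c)]. With [x = m + 2] it amounts to
    [(1 - 1 / x) ^ (- c) >= 1 + c / x], which follows from [ln (1 - 1 / x) <= - 1 / x]. *)
Lemma pow_telescope m c : 0 < c -> (m.+2)%:R `^ (- (1 + c)) <=
  ((m.+1)%:R `^ (- c) - (m.+2)%:R `^ (- c)) / c :> R.
Proof.
move=> c0; set x : R := (m.+2)%:R; have x0 : 0 < x by rewrite ltr0n.
have yx : (m.+1)%:R = x * (1 - x^-1) :> R.
  by rewrite mulrBr mulr1 divff ?gt_eqF// /x -(natr1 m.+1) addrK.
have x1 : 0 < 1 - x^-1.
  by rewrite subr_gt0 invf_lt1// /x ltr1n.
rewrite yx powRM ?(ltW x0) ?(ltW x1)// ler_pdivlMr//.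
have E : 1 + c / x <= (1 - x^-1) `^ (- c).
  rewrite /powR gt_eqF//; apply: le_trans (expR_ge1Dx _).
  rewrite lerD2l mulNr -mulrN ler_pM2l// lerNr.
  by apply: le_ln1Dx; rewrite ltrN2 invf_lt1// /x ltr1n.
rewrite opprD powRD; last by apply/implyP => _; rewrite gt_eqF.
rewrite powR_inv1 ?(ltW x0)//.
have xc : 0 < x `^ (- c) by rewrite powR_gt0.
rewrite (_ : x^-1 * _ * c = x `^ (- c) * (1 + c / x) - x `^ (- c)); last by ring.
by rewrite lerD2r ler_pM2l.
Qed.

Lemma pow_tail c L n : 0 < c -> (0 < L)%N -> (L <= n)%N ->
  \sum_(L <= k < n) (k.+1)%:R `^ (- (1 + c)) <= (L%:R `^ (- c) - n%:R `^ (- c)) / c :> R.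
Proof.
move=> c0 L0; elim: n => [|n IH]; first by rewrite leqn0 => /eqP L00; rewrite L00 in L0.
rewrite leq_eqVlt => /predU1P[<-|]; first by rewrite big_geq// subrr mul0r.
rewrite ltnS => Ln; rewrite big_nat_recr//=.
apply: (@le_trans _ _ ((L%:R `^ (- c) - n%:R `^ (- c)) / c + n.+1%:R `^ (- (1 + c)))).
  by rewrite lerD2r IH.
case: n Ln {IH} => [|n Ln]; first by rewrite leqn0 => /eqP L00; rewrite L00 in L0.
by apply: le_trans (lerD (lexx _) (pow_telescope n c0)) _; rewrite -mulrDl addrA subrK.
Qed.

Lemma pow_tail' c L n : 0 < c -> (0 < L)%N -> (L <= n)%N ->
  \sum_(L <= k < n) (k.+1)%:R `^ (- (1 + c)) <= L%:R `^ (- c) / c :> R.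
Proof.
move=> c0 L0 Ln; apply: le_trans (pow_tail c0 L0 Ln) _.
by rewrite ler_pM2r ?invr_gt0// gerBl powR_ge0.
Qed.

Lemma pow_sum c n : 0 < c ->
  \sum_(k < n) (k.+1)%:R `^ (- (1 + c)) <= 1 + c^-1 :> R.
Proof.
move=> c0; case: n => [|n]; first by rewrite big_ord0 addr_ge0// invr_ge0 ltW.
rewrite -(big_mkord xpredT (fun k => (k.+1)%:R `^ (- (1 + c)) : R)) big_ltn// powR1.
by rewrite lerD2l (le_trans (@pow_tail' _ 1 _ c0 _ _))// powR1 mul1r.
Qed.

Lemma dterm_tail c L n s : 0 < c -> 1 + c <= Re s -> (0 < L)%N -> (L <= n)%N ->
  cmod (\sum_(k < n) dterm k.+1 s - \sum_(k < L) dterm k.+1 s) <= L%:R `^ (- c) / c.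
Proof.
move=> c0 cs L0 Ln; apply: le_trans (pow_tail' c0 L0 Ln).
rewrite -!(big_mkord xpredT (fun k => dterm k.+1 s)) (big_cat_nat (leq0n L) Ln) /=.
rewrite addrAC subrr add0r; apply: le_trans (cmod_sum _ _ _) _.
apply: ler_sum_nat => k _; rewrite cmod_dterm_pow ler_powR ?ler1n//.
by rewrite lerN2.
Qed.

Lemma exp_diff (b : C) (x y E : R) : x <= y ->
  expR (Re b * x) <= E -> expR (Re b * y) <= E ->
  cmod (cexp (b * y%:C) - cexp (b * x%:C)) <= 2 * (cmod b * E) * (y - x).
Proof.
move=> xy E1 E2.
have dd w : cder (fun w => cexp (b * w)) w (b * cexp (b * w)).
  have := cder_comp (cderZ b (cder_id w)) (cder_cexp (b * w)).
  by rewrite mulr1 mulrC.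
have := @mvt_ineq_H _ (fun w => b * cexp (b * w)) (fun w => cexp (b * w)) 0 x y 0 (cmod b * E) xy.
rewrite mul0r subr0; apply => u uxy; first exact: dd.
  by apply: cdiffM; [exact: cdiff_const|eexists; exact: dd].
rewrite subr0 cmodM ler_wpM2l ?cmod_ge0// cmod_cexp ReM /= mulr0 subr0.
case/andP: uxy => xu uy.
have [b0|/ltW b0] := leP 0 (Re b).
  by apply: le_trans E2; rewrite ler_expR ler_wpM2l.
by apply: le_trans E1; rewrite ler_expR ler_wnM2l.
Qed.

(** The first Euler-Maclaurin approximation of [(s - 1) * zeta s], the last term being
    [(L + 1) ^ (1 - s)]. The factor [s - 1] removes the pole, and consecutive approximations differ
    by a summable amount as soon as [Re s > 0]. *)
Definition Vsum L s : C := (s - 1) * \sum_(k < L) dterm k.+1 s + dterm L.+1 (s - 1).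

Lemma cdiff_Vsum L z : cdiff (Vsum L) z.
Proof.
have d1 : cdiff (fun w => w - 1) z by apply: cdiffB; [exact: cdiff_id|exact: cdiff_const].
apply: cdiffD; last by apply: cdiff_comp d1 _; exact: cdiff_dterm.
apply: cdiffM => //; elim: L => [|L IH].
  by apply: (@cdiff_ext _ (fun=> 0)) (cdiff_const _ _) => w; rewrite big_ord0.
apply: (@cdiff_ext _ (fun w => \sum_(k < L) dterm k.+1 w + dterm L.+1 w)).
  by move=> w; rewrite big_ord_recr.
by apply: cdiffD => //; exact: cdiff_dterm.
Qed.

Lemma Vsum_step L s : 0 <= Re s ->
  cmod (Vsum L.+1 s - Vsum L s) <=
  8 * (cmod s * cmod (s - 1)) * (L.+1)%:R `^ (- (1 + Re s)).
Proof.
move=> s0; pose a : R := ln (L.+1)%:R; pose b : R := ln (L.+2)%:R.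
have L0 : 0 < (L.+1)%:R :> R by rewrite ltr0n.
have L20 : 0 < (L.+2)%:R :> R by rewrite ltr0n.
have ab : a <= b by rewrite ler_ln ?posrE// ler_nat.
have ba : b - a <= (L.+1)%:R^-1.
  rewrite /a /b -ln_div ?posrE// (_ : _ / _ = 1 + (L.+1)%:R^-1).
    by apply: le_ln1Dx; rewrite (lt_trans (ltrN10 R))// invr_gt0.
  by rewrite -(natr1 L.+1) mulrDl divff ?gt_eqF// mul1r.
have ea : expR a = (L.+1)%:R by rewrite lnK ?posrE.
have eb : expR b = (L.+2)%:R by rewrite lnK ?posrE.
(* The increment is [g b - g a] for an entire [g] whose derivative contains
   [cexp (- s * a) - cexp (- s * w)]. The mean value inequality, used for [g] and for this factor,
   gains [1 / (L + 1)] twice, against one loss [exp w <= L + 2]. *)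
pose g w := cexp ((1 - s) * w) + (s - 1) * cexp (- s * a%:C) * cexp w.
have gE : Vsum L.+1 s - Vsum L s = g b%:C - g a%:C.
  rewrite /Vsum big_ord_recr /= /g /dterm -/a -/b.
  rewrite !cexpR ea eb (_ : (L.+2)%:R%:C = (L.+1)%:R%:C + 1); last first.
    by rewrite -(natr1 L.+1) rmorphD.
  rewrite (_ : - (s * a%:C) = - s * a%:C); last by ring.
  rewrite (_ : - ((s - 1) * b%:C) = (1 - s) * b%:C); last by ring.
  rewrite (_ : - ((s - 1) * a%:C) = (1 - s) * a%:C); last by ring.
  by ring.
pose g' w := (s - 1) * cexp w * (cexp (- s * a%:C) - cexp (- s * w)).
have dg w : cder g w (g' w).
  have d1 := cder_comp (cderZ (1 - s) (cder_id w)) (cder_cexp ((1 - s) * w)).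
  have d2 := cderZ ((s - 1) * cexp (- s * a%:C)) (cder_cexp w).
  apply: cder_eq (cderD d1 d2) _; rewrite /g' mulr1.
  rewrite (_ : (1 - s) * w = w + - s * w); last by ring.
  by rewrite cexpD; ring.
have := @mvt_ineq_H _ g' g 0 a b 0 (cmod (s - 1) * (L.+2)%:R *
   (2 * (cmod s * expR (- Re s * a)) * (L.+1)%:R^-1)) ab.
rewrite mul0r subr0 -gE => H; apply: le_trans (H _ _ _) _.
- by move=> x _; exact: dg.
- move=> x _; rewrite /g'; apply: cdiffM.
    by apply: cdiffM; [exact: cdiff_const|exact: cdiff_cexp].
  apply: cdiffB; first exact: cdiff_const.
  apply: cdiff_comp (cdiff_cexp _).
  by apply: cdiffM; [exact: cdiff_const|exact: cdiff_id].
- move=> x /andP[ax xb]; rewrite subr0 /g' cmodM (cmodM (s - 1)); apply: ler_pM.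
  + by rewrite mulr_ge0 ?cmod_ge0.
  + exact: cmod_ge0.
  + by rewrite ler_wpM2l ?cmod_ge0// cmod_cexp -eb ler_expR.
  rewrite cmod_distC -(cmodN s).
  apply: le_trans (@exp_diff (- s) a x (expR (- Re s * a)) ax _ _) _.
  + by rewrite ReN.
  + by rewrite ReN ler_expR ler_wnM2l// oppr_le0.
  + apply: ler_wpM2l; first by rewrite !mulr_ge0 ?cmod_ge0 ?expR_ge0.
    by apply: le_trans ba; rewrite lerD2r.
have L2 : (L.+2)%:R <= 2 * (L.+1)%:R :> R.
  by rewrite -natrM ler_nat mul2n -addnn addSnnS leq_addl.
have ba0 : 0 <= b - a by rewrite subr_ge0.
have pE : (L.+1)%:R `^ (- (1 + Re s)) = expR (- Re s * a) / (L.+1)%:R :> R.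
  rewrite opprD powRD; last by apply/implyP => _; rewrite gt_eqF.
  by rewrite powR_inv1 ?(ltW L0)// mulrC /powR gt_eqF.
rewrite pE; set X := expR _; have X0 : 0 <= X by exact: expR_ge0.
set l : R := (L.+1)%:R in L0 ba L2 *.
have s10 := cmod_ge0 (s - 1); have ss0 := cmod_ge0 s.
apply: (@le_trans _ _ (2 * (cmod (s - 1) * (2 * l) * (2 * (cmod s * X) / l)) * l^-1)).
  apply: ler_pM => //.
    by rewrite !mulr_ge0// invr_ge0 ltW.
  rewrite ler_pM2l// ler_wpM2r//; first by rewrite !mulr_ge0// invr_ge0 ltW.
  by rewrite ler_wpM2l.
by rewrite le_eqVlt; apply/orP; left; apply/eqP; field; rewrite gt_eqF.
Qed.

Lemma Vsum0 s : Vsum 0 s = 1.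
Proof. by rewrite /Vsum big_ord0 mulr0 add0r /dterm ln1 mulr0 oppr0 cexp0. Qed.

Lemma Vsum_bound L s : 0 < Re s ->
  cmod (Vsum L s) <= 1 + 8 * (cmod s * cmod (s - 1)) * (1 + (Re s)^-1).
Proof.
move=> s0.
have : cmod (Vsum L s) <= 1 + 8 * (cmod s * cmod (s - 1)) *
    \sum_(k < L) (k.+1)%:R `^ (- (1 + Re s)).
  elim: L => [|L IH]; first by rewrite Vsum0 cmod1 big_ord0 mulr0 addr0.
  rewrite -[Vsum _ _](subrK (Vsum L s)) (le_trans (cmodD _ _))// big_ord_recr /=.
  have := Vsum_step L (ltW s0); lra.
move=> /le_trans; apply; rewrite lerD2l ler_wpM2l ?mulr_ge0 ?cmod_ge0//.
exact: pow_sum.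
Qed.

End DirichletSeries.

(** * The zeta function *)

Section Holomorphic.
Variable R : realType.
Local Notation C := R[i].
Implicit Types (f g : C -> C) (z w : C).

Lemma nbhs_cmod (P : set C) z : (\forall w \near (z : C^o), P w) ->
  exists2 d : R, 0 < d & forall w, cmod (w - z) < d -> P w.
Proof.
move=> [d /= d0 dP].
have dE : d = (complex.Re d)%:C by rewrite RRe_real// gtr0_real.
exists (complex.Re d); first by rewrite -ltcR -dE.
move=> w wz; apply: dP => /=; rewrite dE distrC normr_cmod ltcR//.
Qed.

Lemma cmod_nbhs (P : set C) z (d : R) : 0 < d ->
  (forall w, cmod (w - z) < d -> P w) -> \forall w \near (z : C^o), P w.
Proof.
move=> d0 dP; exists d%:C => /=; first by rewrite ltcR.
by move=> w /=; rewrite distrC normr_cmod ltcR; exact: dP.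
Qed.

Lemma derivable_cdiff f z : derivable (f : C^o -> C^o) z 1 -> cdiff f z.
Proof.
move=> /cvg_ex[l /cvgrPdist_le fl]; exists l => e e0.
have eC : 0 < e%:C :> C by rewrite ltcR.
have [d d0 H] := nbhs_cmod (fl _ eC).
exists d => // h hd.
have [->|h0] := eqVneq h 0.
  by rewrite addr0 subrr mulr0 subrr cmod0 mulr0.
have := H h; rewrite subr0 => /(_ hd h0).
rewrite /= normr_cmod lecR /GRing.scale /= mulr1 [h + z]addrC => E.
have -> : f (z + h) - f z - l * h = - (h * (l - h^-1 * (f (z + h) - f z))).
  by field.
by rewrite cmodN cmodM mulrC ler_wpM2r ?cmod_ge0.
Qed.

Lemma cdiff_derivable f z : cdiff f z -> derivable (f : C^o -> C^o) z 1.
Proof.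
move=> [l df]; apply/cvg_ex; exists l; apply/cvgrPdist_le => /= e e0.
have eE : e = (complex.Re e)%:C by rewrite RRe_real// gtr0_real.
have e0' : 0 < complex.Re e by rewrite -ltcR -eE.
have [d d0 H] := df _ e0'.
apply: (cmod_nbhs d0) => h; rewrite subr0 => /H hd h0.
rewrite eE normr_cmod lecR /GRing.scale /= mulr1 [h + z]addrC.
have -> : l - h^-1 * (f (z + h) - f z) = - (h^-1 * (f (z + h) - f z - l * h)).
  by field.
rewrite cmodN cmodM cmodV ler_pdivrMl ?cmod_gt0//.
by rewrite [leRHS]mulrC.
Qed.

Lemma holomorphic_cdiff f z : holomorphic_at f z -> cdiff f z.
Proof. by move=> /nbhs_singleton/derivable_cdiff. Qed.

Lemma cdiff_holomorphic f z (d : R) : 0 < d ->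
  (forall w, cmod (w - z) < d -> cdiff f w) -> holomorphic_at f z.
Proof. by move=> d0 df; apply: (cmod_nbhs d0) => w /df/cdiff_derivable. Qed.

(** The quotient [cquo f z] is the witness for the exponent 1. Hence a count of distinct zeros is
    bounded by the count with multiplicity. *)
Lemma zero_order_ge1 f z : holomorphic_at f z -> f z = 0 -> (1 <= zero_order f z)%E.
Proof.
move=> /nbhs_cmod[d d0 df] fz.
have dfc w : cmod (w - z) < d -> cdiff f w by move=> /df/derivable_cdiff.
have d4 : 0 < d / 4 by rewrite divr_gt0.
have dsq w : insq z (d / 4) w -> cdiff f w.
  by move=> /cmod_insq wz; apply: dfc; lra.
apply: ereal_sup_ubound; exists 1%N => //=; exists (cquo f z); split.
  by apply: (cdiff_holomorphic d0) => w /dfc; exact: (cdiff_cquo d4 dsq fz).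
by apply: (cmod_nbhs d0) => w _; rewrite expr1; exact: cquoM.
Qed.

Lemma zero_order_ge0 f z : holomorphic_at f z -> (0 <= zero_order f z)%E.
Proof.
move=> hf; apply: ereal_sup_ubound; exists 0%N => //=; exists f; split => //.
by apply: (cmod_nbhs ltr01) => w _; rewrite expr0 mul1r.
Qed.

End Holomorphic.


(** * From an upper bound of the real part to a bound of the modulus *)

Section LogBound.
Variable R : realType.
Local Notation C := R[i].
Local Notation Re := complex.Re.
Local Notation Im := complex.Im.
Implicit Types (f g : C -> C) (z w h a : C).

(** The Moebius map [w / (2 B - w)] sends the half-plane [Re w <= B] into the unit disc, as
    [|2 B - w| ^ 2 - |w| ^ 2 = 4 B (B - Re w)]. *)
Lemma cmod_bc (B : R) w : 0 < B -> Re w <= B ->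
  (2 * B)%:C - w != 0 /\ cmod (w / ((2 * B)%:C - w)) <= 1.
Proof.
move=> B0 wB.
have n0 : (2 * B)%:C - w != 0.
  rewrite -cmod_gt0; apply: lt_le_trans (cmod_Re _).
  by rewrite ReB /= gtr0_norm; lra.
split=> //; rewrite cmodM cmodV ler_pdivrMr ?cmod_gt0// mul1r !cmodE.
rewrite ler_sqrt ?addr_ge0 ?sqr_ge0// ReB ImB /= sub0r sqrrN lerD2r.
by rewrite -subr_ge0 (_ : _ - _ = 4 * B * (B - Re w)) ?mulr_ge0 ?subr_ge0 ?(ltW B0)//; ring.
Qed.


Lemma bc_quotient f a r (B : R) : 0 < B -> (forall z, insq a r z -> cdiff f z) ->
  (forall z, insq a r z -> Re (f z) <= B) ->
  (forall z, insq a r z -> cdiff (fun w => f w / ((2 * B)%:C - f w)) z) /\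
  (forall z, insq a r z -> cmod (f z / ((2 * B)%:C - f z)) <= 1).
Proof.
move=> B0 df fB; split=> z zr; have [n0 n1] := cmod_bc B0 (fB z zr) => //.
apply: cdiffM; first exact: df.
by apply: cdiffV => //; apply: cdiffB; [exact: cdiff_const|exact: df].
Qed.

(** Inverting the Moebius map: [|w| <= e * (2 B + |w|)], and [e <= 1 / 2] allows [|w|] to be
    absorbed on the left. *)
Lemma bc_solve (B e : R) w : 0 < B -> 0 < e <= 2^-1 -> Re w <= B ->
  cmod (w / ((2 * B)%:C - w)) <= e -> cmod w <= 4 * (B * e).
Proof.
move=> B0 /andP[e0 e1] wB; have [n0 _] := cmod_bc B0 wB.
rewrite cmodM cmodV ler_pdivrMr ?cmod_gt0// => H.
have lb := cmodB ((2 * B)%:C) w; rewrite cmodR gtr0_norm in lb; last by lra.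
have : e * cmod ((2 * B)%:C - w) <= e * (2 * B + cmod w) by rewrite ler_pM2l.
have : e * cmod w <= 2^-1 * cmod w by rewrite ler_wpM2r ?cmod_ge0.
by lra.
Qed.

(* Borel-Caratheodory on the unit square. *)
Lemma log_bound_near f a (B : R) : 0 < B -> f a = 0 ->
  (forall z, insq a 1 z -> cdiff f z) -> (forall z, insq a 1 z -> Re (f z) <= B) ->
  forall z, insq a 20^-1 z -> cmod (f z) <= 2 * B.
Proof.
move=> B0 fa df fB z z20; have [d1 b1] := bc_quotient B0 df fB.
(* The half-side [1 / 20] gives [|z - a| <= 1 / 10], so the Taylor remainder [4 |h| / (1 - |h|)] is
   at most [4 / 9], below the threshold [1 / 2] of [bc_solve]. *)
have zh : cmod (z - a) <= 10^-1 by have := cmod_insq z20; lra.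
have hz : cmod (z - a) < 1 by lra.
have := taylor 1 ltr01 d1 b1 hz.
rewrite big_ord1 taylor0// fa mul0r mul0r subr0 [a + _]addrC subrK => H.
have z1 : insq a 1 z by apply: insq_cmod; exact: ltW.
rewrite (_ : 2 * B = 4 * (B * 2^-1)); last by field.
apply: bc_solve (fB _ z1) _ => //.
  by rewrite invr_gt0 ltr0n lexx.
apply: le_trans H _; rewrite expr1 !mulr1 divr1 ler_pdivrMr; last by rewrite subr_gt0.
by move: (cmod (z - a)) zh => u; lra.
Qed.

(* The logarithm [g] of [f / f a] has [Re g <= A], so [g / (2A - g)] is bounded
   by 1; it is [O(1 / A)] near [a], hence small on the whole disc. *)
Lemma nonvanishing_bound (dl eta : R) : 0 < dl <= 1 -> 0 < eta <= 2^-1 ->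
  exists X : R, forall (A r : R) f a, X <= A -> 2 <= r <= 3 ->
    (forall z, insq a r z -> cdiff f z) -> (forall z, insq a r z -> f z != 0) ->
    2^-1 <= cmod (f a) <= 2 -> (forall z, insq a 1 z -> cmod (f z) <= 2) ->
    (forall z, insq a r z -> 2 * cmod (f z) <= expR A) ->
    forall h, cmod h <= r - dl -> cmod (f (a + h)) <= 2 * expR (4 * (A * eta)).
Proof.
move=> /andP[dl0 dl1] /andP[eta0 eta1].
(* On the unit square [|f / f a| <= 4], because [|f| <= 2] and [|f a| >= 1 / 2]. *)
have [B B0 BE] : exists2 B : R, 0 < B & expR B = 4.
  by exists (ln 4); [apply: ln_gt0; lra|rewrite lnK ?posrE].
have i20 : 0 < 20^-1 :> R by rewrite invr_gt0.
have i203 : 20^-1 <= 3 :> R by lra.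
have dl3 : 0 < dl / 3 by rewrite divr_gt0.
have [e e0 TC] := @two_constants_small R 20^-1 3 (dl / 3) 1 eta i20 i203 dl3 ler01 eta0.
(* Near [a] one has [|g| <= 2 B], and [A >= B + B / e] makes the quotient at most
   [2 B / (2 A - 2 B) <= e]. Below, one third of [dl] is spent on the logarithm and one third on the
   two-constants inequality. *)
exists (B + B / e) => A r f a XA /andP[r2 r3] df f0 /andP[fa1 fa2] f1 fA h hr.
have Be0 : 0 <= B / e by rewrite divr_ge0 ?(ltW B0) ?(ltW e0).
have A0 : 0 < A by apply: lt_le_trans XA; rewrite ltr_wpDr.
pose t := r - dl / 3.
have t1 : 1 <= t by rewrite /t; lra.
have trange : 0 < t < r by rewrite /t; lra.
have t203 : 20^-1 <= t <= 3 by rewrite /t; lra.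
have ht : cmod h <= t - dl / 3 by rewrite /t; lra.
have ht' : cmod h <= t by lra.
have tr : t <= r by lra.
clearbody t.
have [g ga gP] := clog_exists trange df f0.
have fap : 0 < cmod (f a) by lra.
have dg z : insq a t z -> cdiff g z by case/gP.
have Reg z (k : R) : insq a t z -> 2 * cmod (f z) <= expR k -> Re (g z) <= k.
  move=> zt; rewrite -[Re _ <= k]ler_expR; apply: le_trans.
  have [_ ->] := gP z zt; rewrite cmodM cmod_cexp mulrA ler_peMl ?expR_ge0//; lra.
have RegA z : insq a t z -> Re (g z) <= A.
  by move=> zt; apply: Reg => //; apply: fA; exact: insq_sub zt.
have sq1 z : insq a 1 z -> insq a t z by exact: insq_sub.
have RegB z : insq a 1 z -> Re (g z) <= B.
  by move=> z1; apply: (Reg z B (sq1 _ z1)); rewrite BE; have := f1 _ z1; lra.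
have dg1 z : insq a 1 z -> cdiff g z by move=> z1; apply: dg; exact: sq1.
have gsmall := log_bound_near B0 ga dg1 RegB.
have [dA bA] := bc_quotient A0 dg RegA.
have fe z : insq a 20^-1 z -> cmod (g z / ((2 * A)%:C - g z)) <= e.
  move=> z20; have z1 : insq a t z by apply: sq1; apply: insq_sub z20; lra.
  have [n0 _] := cmod_bc A0 (RegA z z1).
  rewrite cmodM cmodV ler_pdivrMr ?cmod_gt0//.
  apply: le_trans (gsmall z z20) _.
  have lb : 2 * A - cmod (g z) <= cmod ((2 * A)%:C - g z).
    have := cmod_lb (2 * A)%:C (- g z); rewrite cmodN cmodR gtr0_norm//; lra.
  apply: (@le_trans _ _ (e * (2 * A - cmod (g z)))); last by rewrite ler_pM2l.
  have := gsmall z z20; move: (cmod (g z)) => u u2.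
  apply: (@le_trans _ _ (e * (2 * (B / e)))); last by rewrite ler_pM2l//; lra.
  by rewrite mulrCA mulrC [e * _]mulrC divfK ?gt_eqF// mulrC.
have H := TC t _ a t203 dA bA fe h ht.
have hst : insq a t (a + h) by apply: insq_cmod; rewrite [a + h]addrC addrK.
have gs : cmod (g (a + h)) <= 4 * (A * eta).
  by apply: bc_solve H => //; [rewrite eta0|exact: RegA].
have [_ ->] := gP _ hst; rewrite cmodM cmod_cexp.
apply: ler_pM; rewrite ?cmod_ge0 ?expR_ge0// ler_expR.
by apply: le_trans gs; apply: le_trans (ler_norm _) (cmod_Re _).
Qed.

End LogBound.

(** * Growth of zeta, in general and to the right of its zeros *)

Section Zeta.
Variable R : realType.
Local Notation C := R[i].
Local Notation Re := complex.Re.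
Local Notation Im := complex.Im.
Implicit Types (f g : C -> C) (r c x y B T : R) (p z w h s a : C) (m n L : nat).
Variable zeta : C -> C.
Hypothesis hzeta : is_riemann_zeta zeta.

Lemma cdiff_zeta s : s != 1 -> cdiff zeta s.
Proof. by move=> s1; apply: holomorphic_cdiff; exact: hzeta.1. Qed.

Lemma zeta_lim s (e : R) : 1 < Re s -> 0 < e -> exists N, forall n, (N <= n)%N ->
  cmod (zeta s - \sum_(k < n) dterm k.+1 s) < e.
Proof.
move=> s1 e0; have := hzeta.2 s s1 => /cvgrPdist_lt/(_ e%:C).
rewrite ltcR => /(_ e0)[N _ H]; exists N => n Nn.
have := H n Nn; rewrite /= normr_cmod ltcR /series /= big_mkord.
have E : \sum_(k < n) dterm k.+1 s = \sum_(k < n) (natcpow k.+1 s)^-1.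
  by apply: eq_bigr => k _; exact: dtermE.
by rewrite E.
Qed.

Lemma zeta_tail c L s : 0 < c -> 1 + c <= Re s -> (0 < L)%N ->
  cmod (zeta s - \sum_(k < L) dterm k.+1 s) <= L%:R `^ (- c) / c.
Proof.
move=> c0 cs L0; apply/ler_addgt0Pr => e e0.
have s1 : 1 < Re s by lra.
have [N /(_ (maxn N L) (leq_maxl _ _)) H] := zeta_lim s1 e0.
have := dterm_tail c0 cs L0 (leq_maxr N L).
set S := \sum_(k < maxn _ _) _ in H *; set S' := \sum_(k < L) _ => H'.
rewrite (_ : zeta s - S' = (S - S') + (zeta s - S)); last by ring.
by rewrite (le_trans (cmodD _ _))// lerD// ltW.
Qed.

Lemma zeta_bound c s : 0 < c -> 1 + c <= Re s -> cmod (zeta s) <= 1 + c^-1.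
Proof.
move=> c0 cs; have := zeta_tail c0 cs (ltn0Sn 0); rewrite big_ord1 powR1 mul1r => H.
rewrite -[zeta s](subrK (dterm 1 s)) addrC (le_trans (cmodD _ _))//.
by rewrite lerD// cmod_dterm ln1 mulr0 oppr0 expR0.
Qed.

Lemma zeta_near1 s : 3 <= Re s -> 2^-1 <= cmod (zeta s).
Proof.
move=> s3; have := @zeta_tail 2 1 s (ltr0Sn R 1); rewrite big_ord1 powR1 mul1r.
have d1 : dterm 1 s = 1 by rewrite /dterm ln1 mulr0 oppr0 cexp0.
rewrite d1 => H; have {}H : cmod (zeta s - 1) <= 2^-1 by apply: H => //; lra.
have := cmod_lb 1 (zeta s - 1).
rewrite cmod1 (_ : 1 + (zeta s - 1) = zeta s); last by ring.
by lra.
Qed.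

Lemma Vsum_lim L s : 2 <= Re s ->
  cmod ((s - 1) * zeta s - Vsum L.+1 s) <= (cmod (s - 1) + 1) * (L.+1)%:R^-1.
Proof.
move=> s2; have s2' : 1 + 1 <= Re s by lra.
rewrite /Vsum opprD addrA -mulrBr.
apply: le_trans (cmodB _ _) _; rewrite [leRHS]mulrDl mul1r; apply: lerD.
  rewrite cmodM ler_wpM2l ?cmod_ge0//.
  have := zeta_tail ltr01 s2' (ltn0Sn L).
  by rewrite powR_inv1// divr1.
rewrite cmod_dterm_pow -[leRHS]powR_inv1//.
apply: (@le_trans _ _ ((L.+2)%:R `^ (- 1))).
  by rewrite ler_powR ?ler1n// ReB /=; lra.
by rewrite !powR_inv1// lef_pV2 ?posrE// ler_nat.
Qed.

(** [(s - 1) * zeta s - Vsum L.+1 s] is bounded on a square around [3 + i Im s], uniformly in [L],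
    and arbitrarily small on its unit subsquare when [L] is large. The two-constants inequality
    carries the smallness over to [s], where [Vsum] has an explicit bound. *)
Lemma zeta_poly_bound s : 8^-1 <= Re s -> 4 <= `|Im s| -> cmod (zeta s) <= 200 * `|Im s|.
Proof.
move=> s8 s4.
have [s2|s2] := leP 2 (Re s).
  have s2' : 1 + 1 <= Re s by lra.
  by have := zeta_bound ltr01 s2'; rewrite invr1; lra.
(* One margin of [1 / 16] keeps the square in [Re z >= 1 / 16], a second one separates [s], with
   [Re s >= 1 / 8], from its boundary. *)
pose a : C := 3 +i* Im s; pose r : R := 3 - 16^-1.
have r1 : 1 <= r by rewrite /r; lra.
have ar z : insq a r z -> 16^-1 <= Re z /\ 1 <= `|Im z|.
  move=> /andP[/andP[z1 _] /andP[z3 z4]]; move: z1 z3 z4; rewrite /r /=.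
  move=> z1 z3 z4; split; first by lra.
  by move: s4; rewrite !ler_normr => /orP[] ?; apply/orP; [left|right]; lra.
have dz z : insq a r z -> z != 1.
  by move=> /ar[_]; apply: contraTneq => ->; rewrite /= normr0 ler10.
have df L z : insq a r z -> cdiff (fun w => (w - 1) * zeta w - Vsum L.+1 w) z.
  move=> zr; apply: cdiffB; last exact: cdiff_Vsum.
  apply: cdiffM; last exact/cdiff_zeta/dz.
  by apply: cdiffB; [exact: cdiff_id|exact: cdiff_const].
have r0 : 0 <= r by lra.
(* This bound depends on [s] without control. It enters only the choice of [L], and the bound of
   [Vsum] does not depend on [L]. *)
have [B1 B10 H1] := insq_bounded r0 (fun z zr => cdiff_zeta (dz z zr)).
pose A := cmod a + 2 * r + 1.
have A0 : 0 <= A by rewrite /A; have := cmod_ge0 a; lra.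
have zA z : insq a r z -> cmod z <= A /\ cmod (z - 1) <= A.
  move=> /cmod_insq zr; have : cmod z <= cmod (z - a) + cmod a.
    by rewrite -{1}(subrK a z) cmodD.
  by have := cmodB z 1; rewrite cmod1 /A; lra.
pose B := A * B1 + (1 + 8 * (A * A) * 17).
have B0 : 0 <= B by rewrite addr_ge0 ?mulr_ge0// addr_ge0// !mulr_ge0.
have fB L z : insq a r z -> cmod ((z - 1) * zeta z - Vsum L.+1 z) <= B.
  move=> zr; have [z1 z2] := zA _ zr; have [z3 _] := ar _ zr.
  apply: le_trans (cmodB _ _) _; apply: lerD.
    by rewrite cmodM ler_pM ?cmod_ge0 ?H1.
  apply: le_trans (Vsum_bound _ _) _; first by lra.
  rewrite lerD2l; apply: ler_pM.
  - by rewrite !mulr_ge0 ?cmod_ge0.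
  - by rewrite addr_ge0// invr_ge0; lra.
  - by rewrite ler_wpM2l// ler_pM ?cmod_ge0.
  - have : (Re z)^-1 <= 16 by rewrite -[16]invrK lef_pV2 ?posrE//; lra.
    by lra.
have [e e0 TC] := @two_constants_small R 1 r 16^-1 B 1 ltr01 r1 (ltac:(by [])) B0 ltr01.
have Ae : 0 < (A + 1) / e by rewrite divr_gt0// ltr_wpDl.
pose L := Num.truncn ((A + 1) / e).
have L1 : (A + 1) * (L.+1)%:R^-1 <= e.
  rewrite ler_pdivrMr// mulrC -ler_pdivrMr// ltW//.
  by apply: truncnS_gt.
have fe z : insq a 1 z -> cmod ((z - 1) * zeta z - Vsum L.+1 z) <= e.
  move=> z1; have [_ z2] := zA _ (insq_sub r1 z1).
  apply: le_trans L1; apply: le_trans (Vsum_lim _ _) _.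
    by case/andP: z1 => /andP[+ _] _; rewrite /=; lra.
  by rewrite ler_wpM2r// lerD2r.
have := TC r _ a _ (df L) (fB L) fe (s - a); rewrite r1 lexx => /(_ isT).
have sa : s - a = (Re s - 3)%:C.
  by apply: complex_eq; rewrite ?ReB ?ImB /=; ring.
have -> : cmod (s - a) = 3 - Re s.
  by rewrite sa cmodR ler0_norm; lra.
rewrite [a + _]addrC subrK => H.
have {}H : cmod ((s - 1) * zeta s - Vsum L.+1 s) <= 1 by apply: H; rewrite /r; lra.
have sRe0 : 0 < Re s by lra.
have V := Vsum_bound L.+1 sRe0.
have s1 : 4 <= cmod (s - 1).
  by apply: le_trans s4 _; have := cmod_Im (s - 1); rewrite ImB subr0.
have s18 : (Re s)^-1 <= 8 by rewrite -[8]invrK lef_pV2 ?posrE.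
have ss : cmod s <= 2 * `|Im s|.
  by apply: le_trans (cmod_leD _) _; rewrite ger0_norm; lra.
have K : cmod (s - 1) * cmod (zeta s) <= cmod (s - 1) * (200 * `|Im s|).
  rewrite -cmodM -[_ * _](subrK (Vsum L.+1 s)); apply: le_trans (cmodD _ _) _.
  apply: le_trans (lerD H V) _.
  have : cmod s * cmod (s - 1) * (1 + (Re s)^-1) <= (2 * `|Im s|) * cmod (s - 1) * 9.
    apply: ler_pM; rewrite ?mulr_ge0 ?cmod_ge0//; last by lra.
      by rewrite addr_ge0// invr_ge0 ltW.
    by rewrite ler_wpM2r ?cmod_ge0.
  have : 4 * 4 <= `|Im s| * cmod (s - 1) by apply: ler_pM.
  by lra.
by move: K; rewrite ler_pM2l//; lra.
Qed.

(** [nonvanishing_bound] on the square centred at [3 + i tau] with half-side [3 - sg]. There [zeta]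
    is polynomially bounded, so [A = ln T + O(1)], and a small [eta] turns [exp (4 A eta)] into a
    small power of [T]. The condition [|tau| >= 10] keeps the square away from the pole. *)
Lemma zeta_zero_free (dl dl' : R) : 0 < dl <= 1 -> 0 < dl' ->
  exists2 T1 : R, 1 <= T1 & forall T sg tau : R, T1 <= T -> 4^-1 <= sg <= 1 ->
    10 <= `|tau| <= 4 * T ->
    (forall z, sg <= Re z -> `|Im z - tau| <= 4 -> zeta z != 0) ->
    forall s, Im s = tau -> sg + dl <= Re s -> cmod (zeta s) <= T `^ dl'.
Proof.
move=> dl01 dl'0.
(* On the square [|Im z| <= 4 T + 3 <= 7 T], and 200 is the constant of [zeta_poly_bound]. *)
have [M ME] : exists M : R, forall T, 0 < T -> 2 * (200 * (7 * T)) <= expR (M + ln T).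
  exists (ln (2 * (200 * 7))) => T T0; rewrite expRD !lnK ?posrE//.
  by rewrite le_eqVlt; apply/orP; left; apply/eqP; ring.
have [N2 NE] : exists N : R, expR N = 2.
  by exists (ln 2); rewrite lnK ?posrE.
(* With [eta <= dl' / 8] the exponent [4 A eta] is at most [dl' / 2 * (ln T + O(1))]; the other half
   of [dl'] pays for the constants. *)
have eta01 : 0 < Num.min 2^-1 (dl' / 8) <= 2^-1.
  by rewrite lt_min invr_gt0 ltr0n divr_gt0//= ge_min lexx.
have eta2 : Num.min 2^-1 (dl' / 8) <= dl' / 8 by rewrite ge_min lexx orbT.
have [X HX] := nonvanishing_bound dl01 eta01.
move: (Num.min _ _) eta01 eta2 HX => eta /andP[eta0 _] eta2 HX.
(* Thresholds for [ln T]: in turn they give [X <= M + ln T], then [2 <= T ^ dl'], then the final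
   comparison [fin]. *)
pose Y := Num.max 0 (Num.max (X - M) (Num.max (N2 / dl') ((N2 + dl' / 2 * Num.max 0 M) / (dl' / 2)))).
have [Y0 Y1 Y2 Y3] : [/\ 0 <= Y, X - M <= Y, N2 / dl' <= Y &
    (N2 + dl' / 2 * Num.max 0 M) / (dl' / 2) <= Y].
  by rewrite /Y !le_max !lexx !orbT.
exists (expR Y) => [|T sg tau T1 /andP[sg1 sg2] /andP[tau1 tau2] nz s sE sdl].
  by rewrite -expR0 ler_expR.
clearbody Y; have T0 : 0 < T by apply: lt_le_trans T1; exact: expR_gt0.
have YT : Y <= ln T by rewrite -(expRK Y) ler_ln ?posrE ?expR_gt0.
have T11 : 1 <= T by apply: le_trans T1; rewrite -expR0 ler_expR.
have TE : T `^ dl' = expR (dl' * ln T) by rewrite /powR gt_eqF.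
have two_le : 2 <= T `^ dl'.
  rewrite TE -NE ler_expR mulrC -ler_pdivrMr//; exact: le_trans YT.
have fin : 2 * expR (4 * ((M + ln T) * eta)) <= T `^ dl'.
  rewrite TE -NE -expRD ler_expR.
  have l0 : 0 <= ln T by exact: le_trans YT.
  have M1 : M <= Num.max 0 M by rewrite le_max lexx orbT.
  have M2 : 0 <= Num.max 0 M by rewrite le_max lexx.
  move: (Num.max 0 M) Y3 M1 M2 => M' Y3 M1 M2.
  have : N2 + dl' / 2 * M' <= dl' / 2 * ln T.
    by rewrite [leRHS]mulrC -ler_pdivrMr ?divr_gt0//; exact: le_trans YT.
  have : (M + ln T) * eta <= (M' + ln T) * (dl' / 8).
    apply: (@le_trans _ _ ((M' + ln T) * eta)); first by rewrite ler_pM2r// lerD2r.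
    by rewrite ler_wpM2l// addr_ge0.
  by lra.
have XA : X <= M + ln T by lra.
have := HX (M + ln T) (3 - sg) zeta (3 +i* tau) XA.
clear HX Y1 Y2 Y3 T1 YT XA Y0 eta0 eta2 N2 NE TE.
have [s2 _|s2 H] := leP 2 (Re s).
  have s2' : 1 + 1 <= Re s by lra.
  by apply: le_trans (zeta_bound ltr01 s2') _; rewrite invr1; lra.
have sa : s - (3 +i* tau) = (Re s - 3)%:C.
  by apply: complex_eq; rewrite ?ReB ?ImB /= ?sE; ring.
have csa : cmod (s - (3 +i* tau)) = 3 - Re s by rewrite sa cmodR ler0_norm; lra.
have s23 : 1 + 1 <= 3 :> R by lra.
have ME' := ME T T0; clear ME.
apply: le_trans fin; rewrite -(subrK (3 +i* tau) s) addrC.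
set a : C := 3 +i* tau in H sa csa *.
have ar z : insq a (3 - sg) z -> [/\ sg <= Re z, `|Im z - tau| <= 3 & zeta z != 0].
  move=> zr; have : insq a (3 - sg) z by []; rewrite insqP ReB ImB /= => /andP[_ z2].
  case/andP: (zr) => /andP[z1 _] _; rewrite /= in z1.
  have z3 : `|Im z - tau| <= 3 by lra.
  by split; [lra|done|apply: nz; lra].
have az z : insq a (3 - sg) z -> 4 <= `|Im z| /\ `|Im z| <= 7 * T.
  move=> /ar[_ z1 _]; split.
    have := ler_normB (Im z) (Im z - tau); rewrite (_ : Im z - (Im z - tau) = tau); last by ring.
    by lra.
  have := ler_normD (Im z - tau) tau; rewrite subrK; lra.
apply: H; first by lra.
- move=> z /az[z1 _]; apply: cdiff_zeta.
  by apply: contraTneq z1 => ->; rewrite /= normr0 -ltNge.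
- by move=> z /ar[].
- rewrite (zeta_near1 (s := a))//=.
  by apply: le_trans (zeta_bound (s := a) ltr01 s23) _; rewrite invr1.
- move=> z /andP[/andP[z1 _] _]; rewrite /= in z1.
  have s2' : 1 + 1 <= Re z by lra.
  by apply: le_trans (zeta_bound ltr01 s2') _; rewrite invr1.
- move=> z zr; have [z1 z2] := az _ zr; have [z3 _ _] := ar _ zr.
  apply: le_trans ME'; rewrite ler_pM2l//.
  apply: le_trans (zeta_poly_bound _ z1) _; first by lra.
  by rewrite ler_pM2l.
- by rewrite csa; lra.
Qed.

End Zeta.

(** * Perron's formula *)

Section Perron.
Variable R : realType.
Local Notation C := R[i].
Local Notation Re := complex.Re.
Local Notation Im := complex.Im.
Local Notation twopii := (twopii R).
Implicit Types (f g : C -> C) (c x y t N : R) (z w h : C) (m n k : nat).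

Lemma VintZ z f x (a b : R) : ccts (fun y => f (x +i* y)) a b ->
  Vint (fun w => z * f w) x a b = z * Vint f x a b.
Proof. by move=> cf; rewrite !VintE cintZ. Qed.

Lemma VintD f g x (a b : R) : ccts (fun y => f (x +i* y)) a b ->
  ccts (fun y => g (x +i* y)) a b ->
  Vint (fun w => f w + g w) x a b = Vint f x a b + Vint g x a b.
Proof. by move=> cf cg; rewrite !VintE cintD. Qed.

Lemma VintB f g x (a b : R) : ccts (fun y => f (x +i* y)) a b ->
  ccts (fun y => g (x +i* y)) a b ->
  Vint (fun w => f w - g w) x a b = Vint f x a b - Vint g x a b.
Proof. by move=> cf cg; rewrite !VintE cintB//; exact: cctsZ. Qed.

Lemma Vint_eq f g x (a b : R) : (forall y, a <= y <= b -> f (x +i* y) = g (x +i* y)) ->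
  Vint f x a b = Vint g x a b.
Proof. by move=> fg; rewrite !VintE; apply: cint_eq => y /fg. Qed.

Lemma Vint_sum (F : nat -> C -> C) m x (a b : R) :
  (forall j, ccts (fun y => F j (x +i* y)) a b) ->
  ccts (fun y => \sum_(j < m) F j (x +i* y)) a b /\
  Vint (fun w => \sum_(j < m) F j w) x a b = \sum_(j < m) Vint (F j) x a b.
Proof.
move=> cF; have [] := @cint_sum R _ (index_enum 'I_m) xpredT
  (fun (j : 'I_m) y => F j (x +i* y)) a b (fun j _ => cF j).
by move=> E1 E2; split => //; rewrite VintE E1; apply: eq_bigr => j _; rewrite VintE.
Qed.

(** A double pole at [z] with residue [x]: the full vertical integral to the right of [z] is
    [2 pi i] times the positive part of [x]. *)
Definition pker x z w : C := cexp (x%:C * (w - z)) / (w - z) ^+ 2.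

Lemma cdiff_expl x z w : cdiff (fun w => cexp (x%:C * (w - z))) w.
Proof.
apply: cdiff_comp (cdiff_cexp _); apply: cdiffM; first exact: cdiff_const.
by apply: cdiffB; [exact: cdiff_id|exact: cdiff_const].
Qed.

Lemma cdiff_pker x z w : w != z -> cdiff (pker x z) w.
Proof. by move=> wz; apply: cdiff_pole => //; exact: cdiff_expl. Qed.

Lemma pker_bound x z w (D E : R) : 0 < D -> D <= cmod (w - z) ->
  expR (x * Re (w - z)) <= E -> cmod (pker x z w) <= E / D ^+ 2.
Proof.
move=> D0 Dw eE; rewrite /pker cmodM cmodV cmodX cmod_cexp ReM /= mul0r subr0.
have wp : 0 < cmod (w - z) by exact: lt_le_trans Dw.
apply: ler_pM; rewrite ?expR_ge0 ?invr_ge0 ?exprn_ge0 ?cmod_ge0//.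
by rewrite lef_pV2 ?posrE ?exprn_gt0// lerXn2r// nnegrE ltW.
Qed.

(** For [x <= 0] the segment is closed to the right, where the kernel is holomorphic; for [x > 0] to
    the left, around the double pole. The new sides have length [O(N)] and lie at distance at least
    [N / 2] from the pole, whence an error [O(exp (c x) / N)]. *)
Lemma perron_term x c t N : 0 < c <= 1 -> 1 <= N -> 2 * `|t| <= N ->
  cmod ('i * Vint (pker x (1 +i* t)) (1 + c) (- N) N - twopii * (Num.max 0 x)%:C) <=
  40 * expR (c * x) / N.
Proof.
move=> /andP[c0 c1] N1 tN; set w0 : C := 1 +i* t.
have N0 : 0 < N by lra.
have N20 : 0 < N / 2 by rewrite divr_gt0.
have EN0 : 0 <= expR (c * x) / N by rewrite divr_ge0 ?expR_ge0 ?(ltW N0).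
have imlb w : `|Im w| = N -> N / 2 <= cmod (w - w0).
  move=> wN; apply: le_trans (cmod_Im _); rewrite ImB /=.
  have := ler_normB (Im w) (Im w - t); rewrite (_ : Im w - (Im w - t) = t); last by ring.
  have := ler_normD (Im w - t) t; rewrite subrK wN; lra.
have sq4 (E : R) : E / (N / 2) ^+ 2 * N = 4 * (E / N) by field; rewrite gt_eqF.
have sq1 (E : R) : E / N ^+ 2 * N = E / N by field; rewrite gt_eqF.
have dp w : w - w0 != 0 -> cdiff (pker x w0) w.
  by rewrite subr_eq0; exact: cdiff_pker.
have dpp w (D : R) : 0 < D -> D <= cmod (w - w0) -> cdiff (pker x w0) w.
  by move=> D0 Dw; apply: dp; rewrite -cmod_gt0; exact: lt_le_trans Dw.
have [x0|/ltW x0] := leP x 0.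
  rewrite mulr0 subr0; pose b := 1 + c + N.
  have ab : 1 + c <= b by rewrite /b; lra.
  have NN : - N <= N by lra.
  have relb w : 1 + c <= Re w -> c <= cmod (w - w0).
    by move=> wc; apply: le_trans (cmod_Re _); rewrite ReB /=; apply: le_trans (ler_norm _); lra.
  have G := @goursat _ (pker x w0) (1 + c) b (- N) N ab NN.
  rewrite rectE in G.
  have {}G : Hint (pker x w0) (- N) (1 + c) b + 'i * Vint (pker x w0) b (- N) N -
    Hint (pker x w0) N (1 + c) b - 'i * Vint (pker x w0) (1 + c) (- N) N = 0.
    by apply: G => w /andP[/andP[w1 _] _]; apply: (dpp _ c) => //; exact: relb.
  rewrite (_ : 'i * _ = Hint (pker x w0) (- N) (1 + c) b + 'i * Vint (pker x w0) b (- N) N -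
    Hint (pker x w0) N (1 + c) b); last by move/eqP: G; rewrite subr_eq0 => /eqP <-.
  have eb (u : R) : 1 + c <= u -> expR (x * (u - 1)) <= expR (c * x).
    by move=> cu; rewrite ler_expR mulrC ler_wnM2r//; lra.
  have HB (y : R) : `|y| = N -> cmod (Hint (pker x w0) y (1 + c) b) <= 8 * (expR (c * x) / N).
    move=> yN; apply: le_trans (_ : _ <= 2 * (expR (c * x) / (N / 2) ^+ 2) * (b - (1 + c))) _.
      apply: Hint_bound => //.
        by apply: cdiff_Hccts => u _; apply: (dpp _ _ N20); exact: imlb.
      move=> u /andP[u1 _]; apply: pker_bound => //; first exact: imlb.
      by rewrite ReB; exact: eb.
    by rewrite (_ : b - (1 + c) = N) /b; [rewrite -mulrA sq4; lra|ring].
  have VB : cmod ('i * Vint (pker x w0) b (- N) N) <= 4 * (expR (c * x) / N).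
    have lb y : N <= cmod (b +i* y - w0).
      apply: le_trans (cmod_Re _); rewrite ReB /=; apply: le_trans (ler_norm _).
      by rewrite /b; lra.
    rewrite cmodM cmodi mul1r.
    apply: le_trans (_ : _ <= 2 * (expR (c * x) / N ^+ 2) * (N - - N)) _.
      apply: Vint_bound => //.
        by apply: cdiff_Vccts => u _; apply: (dpp _ _ N0); exact: lb.
      move=> u _; apply: pker_bound => //.
      by rewrite ReB /=; exact: eb.
    by rewrite opprK -mulrA mulrDr sq1; lra.
  have NN' : `|- N| = N by rewrite normrN gtr0_norm.
  have NN'' : `|N| = N by rewrite gtr0_norm.
  apply: le_trans (cmodB _ _) _.
  have := cmodD (Hint (pker x w0) (- N) (1 + c) b) ('i * Vint (pker x w0) b (- N) N).
  have := HB _ NN'; have := HB _ NN''; move: VB EN0.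
  by rewrite -mulrA; lra.
pose a := 1 - N.
have ab : a <= 1 + c by rewrite /a; lra.
have NN : - N <= N by lra.
have ex1 : 1 <= expR (c * x) by rewrite -expR0 ler_expR mulr_ge0// ltW.
have cd0 : 0 < c / 2 by rewrite divr_gt0.
have tn : - (N / 2) <= t <= N / 2 by rewrite -ler_norml; lra.
have G : rect (pker x w0) a (1 + c) (- N) N = twopii * x%:C.
  rewrite (@rect_punctured _ (pker x w0) a (1 + c) (- N) N w0 (c / 2))//=.
  - have dfe z : insq w0 (c / 2) z -> cdiff (fun w => cexp (x%:C * (w - w0))) z.
      by move=> _; exact: cdiff_expl.
    have T := tcoef_cder cd0 dfe.
    have -> : sq (pker x w0) w0 (c / 2) =
        twopii * tcoef (fun w => cexp (x%:C * (w - w0))) w0 (c / 2) 1.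
      by rewrite /tcoef mulVKf ?twopii_neq0.
    congr (_ * _); apply: cder_unique T _.
    have := cder_comp (cderZ x%:C (cderB (cder_id w0) (cder_const w0 w0))) (cder_cexp _).
    by move=> /cder_eq; apply; rewrite /= subrr mulr0 cexp0 subr0 mulr1 mul1r.
  - by rewrite /a; lra.
  - by lra.
  - by lra.
  - by lra.
  - by move=> z _; exact: cdiff_pker.
rewrite rectE in G.
rewrite (_ : 'i * _ - _ = Hint (pker x w0) N a (1 + c) + 'i * Vint (pker x w0) a (- N) N -
    Hint (pker x w0) (- N) a (1 + c)); last by rewrite -G; ring.
have eb (u : R) : u <= 1 + c -> expR (x * (u - 1)) <= expR (c * x).
  by move=> cu; rewrite ler_expR mulrC ler_wpM2r//; lra.
have HB (y : R) : `|y| = N -> cmod (Hint (pker x w0) y a (1 + c)) <= 16 * (expR (c * x) / N).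
  move=> yN; apply: le_trans (_ : _ <= 2 * (expR (c * x) / (N / 2) ^+ 2) * (1 + c - a)) _.
    apply: Hint_bound => //.
      by apply: cdiff_Hccts => u _; apply: (dpp _ _ N20); exact: imlb.
    move=> u /andP[_ u1]; apply: pker_bound => //; first exact: imlb.
    by rewrite ReB; exact: eb.
  apply: (@le_trans _ _ (2 * (expR (c * x) / (N / 2) ^+ 2) * (2 * N))).
    apply: ler_wpM2l; last by rewrite /a; lra.
    by rewrite !mulr_ge0 ?invr_ge0 ?exprn_ge0 ?expR_ge0 ?(ltW N20).
  rewrite (_ : 2 * _ * (2 * N) = 4 * (expR (c * x) / (N / 2) ^+ 2 * N)); last by ring.
  by rewrite sq4; lra.
have VB : cmod ('i * Vint (pker x w0) a (- N) N) <= 4 * (expR (c * x) / N).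
  have lb y : N <= cmod (a +i* y - w0).
    apply: le_trans (cmod_Re _); rewrite ReB /= /a.
    by rewrite (_ : 1 - N - 1 = - N) ?normrN ?gtr0_norm//; ring.
  rewrite cmodM cmodi mul1r.
  apply: le_trans (_ : _ <= 2 * (expR (c * x) / N ^+ 2) * (N - - N)) _.
    apply: Vint_bound => //.
      by apply: cdiff_Vccts => u _; apply: (dpp _ _ N0); exact: lb.
    move=> u _; apply: pker_bound => //.
    by rewrite ReB /=; apply: eb; rewrite /a; lra.
  by rewrite opprK -mulrA mulrDr sq1; lra.
have NN' : `|- N| = N by rewrite normrN gtr0_norm.
have NN'' : `|N| = N by rewrite gtr0_norm.
apply: le_trans (cmodB _ _) _.
have := cmodD (Hint (pker x w0) N a (1 + c)) ('i * Vint (pker x w0) a (- N) N).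
have := HB _ NN'; have := HB _ NN''; move: VB EN0.
by rewrite -mulrA; lra.
Qed.

Definition lnn n : R := ln n%:R.
Definition lam n : R := lnn n.+1 - lnn n.

(* [phi n s / s^2] is the Mellin transform of the piecewise linear (in
   [log m]) cutoff equal to 1 for [m <= n] and to 0 for [m >= n + 1]. *)
Definition phi n s : C := (cexp ((lnn n.+1)%:C * s) - cexp ((lnn n)%:C * s)) / (lam n)%:C.

Lemma lam_ge n : (0 < n)%N -> (n.+1)%:R^-1 <= lam n.
Proof.
move=> n0; have n0' : 0 < n%:R :> R by rewrite ltr0n.
have n1 : 0 < (n.+1)%:R :> R by rewrite ltr0n.
rewrite /lam -[_ - _]opprB lerNr /lnn -ln_div ?posrE//.
rewrite (_ : _ / _ = 1 + - (n.+1)%:R^-1).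
  by apply: le_ln1Dx; rewrite ltrN2 invf_lt1// ltr1n.
by rewrite -(natr1 n); field; rewrite natr1 gt_eqF.
Qed.

Lemma lam_gt0 n : (0 < n)%N -> 0 < lam n.
Proof. by move=> /lam_ge; apply: lt_le_trans; rewrite invr_gt0. Qed.

Lemma lamV_le n : (0 < n)%N -> (lam n)^-1 <= (n.+1)%:R.
Proof.
move=> n0; rewrite -[leRHS]invrK lef_pV2 ?posrE ?lam_gt0 ?invr_gt0//; exact: lam_ge.
Qed.

Lemma cdiff_phi n s : cdiff (phi n) s.
Proof.
have d x : cdiff (fun s => cexp (x%:C * s)) s.
  apply: cdiff_comp (cdiff_cexp _); apply: cdiffM; [exact: cdiff_const|exact: cdiff_id].
by apply: cdiffM; [apply: cdiffB; exact: d|exact: cdiff_const].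
Qed.

Lemma phi_bound n s (E : R) : (0 < n)%N -> expR (Re s * lnn n) <= E ->
  expR (Re s * lnn n.+1) <= E -> cmod (phi n s) <= 2 * cmod s * E.
Proof.
move=> n0 E1 E2; rewrite /phi cmodM cmodV cmodR gtr0_norm ?lam_gt0//.
rewrite ler_pdivrMr ?lam_gt0// ![_%:C * s]mulrC.
rewrite (_ : 2 * cmod s * E * lam n = 2 * (cmod s * E) * lam n); last by ring.
apply: exp_diff => //.
by rewrite /lnn ler_ln ?posrE ?ltr0n// ler_nat.
Qed.

(** The error of truncating at height [N], up to the factor [(m + 1) ^ (- (1 + c))] of the
    individual term. Dividing by [lam n], of size [1 / n], is the cost of smoothing on so short a
    scale. *)
Definition perr n c N : R := 80 * expR (c * lnn n.+1) / (N * lam n).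

Lemma dterm_split m z w : dterm m w = dterm m z * cexp ((- lnn m)%:C * (w - z)).
Proof. by rewrite /dterm -cexpD; congr cexp; rewrite rmorphN /lnn /=; ring. Qed.

(** [phi n s / s ^+ 2] is the difference of two kernels [pker] divided by [lam n]. No integer lies
    strictly between [n] and [n + 1], so on integers the piecewise linear cutoff is the sharp
    one. *)
Lemma perron_dterm n m c t N : (0 < n)%N -> 0 < c <= 1 -> 1 <= N -> 2 * `|t| <= N ->
  ccts (fun y => dterm m.+1 ((1 + c) +i* y) * (phi n ((1 + c) +i* y - (1 +i* t)) /
         ((1 + c) +i* y - (1 +i* t)) ^+ 2)) (- N) N /\
  cmod ('i * Vint (fun w => dterm m.+1 w * (phi n (w - (1 +i* t)) / (w - (1 +i* t)) ^+ 2))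
    (1 + c) (- N) N - twopii * (if (m < n)%N then dterm m.+1 (1 +i* t) else 0)) <=
  perr n c N * (m.+1)%:R `^ (- (1 + c)).
Proof.
move=> n0 c01 N1 tN; set w0 : C := 1 +i* t.
have [c0 c1] := andP c01.
have N0 : 0 < N by lra.
pose x1 := lnn n.+1 - lnn m.+1; pose x0 := lnn n - lnn m.+1.
have xl : x1 - x0 = lam n by rewrite /x1 /x0 /lam; ring.
have lC : (lam n)%:C != 0 by rewrite -cmod_eq0 cmodR normr_eq0 gt_eqF ?lam_gt0.
pose K : C := dterm m.+1 w0 / (lam n)%:C.
have pE w : dterm m.+1 w * (phi n (w - w0) / (w - w0) ^+ 2) =
    K * (pker x1 w0 w - pker x0 w0 w).
  rewrite (dterm_split _ w0) /K /phi /pker /x1 /x0 !rmorphB /=.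
  rewrite !(mulrBl (w - w0)) !cexpD rmorphN /= mulNr; ring.
have wn y : (1 + c) +i* y - w0 != 0.
  rewrite -cmod_gt0; apply: lt_le_trans c0 _; apply: le_trans (cmod_Re _).
  by rewrite ReB /= addrAC subrr add0r ler_norm.
have cp x : ccts (fun y => pker x w0 ((1 + c) +i* y)) (- N) N.
  by apply: cdiff_Vccts => y _; apply: cdiff_pker; rewrite -subr_eq0.
have cpB : ccts (fun y => pker x1 w0 ((1 + c) +i* y) - pker x0 w0 ((1 + c) +i* y)) (- N) N.
  apply: (@cdiff_Vccts _ (fun w => pker x1 w0 w - pker x0 w0 w)) => y _.
  by apply: cdiffB; apply: cdiff_pker; rewrite -subr_eq0.
split.
  by apply: (ccts_eq (u := fun y => K * (pker x1 w0 ((1 + c) +i* y) - pker x0 w0 ((1 + c) +i* y)))) => [y|];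
    [rewrite pE|exact: cctsZ].
rewrite (@Vint_eq _ (fun w => K * (pker x1 w0 w - pker x0 w0 w))); last by move=> y _; rewrite pE.
rewrite VintZ// VintB//.
set P1 := Vint (pker x1 w0) _ _ _; set P0 := Vint (pker x0 w0) _ _ _.
have mx : Num.max 0 x1 - Num.max 0 x0 = if (m < n)%N then lam n else 0.
  have lmono (i j : nat) : (0 < i)%N -> (i <= j)%N -> lnn i <= lnn j.
    by move=> i0 ij; rewrite /lnn ler_ln ?posrE ?ltr0n ?ler_nat// (leq_trans i0).
  case: ifPn => [mn|]; last rewrite -leqNgt => nm.
    have h0 : 0 <= x0 by rewrite subr_ge0; apply: lmono.
    have h1 : 0 <= x1 by rewrite subr_ge0; apply: lmono => //; exact: ltnW.
    by rewrite (max_idPr h0) (max_idPr h1).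
  have h0 : x0 <= 0 by rewrite subr_le0; apply: lmono => //; exact: leqW.
  have h1 : x1 <= 0 by rewrite subr_le0; apply: lmono.
  by rewrite (max_idPl h0) (max_idPl h1) subrr.
have -> : 'i * (K * (P1 - P0)) - twopii * (if (m < n)%N then dterm m.+1 w0 else 0) =
    K * (('i * P1 - twopii * (Num.max 0 x1)%:C) - ('i * P0 - twopii * (Num.max 0 x0)%:C)).
  have -> : (if (m < n)%N then dterm m.+1 w0 else 0) = K * (Num.max 0 x1 - Num.max 0 x0)%:C.
    by rewrite mx /K; case: ifP => _; rewrite ?mulr0// divfK.
  by rewrite rmorphB /=; ring.
rewrite cmodM.
have T1 := perron_term x1 c01 N1 tN; have T0 := perron_term x0 c01 N1 tN.
have e01 : expR (c * x0) <= expR (c * x1).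
  by rewrite ler_expR ler_pM2l// -subr_ge0 xl ltW// lam_gt0.
have T : cmod (('i * P1 - twopii * (Num.max 0 x1)%:C) - ('i * P0 - twopii * (Num.max 0 x0)%:C))
    <= 80 * expR (c * x1) / N.
  apply: le_trans (cmodB _ _) _.
  have : 40 * expR (c * x0) / N <= 40 * expR (c * x1) / N by rewrite ler_pM2r ?invr_gt0// ler_pM2l.
  by move: T1 T0; rewrite -/P1 -/P0; lra.
apply: le_trans (ler_wpM2l (cmod_ge0 _) T) _.
have cK : cmod K = (m.+1)%:R^-1 / lam n.
  rewrite cmodM cmodV cmodR gtr0_norm ?lam_gt0// cmod_dterm_pow /=.
  by rewrite powR_inv1.
have -> : expR (c * x1) = expR (c * lnn n.+1) * (m.+1)%:R `^ (- c).
  rewrite /powR pnatr_eq0 /= -expRD; congr expR; rewrite /x1 /lnn; ring.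
rewrite cK opprD powRD; last by apply/implyP => _; rewrite pnatr_eq0.
rewrite powR_inv1// le_eqVlt; apply/orP; left; apply/eqP; rewrite /perr.
by field; rewrite !gt_eqF ?lam_gt0.
Qed.

Lemma pow_small c (e : R) : 0 < c -> 0 < e -> exists n0, forall n, (n0 <= n)%N ->
  n%:R `^ (- c) <= e.
Proof.
move=> c0 e0; pose x := e^-1 `^ c^-1.
have x0 : 0 < x by apply: powR_gt0; rewrite invr_gt0.
exists (Num.truncn x).+1 => n xn.
have xn' : x <= n%:R.
  apply: (@le_trans _ _ (Num.truncn x).+1%:R); last by rewrite ler_nat.
  by apply/ltW; apply: truncnS_gt.
have n0 : 0 < n%:R :> R by exact: lt_le_trans xn'.
rewrite powRN -[leRHS]invrK lef_pV2 ?posrE ?powR_gt0 ?invr_gt0//.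
have -> : e^-1 = x `^ c by rewrite /x -powRrM mulVf ?gt_eqF// powRr1// invr_ge0 ltW.
by apply: ge0_ler_powR; rewrite ?nnegrE ?(ltW c0) ?(ltW x0) ?(ltW n0).
Qed.

(** Series and integral are not interchanged: [zeta] is replaced by [L] terms of its series, the
    tail being uniformly small on the line and the kernel bounded there by [KB]. The error bound
    does not depend on [L]. *)
Lemma perron_zeta (zeta : C -> C) n c t N : is_riemann_zeta zeta -> (0 < n)%N -> 0 < c <= 1 ->
  1 <= N -> 2 * `|t| <= N ->
  cmod ('i * Vint (fun w => zeta w * (phi n (w - (1 +i* t)) / (w - (1 +i* t)) ^+ 2))
    (1 + c) (- N) N - twopii * \sum_(k < n) dterm k.+1 (1 +i* t)) <=
  perr n c N * (1 + c^-1).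
Proof.
move=> hz n0 c01 N1 tN; set w0 : C := 1 +i* t; have [c0 c1] := andP c01.
have N0 : 0 < N by lra.
have NN : - N <= N by lra.
pose K w := phi n (w - w0) / (w - w0) ^+ 2.
have perr0 : 0 <= perr n c N.
  by rewrite /perr divr_ge0 ?mulr_ge0 ?expR_ge0 ?(ltW N0) ?(ltW (lam_gt0 n0)).
have lb y : c <= cmod ((1 + c) +i* y - w0).
  by apply: le_trans (cmod_Re _); rewrite ReB /= addrAC subrr add0r ler_norm.
have dK y : cdiff K ((1 + c) +i* y).
  have wn : (1 + c) +i* y != w0 by rewrite -subr_eq0 -cmod_gt0; exact: lt_le_trans (lb y).
  apply: (@cdiff_pole _ (fun w => phi n (w - w0))) => //.
  by apply: cdiff_comp (cdiff_phi n _); apply: cdiffB; [exact: cdiff_id|exact: cdiff_const].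
have dz y : cdiff zeta ((1 + c) +i* y).
  apply: (cdiff_zeta hz); rewrite eq_complex /= negb_and (_ : 1 + c == 1 = false)//.
  by rewrite -subr_eq0 addrAC subrr add0r gt_eqF.
pose KB : R := 2 * expR (c * lnn n.+1) / c.
have KB0 : 0 <= KB by rewrite /KB !mulr_ge0 ?invr_ge0 ?expR_ge0 ?(ltW c0).
have Kb y : cmod (K ((1 + c) +i* y)) <= KB.
  rewrite /K cmodM cmodV cmodX.
  have wp : 0 < cmod ((1 + c) +i* y - w0) by exact: lt_le_trans (lb y).
  have rE : Re ((1 + c) +i* y - w0) = c by rewrite ReB /= addrAC subrr add0r.
  have P := @phi_bound n ((1 + c) +i* y - w0) (expR (c * lnn n.+1)) n0.
  rewrite rE in P.
  have l01 : lnn n <= lnn n.+1 by rewrite /lnn ler_ln ?posrE ?ltr0n// ler_nat.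
  have {}P : cmod (phi n ((1 + c) +i* y - w0)) <=
      2 * cmod ((1 + c) +i* y - w0) * expR (c * lnn n.+1).
    by apply: P => //; rewrite ler_expR ler_wpM2l// ltW.
  rewrite ler_pdivrMr ?exprn_gt0//; apply: le_trans P _.
  rewrite /KB expr2 (_ : _ / c * _ = 2 * cmod ((1 + c) +i* y - w0) * expR (c * lnn n.+1) *
    (cmod ((1 + c) +i* y - w0) / c)); last by ring.
  by rewrite ler_peMr ?mulr_ge0 ?expR_ge0 ?cmod_ge0// ler_pdivlMr// mul1r.
apply/ler_addgt0Pr => e e0.
have NK0 : 0 < 4 * N * (KB + 1) by rewrite !mulr_gt0// ltr_wpDl.
have e'0 : 0 < c * (e / (4 * N * (KB + 1))) by rewrite mulr_gt0// divr_gt0.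
have [L0 HL] := pow_small c0 e'0.
pose L := maxn L0 n.
have L1 : (0 < L)%N by rewrite (leq_trans n0)// leq_maxr.
have Lc : L%:R `^ (- c) / c <= e / (4 * N * (KB + 1)).
  by rewrite ler_pdivrMr// mulrC; apply: HL; exact: leq_maxl.
pose S w := \sum_(k < L) dterm k.+1 w.
pose F k w := dterm k.+1 w * K w.
have P k := @perron_dterm n k c t N n0 c01 N1 tN.
have [cS VS] := Vint_sum L (fun k => (P k).1 : ccts (fun y => F k ((1 + c) +i* y)) (- N) N).
have dS y : cdiff S ((1 + c) +i* y).
  rewrite /S; elim: (L) => [|l IH].
    by apply: (@cdiff_ext _ (fun=> 0)) (cdiff_const _ _) => w; rewrite big_ord0.
  apply: (@cdiff_ext _ (fun w => \sum_(k < l) dterm k.+1 w + dterm l.+1 w)).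
    by move=> w; rewrite big_ord_recr.
  by apply: cdiffD => //; exact: cdiff_dterm.
have cD : ccts (fun y => (zeta ((1 + c) +i* y) - S ((1 + c) +i* y)) * K ((1 + c) +i* y)) (- N) N.
  by apply: (@cdiff_Vccts _ (fun w => (zeta w - S w) * K w)) => y _; apply: cdiffM => //; exact: cdiffB.
rewrite (@Vint_eq (fun w => zeta w * K w) (fun w => (zeta w - S w) * K w + \sum_(k < L) F k w)); last first.
  move=> y _; have -> : \sum_(k < L) F k ((1 + c) +i* y) = S ((1 + c) +i* y) * K ((1 + c) +i* y).
    by rewrite /S /F mulr_suml.
  by rewrite -mulrDl subrK.
rewrite VintD// VS.
have -> : \sum_(k < n) dterm k.+1 w0 = \sum_(k < L) (if (k < n)%N then dterm k.+1 w0 else 0).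
  by rewrite (big_ord_widen L (fun k => dterm k.+1 w0)) ?leq_maxr// big_mkcond.
rewrite (_ : _ - _ = 'i * Vint (fun w => (zeta w - S w) * K w) (1 + c) (- N) N +
  \sum_(k < L) ('i * Vint (F k) (1 + c) (- N) N -
     twopii * (if (k < n)%N then dterm k.+1 w0 else 0))); last first.
  by rewrite sumrB mulrDr !mulr_sumr; ring.
rewrite addrC; apply: le_trans (cmodD _ _) _; apply: lerD.
  apply: le_trans (cmod_sum _ _ _) _.
  apply: (@le_trans _ _ (\sum_(k < L) perr n c N * (k.+1)%:R `^ (- (1 + c)))).
    by apply: ler_sum => k _; exact: (P k).2.
  by rewrite -mulr_sumr ler_wpM2l// pow_sum.
rewrite cmodM cmodi mul1r.
apply: le_trans (_ : _ <= 2 * (e / (4 * N * (KB + 1)) * KB) * (N - - N)) _.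
  apply: Vint_bound => // y _; rewrite cmodM; apply: ler_pM; rewrite ?cmod_ge0//.
  by apply: le_trans Lc; apply: zeta_tail.
rewrite opprK (_ : _ * (N + N) = e * (KB / (KB + 1))); last first.
  by field; rewrite !gt_eqF// ltr_wpDl.
by rewrite ler_piMr ?(ltW e0)// ler_pdivrMr ?ltr_wpDl// mul1r lerDl.
Qed.

(* The kernel of [\sum_(n1 < m <= n2)]: the double pole at 0 cancels. *)
Definition dker n1 n2 : C -> C := cquo (cquo (fun s => phi n2 s - phi n1 s) 0) 0.

(** Every [phi n] vanishes at 0 with derivative 1, so the difference has a zero of order at least
    two there. *)
Lemma dker_spec n1 n2 : (0 < n1)%N -> (0 < n2)%N ->
  (forall s, cdiff (dker n1 n2) s) /\
  (forall s, s != 0 -> dker n1 n2 s = phi n2 s / s ^+ 2 - phi n1 s / s ^+ 2).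
Proof.
move=> n10 n20; pose D s := phi n2 s - phi n1 s.
have dD s : cdiff D s by apply: cdiffB; exact: cdiff_phi.
have D0 : D 0 = 0 by rewrite /D /phi !mulr0 cexp0 !subrr !mul0r subrr.
have dphi0 n : (0 < n)%N -> cder (phi n) 0 1.
  move=> n0; have d x : cder (fun s => cexp (x%:C * s)) 0 x%:C.
    have := cder_comp (cderZ x%:C (cder_id 0)) (cder_cexp (x%:C * 0)).
    by rewrite mulr0 cexp0 mul1r mulr1.
  have lC : (lam n)%:C != 0 by rewrite -cmod_eq0 cmodR normr_eq0 gt_eqF ?lam_gt0.
  apply: cder_eq (cderM (cderB (d (lnn n.+1)) (d (lnn n))) (cder_const ((lam n)%:C^-1) 0)) _.
  by rewrite mulr0 addr0 -rmorphB /= divff.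
have dD1 s : cdiff (cquo D 0) s.
  by apply: (@cdiff_cquo _ D 0 1) => // w _; exact: dD.
have D10 : cquo D 0 0 = 0.
  rewrite /cquo eqxx; apply: cder_unique (cdvP (dD 0)) _.
  by apply: cder_eq (cderB (dphi0 _ n20) (dphi0 _ n10)) _; rewrite subrr.
split=> s.
  by apply: (@cdiff_cquo _ (cquo D 0) 0 1) => // w _; exact: dD1.
move=> s0; rewrite /dker !cquoE// subr0 -mulrBl expr2 invfM mulrA.
by [].
Qed.

Lemma perron_diff (zeta : C -> C) n1 n2 c t N : is_riemann_zeta zeta ->
  (0 < n1)%N -> (0 < n2)%N -> 0 < c <= 1 -> 1 <= N -> 2 * `|t| <= N ->
  cmod ('i * Vint (fun w => zeta w * dker n1 n2 (w - (1 +i* t))) (1 + c) (- N) N -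
    twopii * (\sum_(k < n2) dterm k.+1 (1 +i* t) - \sum_(k < n1) dterm k.+1 (1 +i* t))) <=
  (perr n1 c N + perr n2 c N) * (1 + c^-1).
Proof.
move=> hz n10 n20 c01 N1 tN; set w0 : C := 1 +i* t; have [c0 c1] := andP c01.
have [_ dE] := dker_spec n10 n20.
have wn y : (1 + c) +i* y - w0 != 0.
  rewrite -cmod_gt0; apply: lt_le_trans c0 _; apply: le_trans (cmod_Re _).
  by rewrite ReB /= addrAC subrr add0r ler_norm.
have cK n : ccts (fun y => zeta ((1 + c) +i* y) *
    (phi n ((1 + c) +i* y - w0) / ((1 + c) +i* y - w0) ^+ 2)) (- N) N.
  apply: (@cdiff_Vccts _ (fun w => zeta w * (phi n (w - w0) / (w - w0) ^+ 2))) => y _.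
  apply: cdiffM.
    apply: (cdiff_zeta hz); rewrite eq_complex /= negb_and (_ : 1 + c == 1 = false)//.
    by rewrite -subr_eq0 addrAC subrr add0r gt_eqF.
  apply: (@cdiff_pole _ (fun w => phi n (w - w0))); first by rewrite -subr_eq0.
  by apply: cdiff_comp (cdiff_phi n _); apply: cdiffB; [exact: cdiff_id|exact: cdiff_const].
rewrite (@Vint_eq _ (fun w => zeta w * (phi n2 (w - w0) / (w - w0) ^+ 2) -
  zeta w * (phi n1 (w - w0) / (w - w0) ^+ 2))); last first.
  by move=> y _; rewrite dE// mulrBr.
rewrite VintB//.
have := perron_zeta hz n10 c01 N1 tN; have := perron_zeta hz n20 c01 N1 tN.
rewrite -/w0; set V2 := Vint _ _ _ _; set V1 := Vint _ _ _ _.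
set S2 := \sum_(k < n2) _; set S1 := \sum_(k < n1) _ => H2 H1.
rewrite (_ : _ - _ = ('i * V2 - twopii * S2) - ('i * V1 - twopii * S1)); last by ring.
apply: le_trans (cmodB _ _) _; rewrite addrC mulrDl.
exact: lerD.
Qed.

End Perron.


(** * Shifting the contour to a staircase *)

Section Staircase.
Variable R : realType.
Local Notation C := R[i].
Local Notation Re := complex.Re.
Local Notation Im := complex.Im.
Implicit Types (f g : C -> C) (u v b c x y t N : R) (z w h : C) (m n k : nat).

Lemma Hint_diff f y x x' b K : x <= x' -> x' <= b -> x' - x <= 1 -> 0 <= K ->
  ccts (fun u => f (u +i* y)) x b ->
  (forall u, x <= u <= x' -> cmod (f (u +i* y)) <= K) ->
  cmod (Hint f y x b - Hint f y x' b) <= 2 * K.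
Proof.
move=> xx' x'b x1 K0 cf fK.
have -> : Hint f y x b = Hint f y x x' + Hint f y x' b by rewrite !HintE (cint_cat xx' x'b cf).
rewrite addrK; apply: le_trans (Hint_bound xx' _ fK) _; first exact: ccts_sub (lexx _) x'b cf.
by rewrite ler_piMr// mulr_ge0.
Qed.

(** Goursat moves the contour strip by strip. On the line between two strips the horizontal sides
    cancel except between [x j] and [x j.+1], where [f] is estimated from the strip reaching further
    left and charged to the other, [e] being monotone and neighbouring [A j] comparable. The
    constant is [10 = 2 + 4 + 4]: a vertical side and a jump at each end. *)
Lemma staircase f (x A y : nat -> R) (e : R -> R) b B n : (0 < n)%N ->
  (forall j, y j.+1 = y j + 1) ->
  (forall j, x j <= b) -> (forall j, b - x j <= 1) ->
  (forall j, [/\ 0 <= A j, A j <= 2 * A j.+1 & A j.+1 <= 2 * A j]) ->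
  (forall u, 0 <= e u) -> (forall u v, u <= v -> e u <= e v) ->
  (forall j w, (j < n)%N -> y j <= Im w <= y j.+1 -> x j <= Re w <= b -> cdiff f w) ->
  (forall j w, (j < n)%N -> y j <= Im w <= y j.+1 -> x j <= Re w ->
    [|| Re w <= x j.-1, Re w <= x j | Re w <= x j.+1] -> cmod (f w) <= A j * e (Re w)) ->
  (forall v, x 0 <= v <= b -> cmod (f (v +i* y 0)) <= B) ->
  (forall v, x n.-1 <= v <= b -> cmod (f (v +i* y n)) <= B) ->
  cmod (Vint f b (y 0) (y n)) <= 10 * \sum_(j < n) A j * e (x j) + 4 * B.
Proof.
move=> n0 yS xb bx HA e0 eM df fA fB0 fBn.
have y01 j : y 0 <= y j by elim: j => // j IH; rewrite yS ler_wpDr.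
have yy j : y j <= y j.+1 by rewrite yS lerDl.
have A0 j : 0 <= A j by case: (HA j).
have cV k : (k <= n)%N -> ccts (fun v => f (b +i* v)) (y 0) (y k).
  move=> kn; apply: cdiff_Vccts => v; elim: k kn => [_|k IH kn vk].
    move=> v0; apply: (df 0%N) => //=; last by rewrite xb lexx.
    by case/andP: v0 => -> h; rewrite (le_trans h)//.
  have [vk'|vk'] := leP v (y k); first by apply: IH; [exact: ltnW|case/andP: vk => ->].
  by apply: (df k) => //=; [rewrite (ltW vk'); case/andP: vk|rewrite xb lexx].
have cH j y' : (j < n)%N -> (y' == y j) || (y' == y j.+1) -> ccts (fun u => f (u +i* y')) (x j) b.
  move=> jn yy'; apply: cdiff_Hccts => u xu; apply: (df j) => //=.
  by case/orP: yy' => /eqP ->; rewrite lexx ?andbT// yy.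
have step j : (j < n)%N -> 'i * Vint f b (y j) (y j.+1) =
    'i * Vint f (x j) (y j) (y j.+1) - Hint f (y j) (x j) b + Hint f (y j.+1) (x j) b.
  move=> jn; have := @goursat _ f (x j) b (y j) (y j.+1) (xb j) (yy j).
  rewrite rectE => G.
  have {}G : Hint f (y j) (x j) b + 'i * Vint f b (y j) (y j.+1) -
      Hint f (y j.+1) (x j) b - 'i * Vint f (x j) (y j) (y j.+1) = 0.
    by apply: G => w /andP[h1 h2]; exact: (df j).
  by rewrite -[LHS]subr0 -G; ring.
have Vb j : (j < n)%N -> cmod ('i * Vint f (x j) (y j) (y j.+1)) <= 2 * (A j * e (x j)).
  move=> jn; rewrite cmodM cmodi mul1r.
  apply: le_trans (_ : _ <= 2 * (A j * e (x j)) * (y j.+1 - y j)) _.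
    apply: Vint_bound => //.
      by apply: cdiff_Vccts => v vj; apply: (df j) => //=; rewrite lexx xb.
    by move=> v vj; apply: (fA j) => //=; rewrite lexx orbT.
  by rewrite yS addrAC subrr add0r mulr1.
have Hb j : (j.+1 < n)%N -> cmod (Hint f (y j.+1) (x j) b - Hint f (y j.+1) (x j.+1) b) <=
    4 * (A j * e (x j)) + 4 * (A j.+1 * e (x j.+1)).
  move=> jn; have [_ A1 A2] := HA j.
  have e1 := e0 (x j); have e2 := e0 (x j.+1).
  have p1 : 0 <= A j * e (x j) by exact: mulr_ge0.
  have p2 : 0 <= A j.+1 * e (x j.+1) by exact: mulr_ge0.
  have bj := bx j; have bj' := bx j.+1; have xbj := xb j; have xbj' := xb j.+1.
  have [xx|/ltW xx] := leP (x j) (x j.+1).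
    apply: (@le_trans _ _ (2 * (2 * A j.+1 * e (x j.+1)))); last first.
      by move: p1 p2; rewrite -mulrA; lra.
    apply: Hint_diff => //; first by move: bj xbj'; lra.
    - by rewrite !mulr_ge0.
    - by apply: cH; [exact: ltnW|rewrite eqxx orbT].
    - move=> u /andP[u1 u2]; apply: (@le_trans _ _ (A j * e u)).
        by apply: (fA j) => //=; [exact: ltnW|rewrite lexx yy|rewrite u2 !orbT].
      by apply: ler_pM => //; exact: eM.
  rewrite cmod_distC.
  apply: (@le_trans _ _ (2 * (2 * A j * e (x j)))); last first.
    by move: p1 p2; rewrite -mulrA; lra.
  apply: Hint_diff => //; first by move: bj' xbj; lra.
  - by rewrite !mulr_ge0.
  - by apply: cH => //; rewrite eqxx.
  - move=> u /andP[u1 u2]; apply: (@le_trans _ _ (A j.+1 * e u)).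
      by apply: (fA j.+1) => //=; [rewrite lexx yy|rewrite u2].
    by apply: ler_pM => //; exact: eM.
have Bb (j k : nat) : (j < n)%N -> (k == j) || (k == j.+1) ->
    (forall v, x j <= v <= b -> cmod (f (v +i* y k)) <= B) -> cmod (Hint f (y k) (x j) b) <= 2 * B.
  move=> jn kj fB; have B0 : 0 <= B.
    by apply: le_trans (fB b _); rewrite ?cmod_ge0// xb lexx.
  apply: le_trans (Hint_bound (xb j) _ fB) _.
    by apply: cH => //; case/orP: kj => /eqP ->; rewrite eqxx ?orbT.
  by rewrite ler_piMr// mulr_ge0.
(* The last strip reached has paid for its vertical side and one jump, [6 = 2 + 4]; the jump to the
   next strip completes its 10. *)
have ind k : (k < n)%N -> cmod ('i * Vint f b (y 0) (y k.+1) - Hint f (y k.+1) (x k) b) <=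
    10 * \sum_(j < k) A j * e (x j) + 6 * (A k * e (x k)) + 2 * B.
  elim: k => [_|k IH kn].
    rewrite step// addrK big_ord0 mulr0 add0r; apply: le_trans (cmodB _ _) _.
    have := Vb 0%N n0; have := Bb 0%N 0%N n0 isT fB0.
    have : 0 <= A 0%N * e (x 0%N) by rewrite mulr_ge0.
    by move: (A 0%N * e (x 0%N)) (cmod _) (cmod _) => p q r; clear; lra.
  rewrite big_ord_recr /=.
  have -> : 'i * Vint f b (y 0) (y k.+2) = 'i * Vint f b (y 0) (y k.+1) + 'i * Vint f b (y k.+1) (y k.+2).
    by rewrite !VintE (cint_cat (y01 k.+1) (yy k.+1) (cV _ kn)) mulrDr.
  rewrite (step _ kn).
  rewrite (_ : _ - _ = ('i * Vint f b (y 0) (y k.+1) - Hint f (y k.+1) (x k) b) +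
    ('i * Vint f (x k.+1) (y k.+1) (y k.+2) +
     (Hint f (y k.+1) (x k) b - Hint f (y k.+1) (x k.+1) b))); last by ring.
  apply: le_trans (cmodD _ _) _; have := IH (ltnW kn).
  have := cmodD ('i * Vint f (x k.+1) (y k.+1) (y k.+2))
    (Hint f (y k.+1) (x k) b - Hint f (y k.+1) (x k.+1) b).
  have := Vb _ kn; have := Hb _ kn.
  set S := \sum_(j < k) _; set V := cmod (_ * Vint f (x _) _ _); lra.
have -> : cmod (Vint f b (y 0) (y n)) = cmod ('i * Vint f b (y 0) (y n)) by rewrite cmodM cmodi mul1r.
case: n n0 ind Bb fBn {cV cH step Vb Hb df fA} => // n _ ind Bb fBn.
rewrite big_ord_recr /= -[_ * Vint _ _ _ _](subrK (Hint f (y n.+1) (x n) b)).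
apply: le_trans (cmodD _ _) _.
have := ind n (ltnSn n); have := Bb n n.+1 (ltnSn n); rewrite eqxx orbT => /(_ isT fBn).
have : 0 <= A n * e (x n) by rewrite mulr_ge0.
by set S := \sum_(j < n) _; lra.
Qed.

End Staircase.

(** * The Dirichlet sum bounded by a sum over strips *)

Section SumBound.
Variable R : realType.
Local Notation C := R[i].
Local Notation Re := complex.Re.
Local Notation Im := complex.Im.
Local Notation twopii := (twopii R).
Implicit Types (f g : C -> C) (u v b c t M T : R) (z w h s : C) (k : nat).

Lemma expR_lnn_le u M k : `|u| <= 1 -> 1 <= M -> M / 2 <= k%:R <= 3 * M ->
  expR (u * lnn R k) <= 3 * M `^ u.
Proof.
move=> u1 M1 /andP[k1 k2].
have M0 : 0 < M by lra.
have k0 : 0 < k%:R :> R by lra.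
rewrite /powR gt_eqF// -{1}(@lnK _ 3) ?posrE// -expRD ler_expR /lnn.
have e1 : ln k%:R <= ln 3 + ln M :> R by rewrite -lnM ?posrE// ler_ln ?posrE// mulr_gt0.
have e2 : ln M <= ln 3 + ln k%:R :> R.
  by rewrite -lnM ?posrE// ler_ln ?posrE ?mulr_gt0//; lra.
have : `|u * (ln k%:R - ln M)| <= ln 3.
  rewrite normrM; apply: (@le_trans _ _ (1 * `|ln k%:R - ln M|)); first exact: ler_wpM2r.
  by rewrite mul1r ler_norml; apply/andP; split; lra.
by rewrite ler_norml mulrBr => /andP[_]; lra.
Qed.

(** In [phi] the division by [lam] is compensated by the mean value inequality at the cost of a
    factor [|s|]: the decay drops to [1 / |s|], but no power of [M] is lost. *)
Lemma dker_bound n1 n2 M s : 1 <= M -> (0 < n1)%N -> M / 2 <= n1%:R -> n1%:R <= n2%:R :> R ->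
  n2%:R <= 2 * M -> `|Re s| <= 1 -> s != 0 ->
  cmod (dker n1 n2 s) <= 12 * M `^ Re s / cmod s.
Proof.
move=> M1 n10 Mn1 n12 n2M s1 s0.
have n20 : (0 < n2)%N by rewrite -(ltr0n R) (lt_le_trans _ n12)// ltr0n.
have [_ ->//] := dker_spec R n10 n20.
have sp : 0 < cmod s by rewrite cmod_gt0.
have P k : (0 < k)%N -> M / 2 <= k%:R -> k%:R <= 2 * M ->
    cmod (phi k s / s ^+ 2) <= 6 * M `^ Re s / cmod s.
  move=> k0 Mk kM; rewrite cmodM cmodV cmodX ler_pdivrMr ?exprn_gt0//.
  rewrite (_ : _ / _ * _ = 2 * cmod s * (3 * M `^ Re s)); last by field; rewrite gt_eqF.
  apply: phi_bound => //; apply: expR_lnn_le => //; first by apply/andP; split; lra.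
  by rewrite -(natr1 k); apply/andP; split; lra.
apply: le_trans (cmodB _ _) _.
rewrite (_ : 12 * _ / _ = 6 * M `^ Re s / cmod s + 6 * M `^ Re s / cmod s); last by field; rewrite gt_eqF.
by apply: lerD; apply: P => //; lra.
Qed.

Lemma perr_bound k c M (N : R) : 0 < c <= 1 -> 1 <= M -> (0 < k)%N -> M / 2 <= k%:R -> k%:R <= 2 * M ->
  0 < N -> perr k c N <= 720 * M `^ (1 + c) / N.
Proof.
move=> /andP[c0 c1] M1 k0 Mk kM N0.
have M0 : 0 < M by lra.
rewrite /perr invfM.
have E : expR (c * lnn R k.+1) <= 3 * M `^ c.
  apply: expR_lnn_le => //; first by rewrite gtr0_norm.
  by rewrite -(natr1 k); apply/andP; split; lra.
have L : (lam R k)^-1 <= 3 * M.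
  by apply: le_trans (lamV_le R k0) _; rewrite -(natr1 k); lra.
rewrite powRD; last by apply/implyP => _; rewrite gt_eqF.
rewrite powRr1 ?(ltW M0)//.
rewrite (_ : 720 * (M * M `^ c) / N = 80 * (3 * M `^ c) * (N^-1 * (3 * M))); last by ring.
apply: ler_pM; rewrite ?mulr_ge0 ?expR_ge0 ?invr_ge0 ?(ltW N0) ?(ltW (lam_gt0 _ k0))//.
  by rewrite ler_pM2l.
by rewrite ler_pM2l ?invr_gt0.
Qed.

(** For the strips next to that of [t] the horizontal distance counts, since
    [Re w <= x0 <= 1 - 2 * kap]. For the others the vertical distance [|j - i| - 1] suffices, as
    [|j - i| >= 2] and [kap <= 1 / 4]. *)
Lemma dist_lb (kap x0 t N : R) (i j : nat) w : 0 < kap <= 4^-1 -> x0 <= 1 - 2 * kap ->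
  i%:R - N <= t <= (i.+1)%:R - N -> j%:R - N <= Im w <= (j.+1)%:R - N ->
  ((j <= i + 1)%N -> (i <= j + 1)%N -> Re w <= x0) ->
  kap * (1 + `|j%:R - i%:R|) <= cmod (w - (1 +i* t)).
Proof.
move=> /andP[k0 k1] x0k ti wj wx.
have [/andP[ji1 ji2]|] := boolP ((j <= i + 1)%N && (i <= j + 1)%N).
  have {}wx := wx ji1 ji2; apply: le_trans (cmod_Re _); rewrite ReB /=.
  have d2 : `|j%:R - i%:R : R| <= 1.
    move: ji1 ji2; rewrite -(ler_nat R) natrD -(ler_nat R) natrD ler_norml; clear => a1 a2.
    by apply/andP; split; lra.
  apply: (@le_trans _ _ (2 * kap)).
    by rewrite mulrC ler_pM2r// -[2]/(1 + 1) lerD2l.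
  by rewrite -normrN; apply: le_trans (ler_norm _); clear d2; lra.
rewrite negb_and -!ltnNge => ji; apply: le_trans (cmod_Im _); rewrite ImB /=.
have {}wj : j%:R - i%:R - 1 <= Im w - t <= j%:R - i%:R + 1.
  move: ti wj; rewrite -(natr1 i) -(natr1 j); clear.
  by move=> /andP[? ?] /andP[? ?]; apply/andP; split; lra.
have [j1|j1] := leP (i%:R : R) j%:R.
  have ji' : 2 <= j%:R - i%:R :> R.
    have : (i + 2 <= j)%N by move: j1 ji; rewrite ler_nat; clear; lia.
    by rewrite -(ler_nat R) natrD; clear; lra.
  rewrite ger0_norm; last by rewrite subr_ge0.
  apply: le_trans (ler_norm _); case/andP: wj => wj _.
  by move: ji' wj k0 k1; clear; move: (j%:R - i%:R) (Im w - t) => p q *; nra.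
have ji' : 2 <= i%:R - j%:R :> R.
  have : (j + 2 <= i)%N by move: j1 ji; rewrite ltr_nat; clear; lia.
  by rewrite -(ler_nat R) natrD; clear; lra.
rewrite ltr0_norm ?subr_lt0// opprB.
rewrite -normrN; apply: le_trans (ler_norm _); case/andP: wj => _ wj.
have {}wj : Im w - t <= - (i%:R - j%:R) + 1 by rewrite opprB.
by move: ji' wj k0 k1; clear; move: (i%:R - j%:R) (Im w - t) => p q *; nra.
Qed.

Variable zeta : C -> C.
Hypothesis hzeta : is_riemann_zeta zeta.

(** Perron on [Re s = 1 + dl], then [staircase]. Around the height [t] all strips must be at one
    level [x0] to the left of 1: the bound of the kernel blows up at [1 + it], and this keeps the
    contour at distance [kap]. *)
Lemma dirichlet_bound (dl Zb kap x0 T M t : R) (x : nat -> R) (N i n1 n2 : nat) :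
  let y j := j%:R - N%:R : R in
  0 < dl <= 4^-1 -> 0 < kap <= 4^-1 -> x0 <= 1 - 2 * kap -> 0 <= Zb ->
  4 <= T -> 2 * T <= N%:R -> `|t| <= T ->
  1 <= M -> (0 < n1)%N -> M / 2 <= n1%:R -> n1%:R <= n2%:R :> R -> n2%:R <= 2 * M ->
  (forall j, 4^-1 <= x j <= 1 + dl) ->
  (forall j w, (j < N + N)%N -> y j <= Im w <= y j.+1 -> x j <= Re w ->
     w != 1 /\ cmod (zeta w) <= Zb) ->
  y i <= t <= y i.+1 ->
  (forall j, (j <= i + 3)%N -> (i <= j + 3)%N -> x j = x0) ->
  cmod (\sum_(k < n2) dterm k.+1 (1 +i* t) - \sum_(k < n1) dterm k.+1 (1 +i* t)) <=
  30 * Zb / kap * \sum_(j < N + N) M `^ (x j - 1) / (1 + `|j%:R - i%:R|) +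
  (12 * Zb + 180 * (1 + dl^-1)) * (M `^ (1 + dl) / T).
Proof.
move=> y /andP[dl0 dl1] /andP[k0 k1] x0k Zb0 T4 TN tT M1 n10 Mn1 n12 n2M hx hz /andP[ti1 ti2] near.
set w0 : C := 1 +i* t.
have M0 : 0 < M by lra.
have n20 : (0 < n2)%N by rewrite -(ltr0n R) (lt_le_trans _ n12)// ltr0n.
pose f w := zeta w * dker n1 n2 (w - w0).
pose A j : R := 12 * Zb / kap / (1 + `|j%:R - i%:R|).
pose e u := M `^ (u - 1).
pose B := 12 * Zb * M `^ dl / T.
have yS j : y j.+1 = y j + 1 by rewrite /y -(natr1 j); ring.
have d0 (j : nat) : 0 < 1 + `|j%:R - i%:R : R| by rewrite ltr_wpDr.
have fb w (D : R) : 4^-1 <= Re w <= 1 + dl -> 0 < D -> D <= cmod (w - w0) -> cmod (zeta w) <= Zb ->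
    cmod (f w) <= 12 * Zb * e (Re w) / D.
  move=> /andP[r1 r2] D0 Dw zw; rewrite /f cmodM.
  have wp : 0 < cmod (w - w0) by exact: lt_le_trans Dw.
  have := @dker_bound n1 n2 M (w - w0) M1 n10 Mn1 n12 n2M; rewrite ReB /= => K.
  have {}K : cmod (dker n1 n2 (w - w0)) <= 12 * e (Re w) / cmod (w - w0).
    by apply: K; [move: r1 r2 dl1; clear; rewrite ler_norml => *; apply/andP; split; lra|rewrite -cmod_gt0].
  rewrite (_ : 12 * Zb * _ / D = Zb * (12 * e (Re w) / D)); last by ring.
  apply: ler_pM; rewrite ?cmod_ge0//; apply: le_trans K _.
  by rewrite ler_wpM2l ?mulr_ge0 ?powR_ge0// lef_pV2 ?posrE.
have imw w : `|Im w - t| <= cmod (w - w0) by apply: le_trans (cmod_Im _); rewrite ImB.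
have N0 : 1 <= N%:R :> R by lra.
have NN0 : (0 < N + N)%N by rewrite addn_gt0 -(ltr0n R) (lt_le_trans ltr01).
have yN : y (N + N)%N = N%:R by rewrite /y natrD addrK.
have y0 : y 0%N = - N%:R by rewrite /y sub0r.
have ends j k v : (j < N + N)%N -> (k == j) || (k == j.+1) -> T <= `|y k - t| ->
    x j <= v <= 1 + dl -> cmod (f (v +i* y k)) <= B.
  move=> jN kj Tk /andP[v1 v2].
  have [|_ zw] := hz j (v +i* y k) jN _ v1.
    by rewrite /=; case/orP: kj => /eqP ->; rewrite lexx ?andbT// yS lerDl ler01.
  have T0 : 0 < T by apply: lt_le_trans T4.
  apply: (@le_trans _ _ (12 * Zb * e v / T)).
    apply: fb => //=; first by rewrite v2 andbT (le_trans _ v1)//; case/andP: (hx j).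
    exact: (le_trans Tk (imw (v +i* y k))).
  rewrite /B ler_pM2r ?invr_gt0// ler_wpM2l ?mulr_ge0// ler_powR//.
  by rewrite lerBlDl.
have S := @staircase R f x A y e (1 + dl) B (N + N)%N NN0 yS.
have {}S : cmod (Vint f (1 + dl) (y 0%N) (y (N + N)%N)) <=
    10 * \sum_(j < N + N) A j * e (x j) + 4 * B.
  apply: S.
  - by move=> j; case/andP: (hx j).
  - by move=> j; case/andP: (hx j) => h1 h2; lra.
  - move=> j; rewrite /A; set a := 12 * Zb / kap.
    have a0 : 0 <= a by rewrite /a !mulr_ge0 ?invr_ge0 ?(ltW k0).
    split; first by rewrite divr_ge0// ltW.
      rewrite mulrCA ler_wpM2l// -[leLHS]mul1r ler_pdivrMr// mulrAC ler_pdivlMr// mul1r.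
      rewrite -(natr1 j); have := ler_normD (j%:R - i%:R : R) 1; rewrite normr1.
      by rewrite (_ : j%:R - i%:R + 1 = j%:R + 1 - i%:R); [have := normr_ge0 (j%:R - i%:R : R); lra|ring].
    rewrite mulrCA ler_wpM2l// -[leLHS]mul1r ler_pdivrMr// mulrAC ler_pdivlMr// mul1r.
    rewrite -(natr1 j); have := ler_normB (j%:R + 1 - i%:R : R) 1; rewrite normr1.
    rewrite (_ : j%:R + 1 - i%:R - 1 = j%:R - i%:R :> R); last by ring.
    by have := normr_ge0 (j%:R + 1 - i%:R : R); lra.
  - by move=> u; exact: powR_ge0.
  - by move=> u v uv; rewrite /e ler_powR// lerD2r.
  - move=> j w jN wy /andP[xw _]; have [w1 _] := hz j w jN wy xw.
    apply: cdiffM; first exact: cdiff_zeta.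
    apply: cdiff_comp; first by apply: cdiffB; [exact: cdiff_id|exact: cdiff_const].
    by have [] := dker_spec R n10 n20.
  - move=> j w jN wy xw xnear; have [_ zw] := hz j w jN wy xw.
    have [hj1 hj2] := andP (hx j).
    have wb : 4^-1 <= Re w <= 1 + dl.
      apply/andP; split; first exact: le_trans xw.
      case/or3P: xnear => /le_trans; apply.
      + by case/andP: (hx j.-1).
      + by [].
      + by case/andP: (hx j.+1).
    have D : kap * (1 + `|j%:R - i%:R|) <= cmod (w - w0).
      apply: (dist_lb (x0 := x0) (N := N%:R)) => //; [exact/andP|exact/andP|].
      move=> ji1 ji2; have e1 : x j.-1 = x0 by apply: near; move: ji1 ji2; clear; lia.
      have e2 : x j = x0 by apply: near; move: ji1 ji2; clear; lia.
      have e3 : x j.+1 = x0 by apply: near; move: ji1 ji2; clear; lia.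
      by case/or3P: xnear; rewrite ?e1 ?e2 ?e3.
    have D0 : 0 < kap * (1 + `|j%:R - i%:R|) by exact: mulr_gt0.
    apply: le_trans (fb w _ wb D0 D zw) _.
    by rewrite /A le_eqVlt; apply/orP; left; apply/eqP; field; rewrite !gt_eqF.
  - move=> v; apply: ends => //.
    rewrite y0 -normrN; apply: le_trans (ler_norm _).
    by move: tT TN T4; clear; rewrite ler_norml => /andP[] *; lra.
  - move=> v; apply: ends; [by rewrite prednK|by rewrite prednK// eqxx orbT|].
    rewrite yN; apply: le_trans (ler_norm _).
    by move: tT TN T4; clear; rewrite ler_norml => /andP[] *; lra.
rewrite y0 yN in S.
have dl01 : 0 < dl <= 1 by rewrite dl0 (le_trans dl1)// invf_le1// ler1n.
have P := @perron_diff R zeta n1 n2 dl t N%:R hzeta n10 n20 dl01 N0.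
have {}P := P (le_trans (ler_wpM2l (ler0n R 2) tT) TN).
rewrite -/w0 -/(f _) in P; set S0 := \sum_(k < n2) _ - \sum_(k < n1) _ in P *.
have N00 : 0 < N%:R :> R by exact: lt_le_trans N0.
have e1 := perr_bound dl01 M1 n10 Mn1 (le_trans n12 n2M) N00.
have e2 := perr_bound dl01 M1 n20 (le_trans Mn1 n12) n2M N00.
(* The factor [1 / 4] for [1 / (2 pi)] turns [10 * 12], [4 * 12] and 720 into 30, 12 and 180. *)
have -> : cmod S0 = cmod (twopii^-1) * cmod (twopii * S0).
  by rewrite -cmodM mulKf// twopii_neq0.
apply: le_trans (ler_wpM2r (cmod_ge0 _) (cmod_twopii_inv R)) _.
have {}P : cmod (twopii * S0) <= cmod (Vint f (1 + dl) (- N%:R) N%:R) +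
    (perr n1 dl N%:R + perr n2 dl N%:R) * (1 + dl^-1).
  rewrite -lerBlDl; apply: le_trans P; rewrite -/f.
  have := cmodB ('i * Vint f (1 + dl) (- N%:R) N%:R) ('i * Vint f (1 + dl) (- N%:R) N%:R - twopii * S0).
  by rewrite (_ : _ - (_ - _) = twopii * S0); [rewrite [cmod ('i * _)]cmodM cmodi mul1r; lra|ring].
have dli : 0 < dl^-1 by rewrite invr_gt0.
have T0 : 0 < T by exact: lt_le_trans T4.
have Q : (perr n1 dl N%:R + perr n2 dl N%:R) * (1 + dl^-1) <= 720 * (M `^ (1 + dl) / T) * (1 + dl^-1).
  rewrite ler_wpM2r ?addr_ge0 ?(ltW dli)//.
  have : M `^ (1 + dl) / N%:R <= M `^ (1 + dl) / (2 * T).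
    by rewrite ler_wpM2l ?powR_ge0// lef_pV2 ?posrE// mulr_gt0.
  by rewrite invfM mulrCA; move: e1 e2; rewrite -!mulrA; clear; lra.
have BM : B <= 12 * Zb * (M `^ (1 + dl) / T).
  rewrite /B -mulrA ler_wpM2l ?mulr_ge0// ler_pM2r ?invr_gt0//.
  by rewrite ler_powR// lerDr.
have SE : \sum_(j < N + N) A j * e (x j) =
    12 * Zb / kap * \sum_(j < N + N) M `^ (x j - 1) / (1 + `|j%:R - i%:R|).
  rewrite mulr_sumr; apply: eq_bigr => j _; rewrite /A /e; ring.
move: S P Q BM; rewrite SE.
set S1 := \sum_(j < N + N) _; move: (M `^ _ / T) => X.
rewrite (_ : 12 * Zb / kap * S1 = 12 * (Zb / kap * S1)); last by ring.
rewrite (_ : 30 * Zb / kap * S1 = 30 * (Zb / kap * S1)); last by ring.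
move: (Zb / kap * S1) (cmod _) (cmod _) (perr _ _ _ + _) => q1 q2 q3 q4.
rewrite (_ : 720 * X * (1 + dl^-1) = 720 * ((1 + dl^-1) * X)); last by ring.
rewrite (_ : 12 * Zb * X = 12 * (Zb * X)); last by ring.
rewrite (_ : (12 * Zb + 180 * (1 + dl^-1)) * X = 12 * (Zb * X) + 180 * ((1 + dl^-1) * X)); last by ring.
by move: ((1 + _) * X) (Zb * X) (_ * (1 + _)) => q5 q6 q7; clear; lra.
Qed.

End SumBound.


(** * Counting *)

Section Counting.
Variable R : realType.
Local Notation C := R[i].
Local Notation Re := complex.Re.
Local Notation Im := complex.Im.
Implicit Types (a c x T : R) (z w : C).

Lemma powR_large c x : 0 < c -> exists2 T0 : R, 1 <= T0 & forall T, T0 <= T -> x <= T `^ c.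
Proof.
move=> c0; exists (Num.max 1 (`|x| `^ c^-1)); first by rewrite le_max lexx.
move=> T; rewrite ge_max => /andP[T1 xT]; apply: le_trans (ler_norm _) _.
rewrite -[leLHS]powRr1// -(mulVf (lt0r_neq0 c0)) powRrM.
by apply: ge0_ler_powR; rewrite ?nnegrE ?powR_ge0 ?(ltW c0)// (le_trans _ T1).
Qed.

(** With truncated subtraction, [(j - i) + (i - j)] is [|j - i|]; the indices below [i] and those
    from [i] on are each dominated by the full sum of [g]. *)
Lemma sum_dist_le (g : nat -> R) n i : (forall k, 0 <= g k) -> (forall k, g k.+1 <= g k) ->
  (i < n)%N -> \sum_(j < n) g ((j - i) + (i - j))%N <= 2 * \sum_(k < n) g k.
Proof.
move=> g0 gS ni; rewrite -(big_mkord xpredT (fun j => g ((j - i) + (i - j))%N)).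
rewrite (big_cat_nat (leq0n i) (ltnW ni)) /= -(big_mkord xpredT g) mulr_natl mulr2n.
have mono m1 m2 : (m1 <= m2)%N -> \sum_(0 <= k < m1) g k <= \sum_(0 <= k < m2) g k.
  by move=> m12; rewrite [leRHS](big_cat_nat (leq0n m1) m12)/= lerDl sumr_ge0.
apply: lerD.
  rewrite big_nat_rev /= add0n; apply: le_trans (mono _ _ (ltnW ni)).
  rewrite big_nat [leRHS]big_nat; apply: ler_sum => k /andP[_ ki].
  by rewrite (_ : _ + _ = k.+1)%N; [exact: gS|clear -ki; lia].
rewrite -{1}(add0n i) big_addn; apply: le_trans (mono _ _ (leq_subr i n)).
rewrite big_nat [leRHS]big_nat; apply: ler_sum => k _.
by rewrite (_ : _ + _ = k)%N; [|clear; lia].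
Qed.

Lemma natr_dist (i j : nat) : `|j%:R - i%:R| = ((j - i) + (i - j))%:R :> R.
Proof.
have [ij|/ltnW ij] := leqP i j.
  by rewrite -natrB// ger0_norm// (eqP ij) addn0.
by rewrite distrC -natrB// ger0_norm// (eqP ij).
Qed.

(** A convergent series replaces the logarithm: [1 / k <= n ^ c * k ^ (- (1 + c))] for
    [1 <= k <= n]. *)
Lemma harmonic_le c n i : 0 < c -> (i < n)%N ->
  \sum_(j < n) (1 + `|j%:R - i%:R|)^-1 <= 2 * (n%:R `^ c * (1 + c^-1)) :> R.
Proof.
move=> c0 ni.
apply: (@le_trans _ _ (\sum_(j < n) n%:R `^ c * (((j - i) + (i - j)).+1)%:R `^ (- (1 + c)))).
  apply: ler_sum => j _; rewrite natr_dist nat1r.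
  set k := ((j - i) + (i - j))%N.
  have kn : (k.+1 <= n)%N by have := ltn_ord j; rewrite /k; clear -ni; lia.
  rewrite opprD powRD; last by apply/implyP => _; rewrite pnatr_eq0.
  rewrite powR_inv1// mulrCA ler_peMr ?invr_ge0//.
  rewrite powRN ler_pdivlMr ?powR_gt0// mul1r.
  by apply: ge0_ler_powR; rewrite ?nnegrE ?(ltW c0)// ler_nat.
rewrite -mulr_sumr mulrCA ler_wpM2l ?powR_ge0//.
apply: le_trans (@sum_dist_le (fun k => (k.+1)%:R `^ (- (1 + c))) n i _ _ ni) _.
- by move=> k; exact: powR_ge0.
- move=> k; rewrite !powRN lef_pV2 ?posrE ?powR_gt0//.
  by apply: ge0_ler_powR; rewrite ?nnegrE ?ler_nat// addr_ge0 ?(ltW c0).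
- by rewrite ler_pM2l// pow_sum.
Qed.

Lemma harmonic_le_powR c T n i : 0 < c <= 1 -> 0 < T -> n%:R <= 6 * T -> (i < n)%N ->
  \sum_(j < n) (1 + `|j%:R - i%:R|)^-1 <= 12 * (1 + c^-1) * T `^ c :> R.
Proof.
move=> /andP[c0 c1] T0 nT ni; apply: le_trans (harmonic_le c0 ni) _.
rewrite (_ : 12 * (1 + c^-1) * T `^ c = 2 * (6 * T `^ c * (1 + c^-1))); last by ring.
rewrite ler_pM2l// ler_wpM2r ?addr_ge0 ?invr_ge0 ?(ltW c0)//.
apply: (@le_trans _ _ ((6 * T) `^ c)).
  by apply: ge0_ler_powR; rewrite ?nnegrE ?(ltW c0) ?mulr_ge0 ?(ltW T0).
by rewrite powRM ?(ltW T0)// ler_pM2r ?powR_gt0// -[leRHS]powRr1// ler_powR// ler1n.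
Qed.

Variable zeta : C -> C.
Hypothesis hzeta : is_riemann_zeta zeta.

Lemma size_zeros_le a T (s : seq C) : uniq s -> {in s, forall z, zeta_zeros zeta a T z} ->
  ((size s)%:R%:E <= zeta_N zeta a T)%E.
Proof.
move=> us sZ; apply: esum_ge; exists [set` s].
  by split; [exact: finite_seq|move=> z /= /sZ].
rewrite -fsbig_seq//.
apply: (@le_trans _ _ (\sum_(z <- s) 1%:E)%E).
  by rewrite sumEFin big_const_seq count_predT iter_addr_0.
rewrite big_seq [leRHS]big_seq; apply: lee_sum => z /sZ[z1 zz _ _].
by apply: zero_order_ge1 => //; exact: hzeta.1.
Qed.

Lemma zeta_N_ge0 a T : (0 <= zeta_N zeta a T)%E.
Proof.
apply: esum_ge0 => z [z1 _ _ _]; apply: zero_order_ge0; exact: hzeta.1.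
Qed.

Lemma count_zeros_le a x T n (P : pred nat) (z : nat -> C) :
  (forall j, (j < n)%N -> P j -> zeta_zeros zeta a T (z j) /\ `|Im (z j) - (j%:R - x)| <= 5) ->
  ((\sum_(j < n | P j) 1)%:E <= 11%:E * zeta_N zeta a T)%E.
Proof.
move=> HP.
(* Indices in the same class modulo 11 have distinct zeros. *)
have cl (r : 'I_11) : ((\sum_(j < n | P j && (j %% 11 == r)%N) 1)%:E <= zeta_N zeta a T)%E.
  pose s := [seq z j | j <- iota 0 n & P j && (j %% 11 == r)%N].
  have := @size_zeros_le a T s.
  have -> : ((size s)%:R = \sum_(j < n | P j && (j %% 11 == r)%N) 1 :> R).
    rewrite size_map size_filter -sum1_count natr_sum.
    by rewrite -(big_mkord (fun j => P j && (j %% 11 == r)%N) (fun=> 1)) /index_iota subn0.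
  apply.
    rewrite map_inj_in_uniq ?filter_uniq ?iota_uniq// => j k.
    rewrite !mem_filter !mem_iota add0n /= => /andP[/andP[Pj jr] jn] /andP[/andP[Pk kr] kn] zz.
    have [_] := HP j jn Pj; have [_] := HP k kn Pk; rewrite -zz.
    rewrite !ler_norml => /andP[h1 h2] /andP[h3 h4].
    have j1 : (j <= k + 10)%N by rewrite -(ler_nat R) natrD; clear -h1 h2 h3 h4; lra.
    have k1 : (k <= j + 10)%N by rewrite -(ler_nat R) natrD; clear -h1 h2 h3 h4; lra.
    by move: jr kr j1 k1; clear => /eqP jr /eqP kr; lia.
  move=> w /mapP[j]; rewrite mem_filter mem_iota add0n /= => /andP[/andP[Pj _] jn] ->.
  by case: (HP j jn Pj).
rewrite (partition_big (fun j : 'I_n => inord (j %% 11)%N : 'I_11) xpredT)//=.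
apply: (@le_trans _ _ (\sum_(r < 11) zeta_N zeta a T)%E).
  rewrite -sumEFin; apply: lee_sum => r _; apply: le_trans (cl r).
  rewrite le_eqVlt; apply/orP; left; apply/eqP; congr (_%:E); apply: eq_bigl => j.
  by rewrite -val_eqE /= inordK// ltn_pmod.
by rewrite sumr_const card_ord mule_natl.
Qed.

End Counting.

(** * Large values *)

Section LargeValues.
Variable R : realType.
Local Notation C := R[i].
Local Notation Re := complex.Re.
Local Notation Im := complex.Im.
Implicit Types (a c x T : R) (z w : C).
Variable zeta : C -> C.
Hypothesis hzeta : is_riemann_zeta zeta.

(** If a strip within 3 of the height has positive level, its own term is large enough. Otherwise
    [dirichlet_bound] applies, and its truncation error and the strips of level 0 each account for
    at most a quarter of [M ^ (- nu)]; the rest must come from positive levels. *)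
Lemma large_index (eps nu T M t dt : R) (l : nat -> nat) (N i n1 n2 : nat) :
  let dl := eps / 8 in let dl' := eps ^+ 2 / 16 in
  let y j := j%:R - N%:R : R in
  let x j := 1 - nu - eps / 2 + (l j)%:R * dt + dl in
  0 < eps <= 2^-1 -> 0 <= nu <= 2^-1 -> 0 <= dt ->
  (forall j, (l j)%:R * dt <= nu + eps / 2) ->
  1 + dl^-1 <= T `^ dl' -> 768 <= T `^ 8^-1 ->
  1440 / dl * (1 + dl'^-1) <= T `^ dl' -> 60 / dl <= T `^ (dl / 4) ->
  16 <= T -> 2 * T <= N%:R -> N%:R <= 3 * T -> `|t| <= T ->
  T `^ eps <= M -> M <= T `^ 2^-1 ->
  (0 < n1)%N -> M / 2 <= n1%:R -> n1%:R <= n2%:R :> R -> n2%:R <= 2 * M ->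
  (forall j w, (j < N + N)%N -> y j <= Im w <= y j.+1 -> x j <= Re w ->
     w != 1 /\ cmod (zeta w) <= T `^ dl') ->
  y i <= t <= y i.+1 ->
  M `^ (- nu) <=
    cmod (\sum_(k < n2) dterm k.+1 (1 +i* t) - \sum_(k < n1) dterm k.+1 (1 +i* t)) ->
  (i < N + N)%N /\
  T `^ (- dl) <= \sum_(j < N + N | (0 < l j)%N) T `^ ((l j)%:R * dt / 2) / (1 + `|j%:R - i%:R|).
Proof.
move=> dl dl' y x /andP[e0 e1] /andP[nu0 nu1] dt0 ldt Ta Tb Tc Td T16 TN NT tT TM MT n10 Mn1 n12 n2M hz
  ti large.
set G := \sum_(j < N + N | _) _.
have dl0 : 0 < dl by rewrite /dl divr_gt0.
have dlE : dl <= 16^-1 by rewrite /dl; clear -e1; lra.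
have dl'0 : 0 < dl' by rewrite /dl' divr_gt0 ?exprn_gt0.
have dl'4 : dl' <= dl / 4.
  rewrite /dl' /dl expr2; have : eps * eps <= eps * 2^-1 by rewrite ler_pM2l.
  by clear; lra.
have eE : eps = 8 * dl by rewrite /dl; field.
have e2E : eps * (3 * dl) = 6 * dl' by rewrite /dl' /dl; field.
have T0 : 0 < T by clear -T16; lra.
have T1 : 1 <= T by clear -T16; lra.
have Tp a : 0 < T `^ a by exact: powR_gt0.
have TD a b : T `^ (a + b) = T `^ a * T `^ b.
  by rewrite powRD//; apply/implyP => _; rewrite gt_eqF.
have Tm a b : a <= b -> T `^ a <= T `^ b by move=> ab; rewrite ler_powR.
have iN : (i.+4 < N + N)%N.
  rewrite -(ltr_nat R) natrD; have [t1 _] := andP ti; move: tT; rewrite ler_norml => /andP[_ t2].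
  by rewrite -(natr1 i.+3) -(natr1 i.+2) -(natr1 i.+1) -(natr1 i); move: t1; rewrite /y;
    clear -T16 TN t2; lra.
split; first by clear -iN; lia.
(* Such a strip contributes at least [1 / 4 >= T ^ (- dl)]. *)
have [|no] := boolP [exists j : 'I_(N + N), [&& (0 < l j)%N, (j <= i + 3)%N & (i <= j + 3)%N]].
  move=> /existsP[j /and3P[lj j1 j2]].
  apply: (@le_trans _ _ 4^-1).
    rewrite powRN lef_pV2 ?posrE//; apply: le_trans (_ : T `^ (dl / 4) <= _); last first.
      by apply: Tm; clear -dl0; lra.
    apply: le_trans Td; rewrite ler_pdivlMr//; clear -dlE; lra.
  rewrite /G (bigD1 j)//= ler_wpDr//.
    by apply: sumr_ge0 => k _; rewrite divr_ge0// ?powR_ge0// addr_ge0.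
  rewrite -[leLHS]mul1r; apply: ler_pM; rewrite ?invr_ge0//.
    by rewrite -[leLHS](powRr0 T) Tm// divr_ge0// mulr_ge0.
  rewrite lef_pV2 ?posrE ?ltr_wpDr//.
  rewrite natr_dist nat1r ler_nat; clear -j1 j2; lia.
have near j : (j <= i + 3)%N -> (i <= j + 3)%N -> l j = 0%N.
  move=> j1 j2; have jN : (j < N + N)%N by clear -iN j1; lia.
  move: no; rewrite negb_exists => /forallP/(_ (Ordinal jN)) /=.
  by rewrite j1 j2 !andbT -eqn0Ngt => /eqP.
have M1 : 1 <= M by apply: le_trans TM; rewrite -[leLHS](powRr0 T) Tm// ltW.
have M0 : 0 < M by exact: lt_le_trans M1.
have MD a b : M `^ (a + b) = M `^ a * M `^ b.
  by rewrite powRD//; apply/implyP => _; rewrite gt_eqF.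
have MTp a : 0 <= a -> M `^ a <= T `^ (a / 2).
  move=> a0; rewrite [a / 2]mulrC powRrM; apply: ge0_ler_powR; rewrite ?nnegrE ?powR_ge0 ?(ltW M0)//.
have T4 : 4 <= T by clear -T16; lra.
have dk : 0 < dl <= 4^-1 by rewrite dl0 (le_trans dlE)// lef_pV2 ?posrE// ler_nat.
have x0k : 1 - nu - eps / 2 + dl <= 1 - 2 * dl by rewrite eE; clear -nu0 dl0; lra.
have hx j : 4^-1 <= x j <= 1 + dl.
  have : 0 <= (l j)%:R * dt by rewrite mulr_ge0.
  by have := ldt j; rewrite /x; clear -e0 e1 nu1 dl0 => h1 h2; apply/andP; split; lra.
have nearx j : (j <= i + 3)%N -> (i <= j + 3)%N -> x j = 1 - nu - eps / 2 + dl.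
  by move=> j1 j2; rewrite /x near// mul0r addr0.
have := dirichlet_bound hzeta dk dk x0k (ltW (Tp dl')) T4 TN tT M1 n10 Mn1 n12 n2M hx hz ti nearx.
set S0 := \sum_(j < N + N) _; move=> /(le_trans large) {large} D.
pose m := M `^ (- nu).
have m0 : 0 < m by exact: powR_gt0.
(* [M <= T ^ (1 / 2)] bounds the error by about [T ^ (- 1 / 2)] and [M ^ (- nu)] from below by
   [T ^ (- 1 / 4)]. The gap exceeds [T ^ (1 / 8)], which pays for [768 = 4 * (12 + 180)]. *)
have B1 : (12 * T `^ dl' + 180 * (1 + dl^-1)) * (M `^ (1 + dl) / T) <= m / 4.
  have mT : T `^ (- 4^-1) <= m.
    rewrite /m !powRN lef_pV2 ?posrE ?powR_gt0//.
    by apply: le_trans (MTp _ nu0) _; apply: Tm; clear -nu1; lra.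
  have X : M `^ (1 + dl) / T <= T `^ (dl / 2 - 2^-1).
    rewrite ler_pdivrMr// -{2}[T]powRr1 ?(ltW T0)// -TD.
    apply: le_trans (MTp _ _) _; first by rewrite addr_ge0// ltW.
    by apply: Tm; clear; lra.
  apply: (@le_trans _ _ (192 * T `^ dl' * T `^ (dl / 2 - 2^-1))).
    have a0 : 0 <= 1 + dl^-1 by rewrite addr_ge0// invr_ge0 ltW.
    apply: ler_pM; last exact: X.
    - by apply: addr_ge0; apply: mulr_ge0 => //; exact: ltW.
    - by rewrite divr_ge0 ?powR_ge0// ltW.
    by move: Ta; move: (T `^ dl') (dl^-1) => p q; clear; lra.
  have : T `^ dl' * T `^ (dl / 2 - 2^-1) * T `^ 8^-1 <= T `^ (- 4^-1).
    by rewrite -!TD; apply: Tm; move: dlE dl'4; clear; lra.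
  have q0 : 0 < T `^ dl' * T `^ (dl / 2 - 2^-1) by rewrite mulr_gt0.
  have : T `^ dl' * T `^ (dl / 2 - 2^-1) * 768 <= T `^ dl' * T `^ (dl / 2 - 2^-1) * T `^ 8^-1.
    by rewrite ler_pM2l.
  rewrite -(mulrA 192); move: (T `^ dl' * _) mT => q; clear; lra.
have B2 : S0 <= m * (12 * (1 + dl'^-1) * T `^ (- (5 * dl'))) + m * T `^ (dl / 2) * G.
  rewrite /S0 (bigID (fun j : 'I_(N + N) => (0 < l j)%N)) /= addrC; apply: lerD; last first.
    rewrite /G mulr_sumr; apply: ler_sum => j lj; rewrite mulrA.
    rewrite ler_wpM2r ?invr_ge0 ?addr_ge0// -mulrA -TD.
    (* The term [- eps / 2] is dropped; the remaining exponent is nonnegative, so [M <= T ^ (1 / 2)]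
       halves it. *)
    rewrite (_ : x j - 1 = - nu + (- eps / 2 + (l j)%:R * dt + dl)); last by rewrite /x; ring.
    rewrite MD ler_pM2l//.
    apply: (@le_trans _ _ (M `^ ((l j)%:R * dt + dl))).
      by rewrite ler_powR//; clear -e0; lra.
    apply: le_trans (MTp _ _) _; first by rewrite addr_ge0 ?mulr_ge0// ltW.
    by apply: Tm; clear; lra.
  (* Level 0 has [x j - 1 = - nu - 3 * dl]. Since [M >= T ^ eps], the surplus is
     [T ^ (- 3 * eps * dl)], that is six times [dl'] in the exponent. *)
  have MS : M `^ (- (3 * dl)) <= T `^ (- (6 * dl')).
    rewrite !powRN lef_pV2 ?posrE ?powR_gt0// -e2E powRrM.
    by apply: ge0_ler_powR; rewrite ?nnegrE ?powR_ge0 ?(ltW M0)// mulr_ge0// ltW.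
  apply: (@le_trans _ _ (\sum_(j < N + N) m * T `^ (- (6 * dl')) / (1 + `|j%:R - i%:R|))).
    rewrite big_mkcond; apply: ler_sum => j _; case: ifPn => [|_]; last first.
      by rewrite divr_ge0 ?mulr_ge0 ?powR_ge0 ?addr_ge0.
    rewrite -eqn0Ngt => /eqP lj.
    rewrite ler_wpM2r ?invr_ge0 ?addr_ge0//.
    rewrite (_ : x j - 1 = - nu + - (3 * dl)); last by rewrite /x lj mul0r /dl; field.
    by rewrite MD ler_pM2l.
  rewrite -mulr_sumr -mulrA ler_pM2l//.
  rewrite (_ : - (5 * dl') = - (6 * dl') + dl'); last by ring.
  rewrite TD (mulrCA (12 * _)) ler_pM2l//; apply: harmonic_le_powR => //.
  - by rewrite dl'0; move: dl'4 dlE; clear; lra.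
  - by rewrite natrD; clear -NT; lra.
  - exact: ltnW (ltnW (ltnW (ltnW iN))).
(* Of the saving [6 * dl'] one [dl'] went to the harmonic sum; two more cover the bound for [zeta]
   and the constants. *)
have B3 : 30 * T `^ dl' / dl * (m * (12 * (1 + dl'^-1) * T `^ (- (5 * dl')))) <= m / 4.
  rewrite (_ : 30 * T `^ dl' / dl * (m * (12 * (1 + dl'^-1) * T `^ (- (5 * dl')))) =
    1440 / dl * (1 + dl'^-1) * (T `^ dl' * T `^ (- (5 * dl'))) * (m / 4)); last first.
    by field; rewrite !gt_eqF.
  apply: ler_piMl; first by apply: divr_ge0; [exact: ltW|].
  apply: (@le_trans _ _ (T `^ dl' * (T `^ dl' * T `^ (- (5 * dl'))))).
    by rewrite ler_pM2r// mulr_gt0.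
  by rewrite -!TD -[leRHS](powRr0 T); apply: Tm; clear -dl'0; lra.
have G0 : 0 <= G.
  by apply: sumr_ge0 => j _; rewrite divr_ge0 ?powR_ge0 ?addr_ge0.
have B4 : m / 2 <= m * (30 / dl * T `^ (dl' + dl / 2) * G).
  have : 30 * T `^ dl' / dl * S0 <=
      30 * T `^ dl' / dl * (m * (12 * (1 + dl'^-1) * T `^ (- (5 * dl'))) + m * T `^ (dl / 2) * G).
    by rewrite ler_wpM2l// !mulr_ge0 ?invr_ge0 ?powR_ge0 ?(ltW dl0).
  rewrite mulrDr (_ : 30 * T `^ dl' / dl * (m * T `^ (dl / 2) * G) =
    m * (30 / dl * T `^ (dl' + dl / 2) * G)); last by rewrite TD; ring.
  by move: D B1 B3; rewrite -/m; clear; lra.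
rewrite powRN -[leLHS]mul1r ler_pdivrMr// mulrC.
have {}B4 : 1 <= 60 / dl * T `^ (dl' + dl / 2) * G.
  move: B4; rewrite ler_pM2l// (_ : 60 / dl * _ * G = 2 * (30 / dl * T `^ (dl' + dl / 2) * G)).
    by clear; lra.
  by ring.
apply: le_trans B4 _; rewrite ler_wpM2r//.
(* The losses add up to [dl / 4 + dl' + dl / 2 <= dl]. *)
apply: (@le_trans _ _ (T `^ (dl / 4) * T `^ (dl' + dl / 2))); first by rewrite ler_pM2r.
by rewrite -TD; apply: Tm; clear -dl'4; lra.
Qed.

End LargeValues.


(** * From large values to a count of strips *)

Section Measure.
Variable R : realType.
Local Notation C := R[i].
Local Notation Re := complex.Re.
Local Notation Im := complex.Im.
Implicit Types (a c x y T : R) (z w : C).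

Lemma dirichlet_sumE (M M' t : R) : 0 <= M <= M' ->
  dirichlet_sum M M' t = \sum_(k < Num.truncn M') dterm k.+1 (1 +i* t) -
    \sum_(k < Num.truncn M) dterm k.+1 (1 +i* t).
Proof.
move=> /andP[M0 MM']; rewrite /dirichlet_sum.
set n2 := Num.truncn M'; set n1 := Num.truncn M.
have n12 : (n1 <= n2)%N.
  by rewrite truncn_ge_nat ?(le_trans M0)// (le_trans _ MM')// -truncn_ge_nat.
have -> : [set m : nat | M < m%:R <= M'] = [set` index_iota n1.+1 n2.+1].
  apply/seteqP; split => m /=; rewrite mem_index_iota ltnS.
    by rewrite truncn_lt_nat// truncn_ge_nat// (le_trans M0).
  by rewrite truncn_lt_nat// truncn_ge_nat// (le_trans M0).
rewrite -fsbig_seq ?iota_uniq// big_add1 /=.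
rewrite -!(big_mkord xpredT (fun k => dterm k.+1 (1 +i* t))).
rewrite (big_cat_nat (leq0n n1) n12)/= addrAC subrr add0r.
by apply: eq_bigr => k _; rewrite dtermE.
Qed.

(** Capping at [J] makes the minimum exist. Badness of all lower levels is what later yields a zero
    at level [l j - 1]. *)
Lemma first_good (bad : nat -> nat -> Prop) J : exists l : nat -> nat, forall j,
  [/\ (l j <= J)%N, l j = J \/ ~ bad (l j) j & forall k, (k < l j)%N -> bad k j].
Proof.
have ex j : exists k, (k == J) || ~~ `[< bad k j >] by exists J; rewrite eqxx.
exists (fun j => ex_minn (ex j)) => j; case: ex_minnP => m mJ min; split.
- by apply: min; rewrite eqxx.
- by case/orP: mJ => [/eqP|/asboolPn]; [left|right].
- move=> k km; apply: contrapT => nb; have := min k; rewrite leqNgt km => H.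
  by have := H; rewrite asboolF// orbT => /(_ isT).
Qed.

(** [A] is arbitrary: monotonicity is that of the outer measure, and measurability concerns the
    covering intervals only. *)
Lemma unit_cover_le (A : set R) y n (b : pred nat) :
  (forall t, A t -> exists2 i, (i < n)%N && b i & i%:R - y <= t <= (i.+1)%:R - y) ->
  (lebesgue_measure A <= (\sum_(i < n | b i) 1)%:E)%E.
Proof.
move=> HA; pose I i : set R := if b i then `[i%:R - y, (i.+1)%:R - y]%classic else set0.
have mI i : measurable (I i) by rewrite /I; case: ifP => // _; exact: measurable_itv.
apply: (@le_trans _ _ (lebesgue_measure (\big[setU/set0]_(i < n) I i))).
  apply: le_mu_ext => t /HA[i /andP[ni bi] ti].
  by rewrite -bigcup_mkord; exists i => //=; rewrite /I bi /= in_itv.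
apply: (@le_trans _ _ (\sum_(i < n) lebesgue_measure (I i))%E).
  by apply: (@Boole_inequality _ _ _ lebesgue_measure) => i _; exact: mI.
rewrite -sumEFin [leRHS]big_mkcond; apply: lee_sum => i _; rewrite /I; case: ifP => _.
  rewrite lebesgue_measure_itv /= lte_fin ltrD2r ltr_nat ltnSn -EFinB lee_fin -natr1.
  by rewrite (_ : _ - _ = 1); [|ring].
by rewrite measure0.
Qed.

Lemma count_near_le (n N : nat) : \sum_(j < n | `|j%:R - N%:R : R| <= 12) 1 <= 25 :> R.
Proof.
rewrite -(big_mkord (fun j : nat => `|j%:R - N%:R : R| <= 12) (fun=> 1)) /index_iota subn0.
rewrite big_const_seq iter_addr_0 ler_nat -size_filter.
(* For [N < 12] the truncated [N - 12] is 0, and the 25 indices from 0 still contain those at most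
   [N + 12]. *)
rewrite -(size_iota (N - 12) 25); apply: uniq_leq_size; first by rewrite filter_uniq// iota_uniq.
move=> j; rewrite mem_filter !mem_iota natr_dist => /andP[jN _].
by move: jN; rewrite (ler_nat R _ 12); lia.
Qed.

End Measure.

Section LargeMeasure.
Variable R : realType.
Local Notation C := R[i].
Local Notation Re := complex.Re.
Local Notation Im := complex.Im.
Implicit Types (a c x T : R) (z w s : C).
Variable zeta : C -> C.
Hypothesis hzeta : is_riemann_zeta zeta.

(** [c k] counts the strips with a zero of real part at least [alpha k] nearby. The estimate is
    Markov's inequality over integer heights, followed by summing the weights [1 / (1 + |j - i|)]
    over the heights first. *)
Lemma large_measure (eps nu T : R) (J : nat) :
  let dl := eps / 8 in let dl' := eps ^+ 2 / 16 in
  let dt := (nu + eps / 2) / J%:R in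
  let alpha k := 1 - nu - eps / 2 + k%:R * dt in
  0 < eps <= 2^-1 -> 0 <= nu <= 2^-1 -> (0 < J)%N -> 8 / eps <= J%:R ->
  1 + dl^-1 <= T `^ dl' -> 768 <= T `^ 8^-1 ->
  1440 / dl * (1 + dl'^-1) <= T `^ dl' -> 60 / dl <= T `^ (dl / 4) -> 16 <= T ->
  (forall sg tau : R, 4^-1 <= sg <= 1 -> 10 <= `|tau| <= 4 * T ->
    (forall z, sg <= Re z -> `|Im z - tau| <= 4 -> zeta z != 0) ->
    forall s, Im s = tau -> sg + dl <= Re s -> cmod (zeta s) <= T `^ dl') ->
  exists2 c : nat -> R, forall k, ((c k)%:E <= 11%:E * zeta_N zeta (alpha k) (10 * T)%R)%E &
  (lebesgue_measure (large_value_set eps nu T) <= (25 * T `^ (nu / 2 + eps) +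
    T `^ eps * \sum_(k < J) T `^ ((alpha k - (1 - nu)) / 2) * c k)%:E)%E.
Proof.
move=> dl dl' dt alpha e01 nu01 J0 eJ Ta Tb Tc Td T16 HZ.
have [e0 e1] := andP e01; have [nu0 nu1] := andP nu01.
have J0' : 0 < J%:R :> R by rewrite ltr0n.
have dl0 : 0 < dl by rewrite /dl divr_gt0.
have dl'0 : 0 < dl' by rewrite /dl' divr_gt0 ?exprn_gt0.
have dl'4 : dl' <= dl / 4.
  rewrite /dl' /dl expr2; have : eps * eps <= eps * 2^-1 by rewrite ler_pM2l.
  by clear; lra.
have dt0 : 0 <= dt by rewrite divr_ge0// addr_ge0// divr_ge0// ltW.
have JdE : J%:R * dt = nu + eps / 2 by rewrite /dt mulrC divfK// gt_eqF.
(* Levels are so close that passing from one to the next costs at most [T ^ (eps / 16)]. *)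
have dt8 : dt <= eps / 8.
  rewrite ler_pdivrMr//; apply: (@le_trans _ _ 1); first by clear -e1 nu1; lra.
  by rewrite -[leLHS](divff (lt0r_neq0 dl0)) /dl invf_div ler_pM2l.
have T0 : 0 < T by clear -T16; lra.
have T1 : 1 <= T by clear -T16; lra.
have Tp a : 0 < T `^ a by exact: powR_gt0.
have TD a b : T `^ (a + b) = T `^ a * T `^ b.
  by rewrite powRD//; apply/implyP => _; rewrite gt_eqF.
have Tm a b : a <= b -> T `^ a <= T `^ b by move=> ab; rewrite ler_powR.
pose N := (Num.truncn (2 * T)).+1.
have TN : 2 * T <= N%:R by apply/ltW/truncnS_gt.
have NT : N%:R <= 3 * T.
  have := truncn_le (2 * T); rewrite /N -natr1 mulr_ge0 ?(ltW T0)// => h.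
  by clear -h T16; lra.
pose y j : R := j%:R - N%:R.
(* Here 5 is the radius 4 of [zeta_zero_free] plus the height 1 of a strip. *)
pose zer k j z := zeta_zeros zeta (alpha k) (10 * T) z /\ `|Im z - y j| <= 5.
pose bad k j := `|y j| <= 12 \/ exists z, zer k j z.
(* [alpha (l j)] is the level of the [j]-th strip; near the pole it is [alpha J = 1]. *)
have [l Hl] := first_good bad J.
have lJ j : (l j)%:R * dt <= nu + eps / 2.
  by rewrite -JdE ler_wpM2r// ler_nat; case: (Hl j).
pose x j := 1 - nu - eps / 2 + (l j)%:R * dt + dl.
have yN j : (j <= N + N)%N -> `|y j| <= N%:R.
  rewrite -(ler_nat R) natrD /y ler_norml => jN; have := ler0n R j; clear -jN => j0.
  by apply/andP; split; lra.
have hz j w : (j < N + N)%N -> y j <= Im w <= y j.+1 -> x j <= Re w ->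
    w != 1 /\ cmod (zeta w) <= T `^ dl'.
  move=> jN wy xw; have [_ [lJE|nb] _] := Hl j.
    have {}xw : 1 + dl <= Re w.
      by apply: le_trans xw; rewrite /x lJE JdE; clear; lra.
    split; last by apply: le_trans (zeta_bound hzeta dl0 xw) Ta.
    by apply: contraTneq xw => ->; rewrite /= -ltNge ltrDl.
  have y12 : 12 < `|y j| by rewrite ltNge; apply/negP => h; apply: nb; left.
  have wyj : `|Im w - y j| <= 1.
    move: wy; rewrite /y -natr1 ler_norml; clear => /andP[? ?].
    by apply/andP; split; lra.
  have w11 : 11 <= `|Im w|.
    have := ler_normB (Im w) (Im w - y j); rewrite (_ : Im w - (Im w - y j) = y j); last by ring.
    by move: y12 wyj; clear; lra.
  have w4 : `|Im w| <= 4 * T.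
    have := ler_normD (Im w - y j) (y j); rewrite subrK.
    by have := yN j (ltnW jN); move: wyj NT T16; clear; lra.
  have w1 : w != 1 by apply: contraTneq w11 => ->; rewrite /= normr0 -ltNge.
  split=> //; apply: (HZ (alpha (l j)) (Im w)) => //.
  - have : 0 <= (l j)%:R * dt by rewrite mulr_ge0.
    have := lJ j; rewrite /alpha; clear -e1 nu1 => h1 h2.
    by apply/andP; split; lra.
  - by rewrite w4 andbT; clear -w11; lra.
  - move=> z az zw; apply/eqP => z0; apply: nb; right; exists z.
    have zy : `|Im z - y j| <= 5.
      have := ler_normD (Im z - Im w) (Im w - y j); rewrite addrA subrK.
      by move: zw wyj; clear; lra.
    have zT : `|Im z| <= 10 * T.
      have := ler_normD (Im z - Im w) (Im w); rewrite subrK.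
      by move: zw w4 T16; clear; lra.
    split=> //; split=> //; apply/eqP => z1; move: zw; rewrite z1 /= sub0r normrN.
    by move: w11; clear; lra.
pose c k : R := \sum_(j < N + N | `[< exists z, zer k j z >]) 1.
exists c => [k|].
  have ex j : exists z, (exists z, zer k j z) -> zer k j z.
    by have [[z zz]|no] := pselect (exists z, zer k j z); [exists z|exists 0].
  have [z zE] := choice ex.
  apply: (@count_zeros_le _ _ hzeta (alpha k) N%:R (10 * T) (N + N) (fun j => `[< exists z, zer k j z >]) z).
  by move=> j _ /asboolP /zE.
pose g j i := T `^ ((l j)%:R * dt / 2) / (1 + `|j%:R - i%:R|).
have g0 j i : 0 <= g j i by rewrite divr_ge0 ?powR_ge0// addr_ge0.
pose G i := \sum_(j < N + N | (0 < l j)%N) g j i.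
apply: (@le_trans _ _ (\sum_(i < N + N | T `^ (- dl) <= G i) 1)%:E).
  apply: (@unit_cover_le _ _ N%:R (N + N) (fun i => T `^ (- dl) <= G i)) => t /=.
  rewrite /large_value_set /= in_itv /= => -[/andP[t1 t2] [M [M' []]]].
  rewrite !in_itv /= => /andP[M1 M2] /andP[MM' M'2].
  have TM : 1 <= M by apply: le_trans M1; rewrite -[leLHS](powRr0 T) Tm// ltW.
  have M0 : 0 <= M by exact: le_trans TM.
  have M'0 : 0 <= M' by rewrite (le_trans M0)// ltW.
  rewrite dirichlet_sumE ?M0 ?(ltW MM')// normr_cmod lecR => large.
  have tN0 : 0 <= t + N%:R by clear -t1 TN T0; lra.
  pose i := Num.truncn (t + N%:R).
  have ti : y i <= t <= y i.+1.
    by rewrite /y lerBlDr truncn_le tN0 /= lerBrDr ltW// truncnS_gt.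
  have n10 : (0 < Num.truncn M)%N by rewrite truncn_gt0.
  have tM : (Num.truncn M)%:R <= M by rewrite truncn_le.
  have tM' : (Num.truncn M')%:R <= M' by rewrite truncn_le.
  have tT : `|t| <= T by rewrite ler_norml t1.
  have MT : M <= T `^ 2^-1.
    by apply: le_trans M2 _; rewrite div1r; have := Tp 2^-1; clear; lra.
  have Mn1 : M / 2 <= (Num.truncn M)%:R.
    have : M < (Num.truncn M).+1%:R by exact: truncnS_gt.
    by move: n10; rewrite -(ler_nat R) -natr1; clear; lra.
  have n12 : (Num.truncn M)%:R <= (Num.truncn M')%:R :> R.
    by rewrite ler_nat truncn_ge_nat// (le_trans tM)// ltW.
  have [iN Gi] := large_index hzeta e01 nu01 dt0 lJ Ta Tb Tc Td T16 TN NT tT M1 MT n10 Mn1 n12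
    (le_trans tM' M'2) hz ti large.
  by exists i; rewrite ?iN.
rewrite lee_fin.
have H i : (i < N + N)%N -> \sum_(j < N + N) (1 + `|j%:R - i%:R|)^-1 <= T `^ (2 * dl').
  move=> iN; apply: (@le_trans _ _ (12 * (1 + dl'^-1) * T `^ dl')).
    apply: harmonic_le_powR => //.
      by rewrite dl'0; move: dl'4 e1; rewrite /dl; clear; lra.
    by rewrite natrD; clear -NT; lra.
  rewrite (_ : 2 * dl' = dl' + dl'); last by ring.
  rewrite TD ler_pM2r//; apply: le_trans Tc; rewrite ler_wpM2r ?addr_ge0 ?invr_ge0 ?(ltW dl'0)//.
  by rewrite ler_pdivlMr//; move: e1; rewrite /dl; clear; lra.
(* Markov: each counted height has [1 <= T ^ dl * G i]. *)
apply: (@le_trans _ _ (T `^ dl * \sum_(i < N + N) G i)).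
  rewrite mulr_sumr big_mkcond; apply: ler_sum => i _; case: ifPn => [Gi|_].
    by rewrite mulrC -ler_pdivrMr// mul1r -powRN.
  by rewrite mulr_ge0 ?powR_ge0// sumr_ge0.
apply: (@le_trans _ _ (T `^ dl * \sum_(j < N + N | (0 < l j)%N) T `^ ((l j)%:R * dt / 2) * T `^ (2 * dl'))).
  rewrite ler_pM2l// /G exchange_big /=; apply: ler_sum => j _.
  rewrite /g -mulr_sumr ler_pM2l//; apply: le_trans (H j (ltn_ord j)).
  by rewrite le_eqVlt; apply/orP; left; apply/eqP; apply: eq_bigr => i _; rewrite distrC.
rewrite -mulr_suml mulrCA -TD.
(* A strip of positive level is bad one level below. Either it is one of the at most 25 strips near
   the pole, with weight at most that of level [J], or it has a zero at level [k = l j - 1] and is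
   charged to [c k] with the weight of level [k + 1]. *)
have W : \sum_(j < N + N | (0 < l j)%N) T `^ ((l j)%:R * dt / 2) <=
    25 * T `^ (J%:R * dt / 2) + \sum_(k < J) T `^ ((k.+1)%:R * dt / 2) * c k.
  apply: (@le_trans _ _ (\sum_(j < N + N)
      ((if `|j%:R - N%:R : R| <= 12 then 1 else 0) * T `^ (J%:R * dt / 2) +
       \sum_(k < J) T `^ ((k.+1)%:R * dt / 2) * (if `[< exists z, zer k j z >] then 1 else 0)))).
    rewrite big_mkcond; apply: ler_sum => j _.
    have s0 : 0 <= \sum_(k < J) T `^ ((k.+1)%:R * dt / 2) * (if `[< exists z, zer k j z >] then 1 else 0).
      by apply: sumr_ge0 => k _; case: ifP => _; rewrite ?mulr0// mulr1 ltW.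
    have f0 : 0 <= (if `|j%:R - N%:R : R| <= 12 then 1 else 0) * T `^ (J%:R * dt / 2).
      by case: ifP => _; rewrite ?mul0r// mul1r ltW.
    case: ifPn => lj; last exact: addr_ge0.
    have [lJj _ lb] := Hl j.
    have lp : ((l j).-1 < l j)%N by rewrite prednK.
    have [y12|[z zz]] := lb _ lp.
      rewrite ifT// mul1r ler_wpDr//; apply: Tm.
      by rewrite ler_wpM2r// ler_wpM2r// ler_nat.
    rewrite ler_wpDl//.
    have kJ : ((l j).-1 < J)%N by rewrite prednK.
    rewrite (bigD1 (Ordinal kJ))//= prednK// asboolT; last by exists z.
    rewrite mulr1 ler_wpDr//; apply: sumr_ge0 => k _.
    by case: ifP => _; rewrite ?mulr0// mulr1 ltW.
  rewrite big_split /= -mulr_suml; apply: lerD.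
    rewrite ler_pM2r//; apply: le_trans (@count_near_le R (N + N) N).
    by rewrite [leRHS]big_mkcond.
  rewrite exchange_big /=; apply: ler_sum => k _.
  by rewrite -mulr_sumr ler_pM2l// /c [leRHS]big_mkcond.
apply: le_trans (ler_wpM2r (ltW (Tp _)) W) _.
rewrite mulrDl; apply: lerD.
  (* The strips near the pole: [(nu + eps / 2) / 2 + dl + 2 * dl' <= nu / 2 + eps]. *)
  rewrite -(mulrA 25) ler_pM2l// -TD JdE; apply: Tm.
  by move: dl'4; rewrite /dl => h; clear -h e0; lra.
clear Ta Tc HZ; clearbody dl' dt; rewrite mulrC !mulr_sumr; apply: ler_sum => k _.
rewrite !mulrA -!TD ler_wpM2r//; first exact: sumr_ge0.
(* [alpha k - (1 - nu) = k * dt - eps / 2], so the losses [dl], [2 * dl'], [dt / 2] and the shift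
   [eps / 4] must fit into [eps]. *)
apply: Tm; rewrite /alpha (_ : k.+1%:R * dt = k%:R * dt + dt); last by rewrite -(natr1 k) mulrDl mul1r.
by move: dl'4 dt8; rewrite /dl; move: (k%:R * dt) (dl') (dt) => q p r; clear -e0; lra.
Qed.

End LargeMeasure.

Theorem theorem1p2 (R : realType) (zeta : R[i] -> R[i])
    (hzeta : is_riemann_zeta zeta) (eps : R) (heps : 0 < eps) :
  exists2 C : R, 0 < C &
  exists2 C' : R, 0 < C' &
  forall nu T : R, 0 <= nu <= 1 / 2 -> 1 <= T ->
    (lebesgue_measure (large_value_set eps nu T) <=
      C'%:E *
        ((T `^ eps)%:E *
           ereal_sup [set ((T `^ ((alpha - (1 - nu)) / 2))%R)%:E *
                            zeta_N zeta alpha (C * T)%R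
                     | alpha in [set alpha : R | (1 - nu - eps <= alpha <= 1)%R]]
         + (T `^ (nu / 2 + eps))%:E))%E.
Proof.
(* The zeros counted lie within 4 of heights at most [4 T], hence below [10 T]. *)
exists 10 => //.
pose S nu T : \bar R := ereal_sup [set (((T `^ ((alpha - (1 - nu)) / 2))%R)%:E *
  zeta_N zeta alpha (10 * T)%R)%E | alpha in [set alpha : R | (1 - nu - eps <= alpha <= 1)%R]].
have Sub nu T a : 1 - nu - eps <= a <= 1 ->
    ((T `^ ((a - (1 - nu)) / 2))%:E * zeta_N zeta a (10 * T)%R <= S nu T)%E.
  by move=> a1; apply: ereal_sup_ubound; exists a.
have S0 nu T : 0 <= nu -> (0 <= S nu T)%E.
  move=> nu0; apply: le_trans (Sub nu T 1 _).
    by rewrite mule_ge0 ?zeta_N_ge0// lee_fin powR_ge0.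
  by rewrite lexx andbT; clear -nu0 heps; lra.
have [e2|e2] := leP eps 2^-1; last first.
  (* For [eps > 1 / 2] the range of [M] is empty, as [T ^ eps > T ^ (1 / 2) / 2]. *)
  exists 1 => // nu T /andP[nu0 nu1] T1; rewrite -/(S nu T).
  rewrite (_ : large_value_set eps nu T = set0).
    by rewrite measure0 mul1e adde_ge0// ?mule_ge0 ?S0// lee_fin powR_ge0.
  apply/seteqP; split => // t [_ [M [M' []]]]; rewrite in_itv /= => /andP[M1 M2] _ _.
  have := le_trans M1 M2; apply/negP; rewrite -ltNge.
  have : T `^ (1 / 2) <= T `^ eps by rewrite ler_powR// div1r ltW.
  have : 0 < T `^ (1 / 2) by rewrite powR_gt0// (lt_le_trans _ T1).
  by clear; lra.
pose dl := eps / 8; pose dl' := eps ^+ 2 / 16.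
have dl0 : 0 < dl by rewrite /dl divr_gt0.
have dl1 : dl <= 1 by rewrite /dl; clear -e2; lra.
have dl'0 : 0 < dl' by rewrite /dl' divr_gt0 ?exprn_gt0.
have dl40 : 0 < dl / 4 by rewrite divr_gt0.
have [Ta Ta1 HTa] := @powR_large R _ (1 + dl^-1) dl'0.
have h8 : 0 < 8^-1 :> R by rewrite invr_gt0.
have [Tb Tb1 HTb] := powR_large 768 h8.
have [Tc Tc1 HTc] := @powR_large R _ (1440 / dl * (1 + dl'^-1)) dl'0.
have [Td Td1 HTd] := @powR_large R _ (60 / dl) dl40.
have dl01 : 0 < dl <= 1 by rewrite dl0.
have [Te Te1 HTe] := zeta_zero_free hzeta dl01 dl'0.
pose T0 := Ta + Tb + Tc + Td + Te + 16.
pose J := (Num.truncn (8 / eps)).+1.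
have J8 : 8 / eps <= J%:R by apply/ltW/truncnS_gt.
have T00 : 0 <= T0 by rewrite /T0; clear -Ta1 Tb1 Tc1 Td1 Te1; lra.
(* 25 for the strips near the pole, 11 for each of the [J] levels, and [2 * T0] for [T < T0], where
   the trivial bound [2 * T] on the measure is enough because [T ^ (nu / 2 + eps) >= 1]. *)
exists (25 + 11 * J%:R + 2 * T0); first by rewrite ltr_pwDl// ?mulr_ge0// addr_gt0// mulr_gt0// ltr0n.
move=> nu T /andP[nu0 nu1] T1; rewrite -/(S nu T).
have Tp0 : 0 < T by exact: lt_le_trans T1.
have TS0 : (0 <= (T `^ eps)%:E * S nu T)%E by rewrite mule_ge0 ?S0// lee_fin powR_ge0.
have P0 : (0 <= (T `^ (nu / 2 + eps))%:E)%E by rewrite lee_fin powR_ge0.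
have C0 : (0 <= (25 + 11 * J%:R : R)%R%:E)%E by rewrite lee_fin addr_ge0 ?mulr_ge0.
have [TT|TT] := leP T0 T; last first.
  apply: (@le_trans _ _ (lebesgue_measure (`[- T, T]%classic : set R))).
    by apply: le_mu_ext => t [].
  rewrite lebesgue_measure_itv /= lte_fin; case: ifPn => [_|_]; last first.
    by rewrite mule_ge0 ?adde_ge0// lee_fin !addr_ge0// mulr_ge0.
  apply: (@le_trans _ _ ((2 * T0)%R%:E * 1)%E).
    by rewrite mule1 -EFinB lee_fin; clear -TT; lra.
  apply: lee_pmul => //; rewrite ?lee_fin ?mulr_ge0//.
    by rewrite lerDr addr_ge0// mulr_ge0.
  apply: (@le_trans _ _ (T `^ (nu / 2 + eps))%:E); last by rewrite leeDr.
  by rewrite lee_fin -[leLHS](powRr0 T) ler_powR// addr_ge0 ?divr_ge0// ltW.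
have e01 : 0 < eps <= 2^-1 by rewrite heps.
have nu01 : 0 <= nu <= 2^-1 by rewrite nu0 -div1r.
have TTs : [/\ Ta <= T, Tb <= T, Tc <= T, Td <= T & Te <= T] /\ 16 <= T.
  by split; [split|]; move: TT; rewrite /T0; clear -Ta1 Tb1 Tc1 Td1 Te1; lra.
have [[Ta' Tb' Tc' Td' Te'] T16] := TTs.
have [c Hc Hm] := large_measure hzeta e01 nu01 (ltn0Sn _ : (0 < J)%N) J8
  (HTa _ Ta') (HTb _ Tb') (HTc _ Tc') (HTd _ Td') T16 (fun sg tau => HTe T sg tau Te').
apply: le_trans Hm _.
apply: (@le_trans _ _ ((25 + 11 * J%:R)%R%:E * ((T `^ eps)%:E * S nu T + (T `^ (nu / 2 + eps))%:E))%E).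
  rewrite ge0_muleDr// addeC EFinD; apply: leeD.
    by rewrite -EFinM lee_fin ler_wpM2r ?powR_ge0// lerDl mulr_ge0.
  apply: (@le_trans _ _ ((11 * J%:R)%R%:E * ((T `^ eps)%:E * S nu T))%E); last first.
    by rewrite lee_wpmul2r// lee_fin lerDr.
  rewrite [leLHS]EFinM [leRHS]muleCA lee_wpmul2l ?lee_fin ?powR_ge0// -sumEFin.
  (* Every level lies in the range of the supremum, and their number [J] depends on [eps] only. *)
  apply: (@le_trans _ _ (\sum_(k < J) 11%:E * S nu T)%E).
    apply: lee_sum => k _; rewrite EFinM.
    apply: le_trans (lee_wpmul2l _ (Hc k)) _; first by rewrite lee_fin powR_ge0.
    rewrite muleCA lee_wpmul2l ?lee_fin//; apply: Sub.
    have dt0 : 0 <= (nu + eps / 2) / J%:R by rewrite divr_ge0// addr_ge0// divr_ge0// ltW.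
    have k0 : 0 <= k%:R * ((nu + eps / 2) / J%:R) by rewrite mulr_ge0.
    have kJ : k%:R * ((nu + eps / 2) / J%:R) <= nu + eps / 2.
      rewrite mulrCA ler_piMr ?addr_ge0 ?divr_ge0 ?(ltW heps)//.
      by rewrite ler_pdivrMr ?ltr0n// mul1r ler_nat ltnW.
    by move: k0 kJ; move: (k%:R * _) => q; clear -heps; lra.
  have u0 : (0 <= 11%:E * S nu T)%E by rewrite mule_ge0 ?S0// lee_fin.
  rewrite [(11 * _)%R]mulrC EFinM -muleA; move: (11%:E * _)%E u0 => u u0.
  elim: (J) => [|m IH]; first by rewrite big_ord0 mul0e.
  rewrite big_ord_recr /= -natr1 EFinD ge0_muleDl ?lee_fin// mul1e.
  exact: leeD.
by rewrite lee_wpmul2r ?adde_ge0// lee_fin lerDl mulr_ge0.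
Qed.
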